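(* Let $n\ge 1$, let $K\subset\mathbb{R}^n$ be a centrally symmetric convex body, and let $M_\lambda$ be the maximal operator associated with the family $\mathcal{K}$ of all shifts of dilations of $K$. Let $p\in(1,\infty)$ and $\lambda\in(0,1]$. Then there exists a constant $A=A(p,n,\lambda)>1$ such that $$\|M_\lambda f\|_{L^p(\mathbb{R}^n)}\ \ge\ A\,\|f\|_{L^p(\mathbb{R}^n)}\qquad\text{for all } f\in L^p(\mathbb{R}^n) \text{ with } f\ge 0 .$$
   Context: A convex body in $\mathbb{R}^n$ is a compact convex set with non-empty interior. Fix a centrally symmetric convex body $K\subset\mathbb{R}^n$, and let $\mathcal{K}$ be the family of all shifts (translates) of dilations (by positive factors) of $K$. For $\lambda\in[0,1]$ and a centrally symmetric convex body $S$, $\lambda S$ denotes the image of $S$ under the homothety with center the center of $S$ and ratio $\lambda$ (for $\lambda=0$, $\lambda S$ is the one-point set consisting of the center of $S$). For a nonnegative locally integrable function $f$ on $\mathbb{R}^n$, $$(M_\lambda f)(x)=\sup_{S\in\mathcal{K}:\ \lambda S\ni x}\frac{1}{|S|}\int_S f ,$$ where $|S|$ denotes Lebesgue measure. *)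

(* Defs.v *)
From HB Require Import structures.
From mathcomp Require Import all_boot all_order all_algebra.
From mathcomp Require Import all_classical all_reals all_analysis.

Set Implicit Arguments.
Unset Strict Implicit.
Unset Printing Implicit Defensive.

Import Order.TTheory GRing.Theory Num.Theory.
Import numFieldNormedType.Exports.

Local Open Scope classical_set_scope.
Local Open Scope ring_scope.

Definition rV_display : measure_display. Proof. exact: default_measure_display. Qed.

Section rV_measurable.
Context {R : realType}.
Variable n : nat.

Let coord (i : 'I_n) (v : 'rV[R]_n) : measurableTypeR R := v ord0 i.

Let rV_set0 : g_sigma_preimage coord set0.
Proof. exact: sigma_algebra0. Qed.

Let rV_setC A : g_sigma_preimage coord A -> g_sigma_preimage coord (~` A).
Proof. exact: sigma_algebraC. Qed.

Let rV_bigcup (F : _^nat) : (forall i, g_sigma_preimage coord (F i)) ->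
  g_sigma_preimage coord (\bigcup_i (F i)).
Proof. exact: sigma_algebra_bigcup. Qed.

(* The product of [n] copies of the Borel sigma-algebra of [R]. *)
HB.instance Definition _ := @isMeasurable.Build rV_display
  'rV[R]_n (g_sigma_preimage coord) rV_set0 rV_setC rV_bigcup.

Lemma measurable_coord (i : 'I_n) :
  measurable_fun [set: 'rV[R]_n] (fun v => v ord0 i : measurableTypeR R).
Proof.
move=> _ Y mY; rewrite setTI; apply: sub_sigma_algebra => /=.
rewrite -bigcup_seq/=; exists i => /=; first by rewrite mem_index_enum.
by exists Y => //; rewrite setTI.
Qed.

Lemma measurable_fun_rVP d (T : measurableType d) (f : T -> 'rV[R]_n) :
  (forall i, measurable_fun [set: T] (fun x => f x ord0 i : measurableTypeR R))
  -> measurable_fun [set: T] f.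
Proof.
move=> mf; apply: (@measurability _ _ _ _ _ _
  (\big[setU/set0]_(i < n) preimage_set_system setT (coord i) measurable)) => //.
move=> _ [B + <-]; rewrite -bigcup_seq => -[i _] [C mC <-].
by rewrite !setTI -[X in measurable X]setTI; exact: mf.
Qed.

End rV_measurable.

Section rV_cons.
Context {R : realType}.
Variable n : nat.

Definition rV_cons (xv : measurableTypeR R * 'rV[R]_n) : 'rV[R]_n.+1 :=
  row_mx (xv.1 : R)%:M xv.2.

Lemma rV_cons0 xv : rV_cons xv ord0 ord0 = xv.1.
Proof.
have -> : (ord0 : 'I_n.+1) = lshift n (ord0 : 'I_1) by exact: val_inj.
by apply: (etrans (@row_mxEl _ 1 1 n _ _ _ _)); rewrite mxE eqxx mulr1n.
Qed.

Lemma rV_consS xv (i : 'I_n) : rV_cons xv ord0 (lift ord0 i) = xv.2 ord0 i.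
Proof.
have -> : lift ord0 i = rshift 1 i by exact: val_inj.
exact: (@row_mxEr _ 1 1 n).
Qed.

Lemma measurable_rV_cons : measurable_fun setT rV_cons.
Proof.
apply: measurable_fun_rVP => i; have [j ->|->] := unliftP ord0 i.
  under eq_fun do rewrite rV_consS.
  by apply: (measurableT_comp (measurable_coord j)); exact: measurable_snd.
by under eq_fun do rewrite rV_cons0; exact: measurable_fst.
Qed.

Variable m : {sigma_finite_measure set 'rV[R]_n -> \bar R}.

Definition lebesgue_step : set 'rV[R]_n.+1 -> \bar R :=
  pushforward (@lebesgue_measure R \x m)%E rV_cons.

Let step0 : lebesgue_step set0 = 0%E.
Proof. by rewrite /lebesgue_step /pushforward preimage_set0 measure0. Qed.

Let step_ge0 A : (0 <= lebesgue_step A)%E.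
Proof. by rewrite /lebesgue_step /pushforward; exact: measure_ge0. Qed.

Let step_sigma_additive : semi_sigma_additive lebesgue_step.
Proof.
move=> F mF tF mUF; rewrite /lebesgue_step /pushforward preimage_bigcup.
apply: measure_semi_sigma_additive.
- by move=> k; rewrite -[X in measurable X]setTI; exact: measurable_rV_cons.
- apply/trivIsetP => /= i j _ _ ij; rewrite -preimage_setI.
  by move/trivIsetP : tF => /(_ _ _ _ _ ij) ->//; rewrite preimage_set0.
- by rewrite -preimage_bigcup -[X in measurable X]setTI; exact: measurable_rV_cons.
Qed.

HB.instance Definition _ := isMeasure.Build _ _ _ lebesgue_step
  step0 step_ge0 step_sigma_additive.

Definition rV_uncons (v : 'rV[R]_n.+1) : measurableTypeR R * 'rV[R]_n :=
  (v ord0 ord0, \row_i v ord0 (lift ord0 i)).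

Lemma rV_consK : cancel rV_cons rV_uncons.
Proof.
case=> x v; rewrite /rV_uncons rV_cons0; congr pair.
by apply/rowP => i; rewrite mxE rV_consS.
Qed.

Lemma measurable_rV_uncons : measurable_fun setT rV_uncons.
Proof.
apply/measurable_fun_pairP; split; first exact: measurable_coord.
apply: measurable_fun_rVP => i.
by under eq_fun do rewrite /= mxE; exact: measurable_coord.
Qed.

Lemma lebesgue_stepX (A : set R) (B : set 'rV[R]_n) :
  measurable (A : set (measurableTypeR R)) -> measurable B ->
  lebesgue_step (rV_uncons @^-1` (A `*` B)) = (lebesgue_measure A * m B)%E.
Proof.
move=> mA mB; rewrite /lebesgue_step /pushforward -comp_preimage.
rewrite (_ : rV_uncons \o rV_cons = id); last exact/funext/rV_consK.
by rewrite preimage_id product_measure1E.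
Qed.

Let step_sigma_finite : sigma_finite setT lebesgue_step.
Proof.
have /sigma_finiteP[F [TF ndF Foo]] := sigma_finiteT (@lebesgue_measure R).
have /sigma_finiteP[G [TG ndG Goo]] := sigma_finiteT m.
exists (fun k => rV_uncons @^-1` (F k `*` G k)).
  rewrite -preimage_bigcup; apply/esym/seteqP; split => // v _.
  have [i _ Fi] : (\bigcup_i F i) (rV_uncons v).1 by rewrite -TF.
  have [j _ Gj] : (\bigcup_i G i) (rV_uncons v).2 by rewrite -TG.
  exists (maxn i j) => //; split.
    by move: Fi; exact/subsetPset/ndF/leq_maxl.
  by move: Gj; exact/subsetPset/ndG/leq_maxr.
move=> k; have [mF Fk] := Foo k; have [mG Gk] := Goo k; split.
  rewrite -[X in measurable X]setTI; apply: measurable_rV_uncons => //.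
  exact: measurableX.
by rewrite lebesgue_stepX// lte_mul_pinfty// ge0_fin_numE.
Qed.

HB.instance Definition _ := Measure_isSigmaFinite.Build _ _ _ lebesgue_step
  step_sigma_finite.

End rV_cons.

Lemma dirac_rV_sigma_finite (R : realType) :
  sigma_finite setT (\d_(0 : 'rV[R]_0) : set _ -> \bar R).
Proof.
apply: fin_num_fun_sigma_finite; first by rewrite measure0.
by move=> A mA; rewrite diracE.
Qed.

HB.instance Definition _ (R : realType) :=
  Measure_isSigmaFinite.Build _ _ _ (\d_(0 : 'rV[R]_0) : set _ -> \bar R)
  (@dirac_rV_sigma_finite R).

(* The [n]-fold product of [lebesgue_measure], on the product sigma-algebra. *)
Fixpoint borel_lebesgue (R : realType) (n : nat) :
    {sigma_finite_measure set 'rV[R]_n -> \bar R} :=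
  match n with
  | 0 => \d_(0 : 'rV[R]_0)
  | k.+1 => lebesgue_step (borel_lebesgue R k)
  end.

Lemma borel_lebesgue_box (R : realType) (n : nat) (a b : 'rV[R]_n) :
  (forall i, a ord0 i <= b ord0 i) ->
  let box := [set x : 'rV[R]_n | forall i, a ord0 i <= x ord0 i <= b ord0 i] in
  measurable box /\
  borel_lebesgue R n box = (\prod_(i < n) (b ord0 i - a ord0 i))%:E.
Proof.
elim: n a b => [|n IH] a b ab /=.
  rewrite (_ : mkset _ = setT); last first.
    by apply/seteqP; split => // x _ [].
  by split => //; rewrite diracT big_ord0.
pose tl (v : 'rV[R]_n.+1) : 'rV[R]_n := \row_i v ord0 (lift ord0 i).
have tlE v i : tl v ord0 i = v ord0 (lift ord0 i) by rewrite mxE.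
have [|mB IHB] := IH (tl a) (tl b); first by move=> i; rewrite !tlE.
set B := [set x : 'rV[R]_n | _] in mB IHB.
have mA : measurable (`[a ord0 ord0, b ord0 ord0] : set (measurableTypeR R)).
  exact: measurable_itv.
rewrite (_ : mkset _ = @rV_uncons R n @^-1` (`[a ord0 ord0, b ord0 ord0] `*` B)).
  split.
    rewrite -[X in measurable X]setTI; apply: measurable_rV_uncons => //.
    exact: measurableX.
  rewrite lebesgue_stepX// IHB lebesgue_measure_itv/= lte_fin big_ord_recl.
  under eq_bigr do rewrite !tlE.
  have := ab ord0; rewrite le_eqVlt => /predU1P[->|->]; last first.
    by rewrite -EFinB -EFinM.
  by rewrite ltxx mul0e subrr mul0r.
apply/seteqP; split => [x xab|x [/= x0 xB] i].
  split; first by rewrite /= in_itv/=; exact: xab.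
  by move=> i; rewrite /= !mxE; exact: xab.
have [j ->|->] := unliftP ord0 i; last by move: x0; rewrite in_itv.
by have := xB j; rewrite !mxE.
Qed.

(* ['rV[R]_n] with the sigma-algebra of Lebesgue measurable sets, that is, the
   Caratheodory measurable sets of the outer measure of [borel_lebesgue]. *)
Definition lebesgue_space (R : realType) (n : nat) : Type :=
  caratheodory_type (borel_lebesgue R n)^*%mu.

HB.instance Definition _ (R : realType) (n : nat) :=
  Measurable.copy (lebesgue_space R n)
    (caratheodory_type (borel_lebesgue R n)^*%mu).

Definition lebesgue_rV (R : realType) (n : nat) :
    set (lebesgue_space R n) -> \bar R :=
  @completed_measure_extension _ 'rV[R]_n R (borel_lebesgue R n).

HB.instance Definition _ (R : realType) (n : nat) :=
  Measure.on (@lebesgue_rV R n).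
Arguments lebesgue_rV : clear implicits.

Lemma lebesgue_rVE (R : realType) (n : nat) (A : set 'rV[R]_n) :
  measurable A ->
  measurable (A : set (lebesgue_space R n)) /\
  lebesgue_rV R n A = borel_lebesgue R n A.
Proof.
by move=> mA; split; [exact: caratheodory_measurable_mu_ext|
  exact: measurable_mu_extE].
Qed.

Lemma lebesgue_rV_sigma_finite (R : realType) (n : nat) :
  sigma_finite setT (lebesgue_rV R n).
Proof. exact/completed_measure_extension_sigma_finite/sigma_finiteT. Qed.

HB.instance Definition _ (R : realType) (n : nat) :=
  Measure_isSigmaFinite.Build _ _ _ (lebesgue_rV R n)
    (@lebesgue_rV_sigma_finite R n).

Section maximal.
Context {R : realType} {n : nat}.
Implicit Types (K S : set 'rV[R]_n) (c : 'rV[R]_n).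

Definition convex_body K :=
  [/\ compact K, convex_set (K : set (convex_lmodType 'rV[R]_n)) & K° !=set0].

Definition symmetric_about c S := forall x, S x -> S (c *+ 2 - x).

Definition centrally_symmetric S := exists c, symmetric_about c S.

Definition dilations_shifts K : set (set 'rV[R]_n) :=
  [set [set a + t *: x | x in K] | t in [set t : R | 0 < t] & a in setT].

Definition homothety c (l : R) S := [set c + l *: (x - c) | x in S].

Definition average S (f : 'rV[R]_n -> R) : \bar R :=
  ((lebesgue_rV R n S)^-1 * \int[lebesgue_rV R n]_(y in S) (f y)%:E)%E.

(* A bounded non-empty set is symmetric about at most one point, so that [c]
   below is the center of [S]. *)
Definition maximal_operator (l : R) K (f : 'rV[R]_n -> R) (x : 'rV[R]_n) :
    \bar R :=
  ereal_sup [set average S f | S in [set S | dilations_shifts K S /\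
    exists c, symmetric_about c S /\ homothety c l S x]].

End maximal.

(* Main.v *)
(* Replace [f] by a Borel minorant equal to it almost everywhere and centre [K] at
   the origin.  Let [N <= M_lambda f] be the (lower semicontinuous) supremum of
   averages over [S] with [x] interior to [lambda S], and put [e = max (N - f, 0)].
   By differentiation [f <= N] a.e., so [N = f + e] a.e. and, as [p > 1],
   [int N^p >= int f^p + int e^p].  It remains to bound [int f^p] by [C int e^p].
   If [A_s] denotes the average over [x + s K] then [A_s f (y + h) <= f y + e y]
   for [h] in [(lambda s / 2) K], hence, iterating, [(A_s)^k f] at a point at
   distance [~ k lambda s / 2] from [y] is at most [f y] plus averages of [e].
   For a cutoff [w] of a ball [B] obtained by averaging an indicator twice, second
   differences of [w] are [O(s^2)], so [w <= A_s w + O(s^2)]; as [A_s] is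
   self-adjoint, [int w f <= int w (A_s)^k f + k O(s^2) int f].  With [s ~ 1 / k]
   the error is [O(1 / k)]: up to a small multiple of the mean of [f], and averages
   of [e], the mean of [f] on [B] is at most [f y], for every [y] in [B].  Thus
   [f] cannot be much larger than its mean on a large part of [B]; through a Vitali
   covering this gives a good-lambda inequality, and summing it over dyadic levels
   yields [int f^p <= 1/2 int f^p + C int e^p].  Without the second order
   estimate the errors of the [k] steps would add up to [O(1)]. *)
Require Import Defs.
From mathcomp Require Import all_boot all_order all_algebra.
From mathcomp Require Import all_classical all_reals all_analysis.
From mathcomp Require Import measurable_realfun ring lra.

Set Implicit Arguments.
Unset Strict Implicit.
Unset Printing Implicit Defensive.

Import Order.TTheory GRing.Theory Num.Theory.
Import numFieldNormedType.Exports.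

Local Open Scope classical_set_scope.
Local Open Scope ring_scope.

(** * Borel and Lebesgue measure on row vectors *)

(** The constant has to be chosen before [K]. [K] enters the quantitative estimates only through the
    triangle inequality of its gauge and the volume law r^n [vol], so all constants depend on [n],
    [p], [lambda] and the number m + 1 of averaging steps alone. The choice of m is the delicate
    point. The coefficient of f decays like 1/(m + 1), while that of e grows like (m + 1)^(n + 1).
    Only the first must be small, because its term is absorbed into the left side, which is
    legitimate as the integral of f^p is finite; the second merely lowers the gain. The passage from
    means to level sets integrates the pointwise bound in y over the complement of the level set:
    over the whole ball the main terms would cancel. The analysis is done on the product Borel
    sigma-algebra, where the measure is built coordinate by coordinate and Tonelli applies. Lebesgue
    measurable functions are met only at the end. *)

Section rV_borel.
Context {R : realType} {n : nat}.
Local Notation V := 'rV[R]_n.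

Lemma rV_ballP (x y : V) (e : R) : 0 < e ->
  ball x e y <-> forall i, `|x ord0 i - y ord0 i| < e.
Proof.
move=> e0; split => [[_ xy] i|xy]; first exact: xy.
by split => // i j; rewrite (ord1 i); exact: xy.
Qed.

Definition rat_rV (q : 'rV[rat]_n) : V := map_mx ratr q.

Lemma open_rat_rV (U : set V) : open U -> U !=set0 -> exists q, U (rat_rV q).
Proof.
move=> oU [x Ux]; have /nbhs_ballP[e /= e0 xeU] := open_nbhs_nbhs (conj oU Ux).
have xq i : exists q : rat, ratr q \in `](x ord0 i - e), (x ord0 i + e)[.
  by apply: rat_in_itvoo; lra.
exists (\row_i sval (cid (xq i))); apply: xeU; apply/rV_ballP => // i.
rewrite !mxE; case: cid => q /=; rewrite in_itv/= => /andP[? ?].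
by rewrite ltr_distl; apply/andP; split; lra.
Qed.

(** The sigma-algebra is generated by the coordinates, so openness has to be turned into a countable
    union: the boxes of rational centre and half-width 1/(k+1) that fit inside [U]. *)
Lemma open_measurable_rV (U : set V) : open U -> measurable U.
Proof.
move=> oU.
pose box (qk : 'rV[rat]_n * nat) : set V :=
  [set x | forall i, (rat_rV qk.1 - const_mx qk.2.+1%:R^-1) ord0 i <= x ord0 i
                   <= (rat_rV qk.1 + const_mx qk.2.+1%:R^-1) ord0 i].
pose F qk := if `[< box qk `<=` U >] then box qk else set0.
rewrite (_ : U = \bigcup_qk F qk); last first.
  apply/seteqP; split => [x Ux|x [qk _]]; last first.
    by rewrite /F; case: asboolP => // qkU /qkU.
  have /nbhs_ballP[e /= e0 xeU] := open_nbhs_nbhs (conj oU Ux).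
  (* Half of [e], because the rational centre is within 1/(k+1) of [x] and the box extends 1/(k+1)
     further. *)
  pose k := Num.truncn (2 / e).
  have ke : k.+1%:R^-1 < e / 2 :> R.
    by rewrite -[e / 2]invrK invf_div ltf_pV2 ?posrE ?divr_gt0// truncnS_gt.
  have k0 : 0 < k.+1%:R^-1 :> R by rewrite invr_gt0.
  have [||q xq] := @open_rat_rV (ball x k.+1%:R^-1).
  - exact: ball_open.
  - by exists x; exact: ballxx.
  - exists (q, k) => //; rewrite /F; move/(rV_ballP _ _ k0) : xq => xq.
    case: asboolP => [_ i|[]].
      have := xq i; rewrite /= /rat_rV !mxE ltr_distl => /andP[+ +].
      set d := k.+1%:R^-1; set r := ratr _ => r1 r2.
      by apply/andP; split; exact: ltW.
    move=> y qy; apply: xeU; apply/rV_ballP => // i.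
    have := xq i; have := qy i; rewrite /= /rat_rV !mxE !ltr_distl.
    move: ke; set d := k.+1%:R^-1; set r := ratr _ => ? /andP[? ?] /andP[? ?].
    by apply/andP; split; lra.
apply: countable_bigcupT_measurable; first exact: countableP.
move=> qk; rewrite /F; case: asboolP => // _.
have [|mb _] := @borel_lebesgue_box R n (rat_rV qk.1 - const_mx qk.2.+1%:R^-1)
  (rat_rV qk.1 + const_mx qk.2.+1%:R^-1); last exact: mb.
move=> i; rewrite !mxE lerD2l; have : 0 < qk.2.+1%:R^-1 :> R by rewrite invr_gt0.
by set d := _^-1; lra.
Qed.

Lemma closed_measurable_rV (U : set V) : closed U -> measurable U.
Proof.
move=> cU; rewrite -[U]setCK; apply: measurableC.
by apply: open_measurable_rV; exact: closed_openC.
Qed.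

Lemma measurable_rVD d (T : measurableType d) (f g : T -> V) :
  measurable_fun setT f -> measurable_fun setT g ->
  measurable_fun setT (fun x => f x + g x).
Proof.
move=> mf mg; apply: measurable_fun_rVP => i; under eq_fun do rewrite mxE.
by apply: measurable_funD; apply: (measurableT_comp (measurable_coord i)).
Qed.

Lemma measurable_rVZ d (T : measurableType d) (t : R) (f : T -> V) :
  measurable_fun setT f -> measurable_fun setT (fun x => t *: f x).
Proof.
move=> mf; apply: measurable_fun_rVP => i; under eq_fun do rewrite mxE.
by apply: measurable_funM => //; apply: (measurableT_comp (measurable_coord i)).
Qed.

Lemma measurable_rV_affine (a : V) (t : R) :
  measurable_fun setT (fun x : V => a + t *: x).
Proof. by apply: measurable_rVD => //; exact: measurable_rVZ. Qed.

Lemma open_preimage_affine (a : V) (t : R) (U : set V) :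
  open U -> open [set x | U (a + t *: x)].
Proof.
move=> oU; rewrite openE => x Ux.
have /nbhs_ballP[e /= e0 eU] := open_nbhs_nbhs (conj oU Ux).
have t1 : 0 < `|t| + 1 by rewrite ltr_wpDl.
have et0 : 0 < e / (`|t| + 1) by rewrite divr_gt0.
apply/nbhs_ballP; exists (e / (`|t| + 1)); first exact: et0.
move=> y /(rV_ballP _ _ et0) xy; apply: eU; apply/(rV_ballP _ _ e0) => i.
have := xy i; rewrite ltr_pdivlMr// => /(le_lt_trans _); apply.
rewrite !mxE opprD addrACA subrr add0r -mulrBr normrM mulrC.
by rewrite ler_wpM2l// lerDl.
Qed.

End rV_borel.

(** * Affine changes of variables *)

Section affine_measure.
Context {R : realType}.
Local Notation leb := (@lebesgue_measure R).

Lemma measurable_affine (a t : R) :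
  measurable_fun setT (fun x : measurableTypeR R => a + t * (x : R) : measurableTypeR R).
Proof. by apply: measurable_funD => //; exact: measurable_funM. Qed.

(** Uniqueness of Lebesgue measure: [|t|] times the push-forward agrees with it on the intervals ]b,
    c]. For negative [t] the preimage is half-open on the other side, which does not affect its
    length. *)
Lemma lebesgue_measure_affine (a t : R) (B : set (measurableTypeR R)) : t != 0 -> measurable B ->
  leb ((fun x => a + t * x) @^-1` B) = (`|t|^-1%:E * leb B)%E.
Proof.
move=> t0 mB.
have mf : measurable_fun setT (fun x : measurableTypeR R => a + t * (x : R) : measurableTypeR R).
  exact: measurable_affine.
pose pm := measure_function_pushforward__canonical__measure_function_Measure leb mf.
have t1 : 0 <= `|t| by [].
pose m (A : set (measurableTypeR R)) := (`|t|%:E * leb ((fun x => (a + t * x)%R) @^-1` A))%E.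
suff mE : forall X, ocitv X -> leb X = m X.
  have -> : leb B = m B := @lebesgue_measure_unique R (mscale (NngNum t1) pm) mE _ mB.
  by rewrite /m muleA -EFinM mulVf ?normr_eq0// mul1e.
move=> _ [[b c] _ <-]; rewrite /m.
have tc x y : (x < a + t * y) = (if 0 < t then (x - a) / t < y else y < (x - a) / t).
  rewrite addrC -ltrBlDr; case: ifPn => [t0'|].
    by rewrite ltr_pdivrMr// mulrC.
  by rewrite -leNgt le_eqVlt (negPf t0)/= => t0'; rewrite ltr_ndivlMr// mulrC.
have td x y : (a + t * y <= x) = (if 0 < t then y <= (x - a) / t else (x - a) / t <= y).
  rewrite addrC -lerBrDr; case: ifPn => [t0'|].
    by rewrite ler_pdivlMr// mulrC.
  by rewrite -leNgt le_eqVlt (negPf t0)/= => t0'; rewrite ler_ndivrMr// mulrC.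
rewrite (_ : _ @^-1` _ = if 0 < t then `](b - a) / t, (c - a) / t]%classic
    else `[(c - a) / t, (b - a) / t[%classic); last first.
  apply/seteqP; split => x /=; rewrite !in_itv/= tc td; case: ifPn => _ /=;
    by rewrite in_itv //= andbC.
case: ifPn => t0'.
  rewrite !lebesgue_measure_itv/= !lte_fin ltr_pM2r ?invr_gt0// ltrD2r.
  case: ifPn => bc; last by rewrite mule0.
  by rewrite -!EFinB -EFinM gtr0_norm//; congr EFin; field.
move: t0'; rewrite -leNgt le_eqVlt (negPf t0)/= => t0'.
rewrite !lebesgue_measure_itv/= !lte_fin ltr_nM2r ?invr_lt0// ltrD2r.
case: ifPn => bc; last by rewrite mule0.
by rewrite -!EFinB -EFinM ltr0_norm//; congr EFin; field.
Qed.

(** Induction on the dimension: a section of the preimage is the preimage of a section, which gives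
    |t|^-n in the remaining coordinates; the change of variables in the first coordinate supplies
    one more |t|^-1. *)
Lemma borel_lebesgue_affine n (a : 'rV[R]_n) (t : R) (B : set 'rV[R]_n) :
  t != 0 -> measurable B ->
  borel_lebesgue R n ((fun x => a + t *: x) @^-1` B) =
  ((`|t| ^- n)%:E * borel_lebesgue R n B)%E.
Proof.
move=> t0; elim: n a B => [|n IH] a B mB.
  rewrite expr0 invr1 mul1e (_ : (fun x => _) = id) ?preimage_id//.
  by apply/funext => x; apply/rowP => -[].
have mf : measurable_fun setT (fun x : measurableTypeR R => a ord0 ord0 + t * (x : R) : measurableTypeR R).
  exact: measurable_affine.
pose a' : 'rV[R]_n := \row_i a ord0 (lift ord0 i).
pose C := @rV_cons R n @^-1` B.
have mC : measurable C.
  by rewrite -[X in measurable X]setTI; exact: measurable_rV_cons.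
pose G x := borel_lebesgue R n (xsection C x).
have mG : measurable_fun setT G by exact: measurable_fun_xsection.
have G0 x : (0 <= G x)%E by [].
have cons_affine x v : a + t *: rV_cons (x, v) = rV_cons (a ord0 ord0 + t * x, a' + t *: v).
  apply/matrixP => z i; rewrite [z]ord1 {z}; have [j ->|->] := unliftP ord0 i.
    by rewrite rV_consS [LHS]mxE [X in _ + X = _]mxE rV_consS !mxE.
  by rewrite rV_cons0 [LHS]mxE [X in _ + X = _]mxE rV_cons0.
transitivity (\int[leb]_x ((`|t| ^- n)%:E * G (a ord0 ord0 + t * x)%R))%E.
  apply: eq_integral => x _ /=; rewrite -(IH a')//; last exact: measurable_xsection.
  congr (borel_lebesgue _ _ _); apply/seteqP; split => v;
    by rewrite /xsection/= !inE/= /C/= cons_affine.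
rewrite ge0_integralZl//; last exact: (measurableT_comp mG mf).
rewrite [RHS](_ : _ = (`|t| ^- n.+1)%:E * \int[leb]_x G x)%E //.
rewrite -(@ge0_integral_pushforward _ _ _ _ _ _ mf leb setT G)//.
have t1 : 0 <= `|t|^-1 by rewrite invr_ge0.
rewrite (@eq_measure_integral _ _ _ _ (mscale (NngNum t1) leb)); last first.
  move=> A mA _. exact: (lebesgue_measure_affine (a ord0 ord0) t0 mA).
rewrite ge0_integral_mscale//= muleA -EFinM; congr (_%:E * _)%E.
by rewrite exprS invfM mulrC.
Qed.

End affine_measure.

Section change_of_variables.
Context {R : realType} {n : nat}.
Local Notation V := 'rV[R]_n.
Local Notation mu := (borel_lebesgue R n).
Local Open Scope ereal_scope.

Lemma ge0_integral_affine (a : V) (t : R) (D : set V) (g : V -> \bar R) :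
  t != 0%R -> measurable D -> measurable_fun setT g -> (forall x, 0 <= g x) ->
  \int[mu]_(x in (fun x => (a + t *: x)%R) @^-1` D) g (a + t *: x)%R =
  (`|t| ^- n)%:E * \int[mu]_(x in D) g x.
Proof.
move=> t0 mD mg g0; pose f x : V := (a + t *: x)%R.
have mf : measurable_fun setT f by exact: measurable_rV_affine.
rewrite -(@ge0_integral_pushforward _ _ _ _ _ _ mf mu D g)//; last exact: measurable_funS mg.
have t1 : (0 <= `|t| ^- n)%R by rewrite invr_ge0 exprn_ge0.
rewrite (@eq_measure_integral _ _ _ _ (mscale (NngNum t1) mu)); last first.
  by move=> A mA _; exact: borel_lebesgue_affine.
by rewrite ge0_integral_mscale//; exact: measurable_funS mg.
Qed.

Lemma ge0_integral_translation (a : V) (g : V -> \bar R) :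
  measurable_fun setT g -> (forall x, 0 <= g x) ->
  \int[mu]_x g (a + x)%R = \int[mu]_x g x.
Proof.
move=> mg g0; have := @ge0_integral_affine a 1 setT g (oner_neq0 _) measurableT mg g0.
rewrite preimage_setT normr1 expr1n invr1 mul1e => <-.
by under [RHS]eq_integral do rewrite scale1r.
Qed.

End change_of_variables.

(** * Averages over a symmetric convex body *)

(** The working form of a body whose centre has been moved to 0; [centred_sym_body] derives it from
    the notions of the statement. *)
Record sym_body {R : realType} {n : nat} (K : set 'rV[R]_n) : Prop := SymBody {
  body_convex : forall x y t, 0 <= t <= 1 -> K x -> K y -> K (t *: x + (1 - t) *: y);
  body_sym : forall x, K x -> K (- x);
  body_nbhs : nbhs (0 : 'rV[R]_n) K;
  body_bounded : exists M : R, forall x, K x -> `|x| <= M;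
  body_measurable : measurable K;
  body_finite : (borel_lebesgue R n K < +oo)%E }.

Section body.
Context {R : realType} {n : nat}.
Local Notation V := 'rV[R]_n.
Local Notation mu := (borel_lebesgue R n).
Variable K : set V.
Hypothesis bK : sym_body K.

Definition body_ball (x : V) (r : R) := [set y | K (r^-1 *: (y - x))].
Local Notation B := body_ball.

Lemma body0 : K 0. Proof. exact: nbhs_singleton (body_nbhs bK). Qed.

Lemma body_scale v t : 0 <= t <= 1 -> K v -> K (t *: v).
Proof.
by move=> t01 Kv; have := body_convex bK t01 Kv body0; rewrite scaler0 addr0.
Qed.

(** Triangle inequality for the gauge of [K]: the vector is the convex combination of v/r and w/s
    with weight r/(r + s). *)
Lemma dilD r s v w : 0 < r -> 0 < s -> K (r^-1 *: v) -> K (s^-1 *: w) ->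
  K ((r + s)^-1 *: (v + w)).
Proof.
move=> r0 s0 Kv Kw; have rs0 : 0 < r + s by rewrite addr_gt0.
have t01 : 0 <= r / (r + s) <= 1.
  by rewrite ltW ?divr_gt0//= ler_pdivrMr// mul1r; lra.
have := body_convex bK t01 Kv Kw.
congr K; rewrite !scalerA scalerDr; congr (_ *: _ + _ *: _); field;
  by rewrite ?(gt_eqF r0) ?(gt_eqF s0) ?(gt_eqF rs0).
Qed.

Lemma dil_le r s v : 0 < r -> r <= s -> K (r^-1 *: v) -> K (s^-1 *: v).
Proof.
move=> r0 rs Kv; have s0 := lt_le_trans r0 rs.
have -> : s^-1 *: v = (r / s) *: (r^-1 *: v).
  by rewrite scalerA; congr (_ *: _); field; rewrite (gt_eqF r0) (gt_eqF s0).
by apply: body_scale => //; rewrite ltW ?divr_gt0//= ler_pdivrMr// mul1r.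
Qed.

Lemma dilN r v : K (r^-1 *: v) -> K (r^-1 *: (- v)).
Proof. by rewrite scalerN; exact: body_sym. Qed.

Lemma body_ball_sub x y r s : 0 < r -> 0 < s -> K (s^-1 *: (x - y)) ->
  B x r `<=` B y (r + s).
Proof.
move=> r0 s0 Kxy z Kz; rewrite /B/=.
have -> : z - y = (z - x) + (x - y) by rewrite addrA subrK.
exact: dilD.
Qed.

Lemma body_ball_center x r : 0 < r -> B x r x.
Proof. by move=> r0; rewrite /B/= subrr scaler0; exact: body0. Qed.

Lemma body_ball_le x r s : 0 < r -> r <= s -> B x r `<=` B x s.
Proof. by move=> r0 rs y; exact: dil_le. Qed.

Lemma body_ballE x r :
  B x r = (fun y => - (r^-1 *: x) + r^-1 *: y) @^-1` K.
Proof.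
by apply/seteqP; split => y; rewrite /B/= scalerBr addrC.
Qed.

Lemma measurable_body_ball x r : measurable (B x r).
Proof.
rewrite body_ballE -[X in measurable X]setTI; apply: measurable_rV_affine => //.
exact: body_measurable.
Qed.

Lemma mu_body_ball x r : 0 < r -> mu (B x r) = ((r ^+ n)%:E * mu K)%E.
Proof.
move=> r0; rewrite body_ballE borel_lebesgue_affine//; last 2 first.
  by rewrite invr_eq0 gt_eqF.
  exact: body_measurable.
by rewrite normfV gtr0_norm// exprVn invrK.
Qed.

Definition vol := fine (mu K).

Lemma volE : mu K = vol%:E.
Proof. by rewrite fineK// ge0_fin_numE//; exact: body_finite. Qed.

Lemma vol_gt0 : 0 < vol.
Proof.
rewrite -lte_fin -volE; have /nbhs_ballP[e /= e0 eK] := body_nbhs bK.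
have [|mb mbE] := @borel_lebesgue_box R n (const_mx (- (e / 2))) (const_mx (e / 2)).
  by move=> i; rewrite !mxE; lra.
set box := mkset _ in mb mbE.
have boxK : box `<=` K.
  move=> x xe; apply: eK; apply/rV_ballP => // i.
  have := xe i; rewrite !mxE sub0r normrN ltr_norml => /andP[? ?].
  by apply/andP; split; lra.
have : (mu box <= mu K)%E.
  by apply: le_measure => //; apply/mem_set => //; exact: body_measurable.
apply: lt_le_trans; rewrite mbE lte_fin; apply: prodr_gt0 => i _; rewrite !mxE; lra.
Qed.

Lemma mu_ballE x r : 0 < r -> mu (B x r) = (r ^+ n * vol)%:E.
Proof. by move=> r0; rewrite mu_body_ball// volE EFinM. Qed.

Local Open Scope ereal_scope.

(** Integrating over the fixed set [K] instead of the moving ball makes translation and Tonelli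
    immediate, and gives a meaning to negative [r], through which the symmetry of [K] enters in
    [avg_opp]. For r > 0 this is the mean over [B x r], by [avgE]. *)
Definition avg (r : R) (g : V -> \bar R) (x : V) : \bar R :=
  (vol^-1)%:E * \int[mu]_(z in K) g (x + r *: z)%R.

Lemma avgE r g x : (0 < r)%R -> measurable_fun setT g -> (forall y, 0 <= g y) ->
  \int[mu]_(y in B x r) g y = (r ^+ n * vol)%:E * avg r g x.
Proof.
move=> r0 mg g0; have r1 : r != 0%R by rewrite gt_eqF.
have := @ge0_integral_affine R n x r (B x r) g r1 (measurable_body_ball _ _) mg g0.
rewrite (_ : _ @^-1` B x r = K); last first.
  apply/seteqP; split => y; rewrite /B/= addrAC subrr add0r scalerA mulVf// scale1r //.
rewrite /avg => ->; rewrite muleA muleA -!EFinM gtr0_norm//.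
have v0 := vol_gt0; rewrite (_ : (_ * _ * _)%R = 1%R) ?mul1e//.
by field; rewrite expf_neq0//= gt_eqF.
Qed.

End body.

Lemma integral_indic_mul {d} {T : measurableType d} {R : realType}
    (m : {measure set T -> \bar R}) (D : set T) (g : T -> \bar R) :
  (\int[m]_(x in D) g x = \int[m]_x (g x * (\1_D x)%:E))%E.
Proof.
rewrite integral_mkcond; apply: eq_integral => x _.
by rewrite patchE indicE; case: (x \in D); rewrite ?mule1 ?mule0.
Qed.

Section averages.
Context {R : realType} {n : nat}.
Local Notation V := 'rV[R]_n.
Local Notation mu := (borel_lebesgue R n).
Variable K : set V.
Hypothesis bK : sym_body K.
Local Notation B := (body_ball K).
Local Notation A := (avg K).
Local Notation vol := (vol K).
Local Open Scope ereal_scope.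

Let mK : measurable K := body_measurable bK.
Let vol0 : (0 < vol)%R := vol_gt0 bK.
Let ivol0 : (0 <= vol^-1)%R. Proof. by rewrite invr_ge0 ltW. Qed.

Lemma measurable_comp_affine (g : V -> \bar R) (a : V) (t : R) :
  measurable_fun setT g -> measurable_fun setT (fun z : V => g (a + t *: z)%R).
Proof. by move=> mg; apply: (measurableT_comp mg); exact: measurable_rV_affine. Qed.

Let mcompK (g : V -> \bar R) (a : V) (t : R) :
  measurable_fun setT g -> measurable_fun K (fun z : V => g (a + t *: z)%R).
Proof. by move=> mg; apply: measurable_funTS; exact: measurable_comp_affine. Qed.

Let kernel (r : R) (g : V -> \bar R) (xz : V * V) := g (xz.1 + r *: xz.2)%R * (\1_K xz.2)%:E.

Let kernel_ge0 r g : (forall x, 0 <= g x) -> forall xz, 0 <= kernel r g xz.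
Proof. by move=> g0 xz; rewrite /kernel mule_ge0// lee_fin. Qed.

Let measurable_kernel r g : measurable_fun setT g -> measurable_fun setT (kernel r g).
Proof.
move=> mg; apply: emeasurable_funM.
  apply: (measurableT_comp mg); apply: measurable_rVD; first exact: measurable_fst.
  by apply: measurable_rVZ; exact: measurable_snd.
apply/measurable_EFinP; apply: measurableT_comp; last exact: measurable_snd.
exact: measurable_indic.
Qed.

Let avg_kernel r g x : A r g x = (vol^-1)%:E * \int[mu]_z kernel r g (x, z).
Proof. by rewrite /avg integral_indic_mul. Qed.

Lemma measurable_avg r (g : V -> \bar R) : measurable_fun setT g -> (forall x, 0 <= g x) ->
  measurable_fun setT (A r g).
Proof.
move=> mg g0; rewrite (_ : A r g = fun x => (vol^-1)%:E * \int[mu]_z kernel r g (x, z)); last first.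
  by apply/funext => x; exact: avg_kernel.
apply: measurable_funeM.
exact: (@measurable_fun_fubini_tonelli_F _ _ _ _ _ mu _ (measurable_kernel r mg) (kernel_ge0 r g0)).
Qed.

Lemma avg_ge0 r (g : V -> \bar R) x : (forall y, 0 <= g y) -> 0 <= A r g x.
Proof. by move=> g0; rewrite /avg mule_ge0 ?lee_fin//; apply: integral_ge0. Qed.

Lemma le_avg r (g h : V -> \bar R) x : (forall y, 0 <= g y) ->
  measurable_fun setT g -> measurable_fun setT h ->
  (forall y, g y <= h y) -> A r g x <= A r h x.
Proof.
move=> g0 mg mh gh; rewrite /avg lee_wpmul2l ?lee_fin//.
by apply: ge0_le_integral => //; exact: mcompK.
Qed.

Lemma avgD r (g h : V -> \bar R) x : (forall y, 0 <= g y) -> (forall y, 0 <= h y) ->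
  measurable_fun setT g -> measurable_fun setT h ->
  A r (fun y => g y + h y) x = A r g x + A r h x.
Proof.
move=> g0 h0 mg mh; rewrite /avg ge0_integralD//; [|exact: mcompK..].
by rewrite ge0_muleDr//; exact: integral_ge0.
Qed.

Lemma avg_cst r (c : \bar R) x : A r (cst c) x = c.
Proof.
rewrite /avg integral_cst//= volE// muleC -muleA -EFinM.
by rewrite mulfV ?gt_eqF// mule1.
Qed.

Lemma avg_translation r (g : V -> \bar R) x h : A r (fun y => g (y + h)%R) x = A r g (x + h)%R.
Proof. by rewrite /avg; under eq_integral do rewrite addrAC. Qed.

Lemma avg_opp r (g : V -> \bar R) x : measurable_fun setT g -> (forall y, 0 <= g y) ->
  A (- r) g x = A r g x.
Proof.
move=> mg g0; rewrite /avg; congr (_ * _).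
have N1 : (-1 != 0 :> R)%R by rewrite oppr_eq0 oner_neq0.
have m1 := measurable_comp_affine x r mg.
have := @ge0_integral_affine R n 0 (-1)%R K _ N1 mK m1 (fun y => g0 _).
rewrite normrN normr1 expr1n invr1 mul1e => <-.
rewrite (_ : _ @^-1` K = K).
  by apply: eq_integral => z _; rewrite add0r scaleN1r scalerN scaleNr.
apply/seteqP; split => z /=; rewrite add0r scaleN1r; last exact: body_sym.
by move/(body_sym bK); rewrite opprK.
Qed.

(** Tonelli, then for each z in [K] the translation of x by -rz, which moves the shift from [f] to
    [g] and turns [r] into [-r]; [avg_opp] restores the sign. *)
Lemma avg_selfadjoint r (f g : V -> \bar R) : measurable_fun setT f -> (forall y, 0 <= f y) ->
  measurable_fun setT g -> (forall y, 0 <= g y) ->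
  \int[mu]_x (A r f x * g x) = \int[mu]_x (f x * A r g x).
Proof.
move=> mf f0 mg g0.
have mg1 : measurable_fun setT (fun xz : V * V => g xz.1).
  by apply: (measurableT_comp mg); exact: measurable_fst.
have mf1 : measurable_fun setT (fun xz : V * V => f xz.1).
  by apply: (measurableT_comp mf); exact: measurable_fst.
transitivity ((vol^-1)%:E * \int[mu]_x \int[mu]_z (kernel r f (x, z) * g x)).
  rewrite -ge0_integralZl//; last 2 first.
  - apply: (@measurable_fun_fubini_tonelli_F _ _ _ _ _ mu
      (fun xz => kernel r f xz * g xz.1)) => //.
      by apply: emeasurable_funM => //; exact: measurable_kernel.
    by move=> xz; rewrite mule_ge0//; exact: kernel_ge0.
  - by move=> x _; apply: integral_ge0 => z _; rewrite mule_ge0//; exact: kernel_ge0.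
  apply: eq_integral => x _; rewrite avg_kernel -muleA ge0_integralZr//.
  - by apply: measurable_fun_pair2; exact: measurable_kernel.
  - by move=> z _; exact: kernel_ge0.
transitivity ((vol^-1)%:E * \int[mu]_x \int[mu]_z (kernel (- r) g (x, z) * f x)).
  congr (_ * _); rewrite (@fubini_tonelli _ _ _ _ _ mu mu (fun xz => kernel r f xz * g xz.1))//; last 2 first.
  - by apply: emeasurable_funM => //; exact: measurable_kernel.
  - by move=> xz; rewrite mule_ge0//; exact: kernel_ge0.
  rewrite [RHS](@fubini_tonelli _ _ _ _ _ mu mu (fun xz => kernel (- r) g xz * f xz.1))//; last 2 first.
  - by apply: emeasurable_funM => //; exact: measurable_kernel.
  - by move=> xz; rewrite mule_ge0//; exact: kernel_ge0.
  apply: eq_integral => z _ /=.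
  rewrite -(@ge0_integral_translation _ _ (- (r *: z))%R)//; last 2 first.
  - apply: emeasurable_funM => //; apply: measurable_fun_pair1.
    exact: measurable_kernel.
  - by move=> x; rewrite mule_ge0//; exact: kernel_ge0.
  apply: eq_integral => x _; rewrite /kernel/= scaleNr [(- _ + x)%R]addrC subrK.
  by rewrite muleAC [f x * _]muleC muleAC.
rewrite -ge0_integralZl//; last 2 first.
- apply: (@measurable_fun_fubini_tonelli_F _ _ _ _ _ mu
    (fun xz => kernel (- r) g xz * f xz.1)) => //.
    by apply: emeasurable_funM => //; exact: measurable_kernel.
  by move=> xz; rewrite mule_ge0//; exact: kernel_ge0.
- by move=> x _; apply: integral_ge0 => z _; rewrite mule_ge0//; exact: kernel_ge0.
apply: eq_integral => x _; rewrite -avg_opp// avg_kernel [RHS]muleC -muleA ge0_integralZr//.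
- by apply: measurable_fun_pair2; exact: measurable_kernel.
- by move=> z _; exact: kernel_ge0.
Qed.

End averages.

Lemma bernoulli_ineq {R : realDomainType} (t : R) (k : nat) : 0 <= t <= 1 ->
  1 - k%:R * t <= (1 - t) ^+ k.
Proof.
move=> /andP[t0 t1]; elim: k => [|k IH]; first by rewrite expr0 mul0r subr0.
have k0 : 0 <= k%:R * t ^+ 2 by rewrite mulr_ge0// sqr_ge0.
apply: (@le_trans _ _ ((1 - t) * (1 - k%:R * t))).
  by rewrite -natr1; lra.
by rewrite exprS ler_wpM2l// subr_ge0.
Qed.

Lemma ge0_le_integral_setU {d} {T : measurableType d} {R : realType}
    (m : {measure set T -> \bar R}) (D X Y : set T) (g : T -> \bar R) :
  measurable D -> measurable X -> measurable Y -> measurable_fun setT g ->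
  (forall x, 0 <= g x)%E -> D `<=` X `|` Y ->
  (\int[m]_(x in D) g x <= \int[m]_(x in X) g x + \int[m]_(x in Y) g x)%E.
Proof.
move=> mD mX mY mg g0 DXY; have mYX := measurableD mY mX.
apply: (@le_trans _ _ (\int[m]_(x in X `|` (Y `\` X)) g x)%E).
  apply: ge0_subset_integral => //; first exact: measurableU.
    exact: measurable_funTS.
  by rewrite setUDr setDv setD0 => x /DXY.
rewrite ge0_integral_setU//; last 2 first.
  exact: measurable_funTS.
  by apply/disj_setPS => x [? []].
by rewrite leeD2l//; apply: ge0_subset_integral => //; exact: measurable_funTS.
Qed.

(** * Dependence of an average on its centre *)

Section smoothing.
Context {R : realType} {n : nat}.
Local Notation V := 'rV[R]_n.
Local Notation mu := (borel_lebesgue R n).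
Variable K : set V.
Hypothesis bK : sym_body K.
Local Notation B := (body_ball K).
Local Notation A := (avg K).
Local Notation vol := (vol K).
Local Open Scope ereal_scope.

Let mK : measurable K := body_measurable bK.
Let vol0 : (0 < vol)%R := vol_gt0 bK.
Let ivol0 : (0 <= vol^-1)%R. Proof. by rewrite invr_ge0 ltW. Qed.

Lemma body_ball1 : B 0 1 = K.
Proof. by apply/seteqP; split => y; rewrite /body_ball/= subr0 invr1 scale1r. Qed.

(** After rescaling, the two averages are over unit balls whose centres are at gauge distance at
    most th = s/r. Both contain the concentric ball of radius 1 - th about 0, so the excess has
    measure at most (1 - (1 - th)^n) [vol], and Bernoulli bounds this by n th [vol]. *)
Lemma avg_shift r s (C : R) (g : V -> \bar R) x h : (0 < s < r)%R -> K (s^-1 *: h) ->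
  measurable_fun setT g -> (forall y, 0 <= g y <= C%:E) ->
  A r g x <= A r g (x + h)%R + (n%:R * (s / r) * C)%:E.
Proof.
move=> /andP[s0 sr] Kh mg gC; have r0 := lt_trans s0 sr.
have C0 : (0 <= C)%R by have /andP[/le_trans + ] := gC 0%R => /[apply]; rewrite lee_fin.
have g0 y : 0 <= g y by have /andP[] := gC y.
pose h' : V := r^-1 *: h; set th := (s / r)%R.
have th01 : (0 <= th <= 1)%R by rewrite ltW ?divr_gt0//= ler_pdivrMr// mul1r ltW.
have th1 : (0 < 1 - th)%R by rewrite subr_gt0 ltr_pdivrMr// mul1r.
pose G (z : V) := g ((x + h) + r *: z)%R.
have mG : measurable_fun setT G by exact: measurable_comp_affine.
have G0 z : 0 <= G z by exact: g0.
have mB1 := measurable_body_ball bK (- h') 1.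
have -> : A r g x = (vol^-1)%:E * \int[mu]_(z in B (- h') 1) G z.
  rewrite /avg; congr (_ * _).
  have N1 : (1 != 0 :> R)%R by exact: oner_neq0.
  have := @ge0_integral_affine R n (- h') 1%R (B (- h') 1) _ N1 mB1 mG G0.
  rewrite normr1 expr1n invr1 mul1e => <-.
  rewrite (_ : _ @^-1` _ = K).
    apply: eq_integral => z _; rewrite /G scale1r scalerDr scalerN scalerA mulfV ?gt_eqF//.
    by rewrite scale1r addrA addrK.
  apply/seteqP; split => z; rewrite /body_ball/= scale1r opprK invr1 scale1r;
    by rewrite addrAC addNr add0r.
have KE : \int[mu]_(z in B (- h') 1) G z <=
    \int[mu]_(z in K) G z + (n%:R * th * C * vol)%:E.
  have mD : measurable (B (- h') 1 `\` B 0 (1 - th)%R).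
    by apply: measurableD => //; exact: measurable_body_ball.
  apply: (@le_trans _ _ (\int[mu]_(z in K) G z + \int[mu]_(z in B (- h') 1 `\` B 0 (1 - th)%R) G z)).
    apply: ge0_le_integral_setU => //.
    move=> z Bz; have [Kz|Kz] := pselect (K z); [by left|right; split => //].
    have le1 : (1 - th <= 1)%R by rewrite lerBlDr lerDl; case/andP: th01.
    by move=> /(body_ball_le bK th1 le1); rewrite body_ball1.
  rewrite leeD2l//.
  apply: (@le_trans _ _ (\int[mu]_(z in B (- h') 1 `\` B 0 (1 - th)%R) C%:E)).
    apply: ge0_le_integral => //.
    - exact: measurable_funTS.
    - by move=> z _; have /andP[] := gC ((x + h) + r *: z)%R.
  rewrite integral_cst//=.
  have muoo : mu (B (- h') 1) < +oo by rewrite mu_ballE// ltry.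
  rewrite (measureD mB1 (measurable_body_ball bK 0 (1 - th)%R) muoo).
  rewrite (_ : _ `&` _ = B 0 (1 - th)%R); last first.
    apply/setIidr => z; rewrite /body_ball/= subr0 opprK => Kz.
    have th0 : (0 < th)%R by rewrite divr_gt0.
    have Kh' : K (th^-1 *: h').
      rewrite (_ : th^-1 *: h' = s^-1 *: h)// scalerA; congr (_ *: _).
      by rewrite /th; field; rewrite !gt_eqF.
    by have := dilD bK th1 th0 Kz Kh'; rewrite subrK.
  rewrite [X in X - _](mu_ballE bK)// [X in _ - X](mu_ballE bK)//.
  rewrite expr1n mul1r -EFinB -EFinM lee_fin.
  have := bernoulli_ineq n th01 => ber.
  rewrite -subr_ge0 (_ : (_ - _)%R = C * vol * ((1 - th) ^+ n - (1 - n%:R * th)))%R; last by ring.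
  by rewrite !mulr_ge0 ?subr_ge0// ltW.
apply: (@le_trans _ _ ((vol^-1)%:E * (\int[mu]_(z in K) G z + (n%:R * th * C * vol)%:E))).
  by rewrite lee_wpmul2l ?lee_fin.
rewrite ge0_muleDr; [|exact: integral_ge0|]; last first.
  by rewrite lee_fin mulr_ge0 ?(ltW vol0)// mulr_ge0// mulr_ge0//; case/andP: th01.
by rewrite leeD2l// -EFinM lee_fin mulrC mulfK ?lexx// gt_eqF.
Qed.

End smoothing.

(** * Cutoffs and iterated averages *)

Section second_difference.
Context {R : realType} {n : nat}.
Local Notation V := 'rV[R]_n.
Local Notation mu := (borel_lebesgue R n).
Variable K : set V.
Hypothesis bK : sym_body K.
Local Notation B := (body_ball K).
Local Notation A := (avg K).
Local Notation vol := (vol K).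
Local Open Scope ereal_scope.

Let mK : measurable K := body_measurable bK.
Let vol0 : (0 < vol)%R := vol_gt0 bK.
Let ivol0 : (0 <= vol^-1)%R. Proof. by rewrite invr_ge0 ltW. Qed.

Lemma avg_le_cst r (c : R) (g : V -> \bar R) x : measurable_fun setT g ->
  (forall y, 0 <= g y <= c%:E) -> 0 <= A r g x <= c%:E.
Proof.
move=> mg gc; have g0 y : 0 <= g y by have /andP[] := gc y.
rewrite (avg_ge0 bK)//= -[leRHS](avg_cst bK r _ x); apply: (le_avg bK) => // y.
by have /andP[] := gc y.
Qed.

(** The inner average changes by at most [L] under the shift, so the difference between [u] and its
    translate has size [L]; applying [avg_shift] to that difference gains a second factor [L] from
    the outer average. *)
Lemma second_difference r s (g : V -> \bar R) x h : (0 < s < r)%R -> K (s^-1 *: h) ->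
  measurable_fun setT g -> (forall y, 0 <= g y <= 1) ->
  A r (A r g) x + A r (A r g) x <=
  A r (A r g) (x + h)%R + A r (A r g) (x - h)%R + ((n%:R * (s / r)) ^+ 2 *+ 2)%:E.
Proof.
move=> sr Kh mg g1; set u := A r g; set L := (n%:R * (s / r))%R.
have L0 : (0 <= L)%R.
  by case/andP: sr => s0 /(lt_trans s0) r0; rewrite mulr_ge0// ltW// divr_gt0.
have g0 y : 0 <= g y by have /andP[] := g1 y.
have u1 y : 0 <= u y <= 1 by exact: avg_le_cst.
have u0 y : 0 <= u y by have /andP[] := u1 y.
have ufin y : u y \is a fin_num.
  by have /andP[? /le_lt_trans] := u1 y; rewrite ge0_fin_numE// => ->//; rewrite ltry.
have mu_ : measurable_fun setT u by exact: measurable_avg.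
have muh (k : V) : measurable_fun setT (fun y : V => u (y + k)%R).
  rewrite (_ : (fun y => _) = fun y : V => u (k + 1 *: y)%R).
    exact: measurable_comp_affine.
  by apply/funext => y; rewrite scale1r addrC.
have shift_le y k : K (s^-1 *: k) -> u y <= u (y + k)%R + L%:E.
  by move=> Kk; have := avg_shift bK y sr Kk mg g1; rewrite mulr1.
(* Adding [L] makes the difference nonnegative, as the averages require. The cost is the bound 2L
   instead of L, whence the error 2L^2. *)
pose v y := u (y + h)%R + L%:E - u y.
have v0 y : 0 <= v y by rewrite /v sube_ge0 ?shift_le// ufin.
have vL y : v y <= (L *+ 2)%:E.
  have := shift_le (y + h)%R _ (dilN bK Kh); rewrite addrK.
  rewrite /v; have := ufin y; have := ufin (y + h)%R.
  case: (u y) => [a||]//; case: (u (y + h)%R) => [b||]// _ _.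
  by rewrite -?EFinN -!EFinD !lee_fin; lra.
have mv : measurable_fun setT v.
  by apply: emeasurable_funB => //; apply: emeasurable_funD.
have vE y : A r v y + A r u y = A r u (y + h)%R + L%:E.
  rewrite -(avg_translation K r u y h) -[X in _ = _ + X](avg_cst bK r L%:E y).
  rewrite -!avgD//; congr (A r _ y); apply/funext => z.
  by rewrite /v subeK// ufin.
have vshift : A r v (x - h)%R <= A r v x + (L * (L *+ 2))%:E.
  have := avg_shift bK (x - h)%R sr Kh mv; rewrite subrK => /(_ (L *+ 2)%R); apply.
  by move=> y; rewrite v0 vL.
have E1 := vE x; have := vE (x - h)%R; rewrite subrK => E2.
have afin (w : V -> \bar R) c y : measurable_fun setT w -> (forall y, 0 <= w y <= c%:E) ->
    A r w y \is a fin_num.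
  move=> mw wc; have /andP[? /le_lt_trans] := avg_le_cst r y mw wc.
  by rewrite ge0_fin_numE// => ->//; rewrite ltry.
have vL' y : 0 <= v y <= (L *+ 2)%:E by rewrite v0 vL.
move: vshift E1 E2 (afin v _ x mv vL') (afin v _ (x - h)%R mv vL').
move: (afin u _ x mu_ u1) (afin u _ (x - h)%R mu_ u1) (afin u _ (x + h)%R mu_ u1).
case: (A r u x) => [a||]//; case: (A r u (x - h)%R) => [b||]//.
case: (A r u (x + h)%R) => [c||]//; case: (A r v x) => [d||]//.
case: (A r v (x - h)%R) => [e||]// _ _ _ + + + _ _.
rewrite -!EFinD !lee_fin => + [] + []; rewrite expr2 !mulr2n => *; nra.
Qed.

(** The second difference is averaged over h = sz with z in [K]: by symmetry the two shifted terms
    have the same mean, and halving gives the bound. *)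
Lemma avg_avg_le r s (g : V -> \bar R) x : (0 < s < r)%R ->
  measurable_fun setT g -> (forall y, 0 <= g y <= 1) ->
  A r (A r g) x <= A s (A r (A r g)) x + ((n%:R * (s / r)) ^+ 2)%:E.
Proof.
move=> sr mg g1; set u := A r (A r g); set e := ((n%:R * (s / r)) ^+ 2)%R.
have g0 y : 0 <= g y by have /andP[] := g1 y.
have mu1 : measurable_fun setT (A r g) by exact: measurable_avg.
have u11 y : 0 <= A r g y <= 1 by exact: avg_le_cst.
have mu2 : measurable_fun setT u by apply: measurable_avg => // y; have /andP[] := u11 y.
have u1 y : 0 <= u y <= 1 by exact: avg_le_cst.
have u0 y : 0 <= u y by have /andP[] := u1 y.
have e0 : (0 <= e)%R by rewrite sqr_ge0.
have s0 : (0 < s)%R by case/andP: sr.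
have sd z : K z -> u x + u x <= u (x + s *: z)%R + u (x - s *: z)%R + (e *+ 2)%:E.
  by move=> Kz; apply: second_difference => //; rewrite scalerA mulVf ?gt_eqF// scale1r.
clearbody u; have : u x + u x <= A s u x + A s u x + (e *+ 2)%:E.
  have m1 t : measurable_fun K (fun z : V => u (x + t *: z)%R).
    by apply: measurable_funTS; exact: measurable_comp_affine.
  have c0 : 0 <= (e *+ 2)%:E by rewrite lee_fin mulrn_wge0.
  rewrite -[leLHS](avg_cst bK s (u x + u x) x).
  have -> : A s u x + A s u x + (e *+ 2)%:E = (vol^-1)%:E *
      \int[mu]_(z in K) (u (x + s *: z)%R + u (x + (- s) *: z)%R + (e *+ 2)%:E).
    rewrite ge0_integralD//; last 2 first.
    - by move=> z _; exact: adde_ge0.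
    - by apply: emeasurable_funD; exact: m1.
    have I0 t : 0 <= \int[mu]_(z in K) u (x + t *: z)%R by apply: integral_ge0 => z _.
    have -> : \int[mu]_(z in K) (u (x + s *: z)%R + u (x + (- s) *: z)%R) =
        \int[mu]_(z in K) u (x + s *: z)%R + \int[mu]_(z in K) u (x + (- s) *: z)%R.
      by apply: ge0_integralD => //; exact: m1.
    rewrite (ge0_muleDr _ (adde_ge0 (I0 _) (I0 _))) ?integral_ge0//.
    rewrite (ge0_muleDr _ (I0 _) (I0 _)); congr (_ + _ + _).
      by rewrite -[LHS](avg_opp bK s x mu2 u0).
    by rewrite -[LHS](avg_cst bK s _ x).
  rewrite lee_wpmul2l ?lee_fin//; apply: ge0_le_integral => //=.
  - by move=> z _; apply: adde_ge0.
  - by apply: emeasurable_funD => //; apply: emeasurable_funD; exact: m1.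
  - by move=> z Kz; rewrite scaleNr; exact: sd.
have /andP[_ a1] := u1 x; have /andP[_ b1] := avg_le_cst s x mu2 u1.
have := avg_ge0 bK s x u0; have := u0 x; move: a1 b1.
case: (u x) => [a||]//; case: (A s u x) => [b||]// _ _ _ _.
by rewrite -!EFinD !lee_fin mulr2n; lra.
Qed.

Lemma avg_eq0 r a (g : V -> \bar R) x0 x : (0 < r)%R -> (0 < a)%R ->
  (forall y, ~ B x0 a y -> g y = 0) -> ~ B x0 (a + r)%R x -> A r g x = 0.
Proof.
move=> r0 a0 g0 Bx; rewrite /avg integral0_eq ?mule0// => z Kz.
apply: g0 => Bz; apply: Bx; rewrite /body_ball/=.
have -> : (x - x0 = (x + r *: z - x0) + (- (r *: z)))%R by rewrite addrAC addrK.
apply: dilD => //; apply: (dilN bK).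
by rewrite scalerA mulVf ?gt_eqF// scale1r.
Qed.

Lemma avg_eq1 r a (g : V -> \bar R) x0 x : (0 < r)%R -> (0 < a)%R ->
  (forall y, B x0 (a + r)%R y -> g y = 1) -> B x0 a x -> A r g x = 1.
Proof.
move=> r0 a0 g1 Bx; rewrite -[RHS](avg_cst bK r _ x) /avg; congr (_ * _).
apply: eq_integral => z /set_mem Kz; apply: g1.
rewrite /body_ball/= (addrAC x); apply: dilD => //.
by rewrite scalerA mulVf ?gt_eqF// scale1r.
Qed.

(** Self-adjointness transfers the average to the indicator of the ball; the averaged indicator is
    at most 1 and vanishes off the larger ball. *)
Lemma integral_avg_ball r a (g : V -> \bar R) x0 : (0 < r)%R -> (0 < a)%R ->
  measurable_fun setT g -> (forall y, 0 <= g y) ->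
  \int[mu]_(x in B x0 a) A r g x <= \int[mu]_(x in B x0 (a + r)%R) g x.
Proof.
move=> r0 a0 mg g0; rewrite [leLHS]integral_indic_mul [leRHS]integral_indic_mul.
have m1 (D : set V) : measurable D -> measurable_fun setT (fun x => (\1_D x)%:E : \bar R).
  by move=> mD; apply/measurable_EFinP; exact: measurable_indic.
have i0 (D : set V) x : 0 <= (\1_D x)%:E :> \bar R by rewrite lee_fin.
have i1 (D : set V) x : (\1_D x)%:E <= 1 :> \bar R.
  by rewrite lee_fin indicE lern1; case: (_ \in _).
have mB := measurable_body_ball bK x0 a.
rewrite (avg_selfadjoint bK)//; last exact: m1.
apply: ge0_le_integral => //.
- by move=> x _; rewrite mule_ge0// (avg_ge0 bK).
- by apply: emeasurable_funM => //; apply: measurable_avg => //; exact: m1.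
- by apply: emeasurable_funM => //; apply: m1; exact: measurable_body_ball.
move=> x _; have [Bx|Bx] := pselect (B x0 (a + r)%R x).
  rewrite [X in _ <= _ * X%:E]indicE mem_set// mule1 -[leRHS]mule1 lee_wpmul2l//.
  have i01 y : 0 <= ((\1_(B x0 a) y)%:E : \bar R) <= 1 by rewrite i0 i1.
  by have /andP[] := avg_le_cst r x (m1 _ mB) i01.
rewrite (@avg_eq0 r a _ x0)// ?mule0 ?mule_ge0// => y By.
by rewrite indicE memNset.
Qed.

End second_difference.

Section iterated_averages.
Context {R : realType} {n : nat}.
Local Notation V := 'rV[R]_n.
Local Notation mu := (borel_lebesgue R n).
Variable K : set V.
Hypothesis bK : sym_body K.
Local Notation B := (body_ball K).
Local Notation A := (avg K).
Local Open Scope ereal_scope.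

Lemma measurable_translation (g : V -> \bar R) (a : V) :
  measurable_fun setT g -> measurable_fun setT (fun z : V => g (z + a)%R).
Proof.
move=> mg; rewrite (_ : (fun y => _) = fun y : V => g (a + 1 *: y)%R).
  exact: measurable_comp_affine.
by apply/funext => z; rewrite scale1r addrC.
Qed.

Lemma measurable_iter_avg s k (g : V -> \bar R) : measurable_fun setT g ->
  (forall x, 0 <= g x) ->
  measurable_fun setT (iter k (A s) g) /\ (forall x, 0 <= iter k (A s) g x).
Proof.
move=> mg g0; elim: k => [//|k [IH1 IH2]]; split; first exact: measurable_avg.
by move=> x; exact: (avg_ge0 bK).
Qed.

Lemma integral_iter_avg s k a x0 (g : V -> \bar R) : (0 < s)%R -> (0 < a)%R ->
  measurable_fun setT g -> (forall x, 0 <= g x) ->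
  \int[mu]_(x in B x0 a) iter k (A s) g x <= \int[mu]_(x in B x0 (a + k%:R * s)%R) g x.
Proof.
move=> s0 a0 mg g0; elim: k a a0 => [|k IH] a a0; first by rewrite mul0r addr0.
have [mk k0] := measurable_iter_avg s k mg g0.
apply: (le_trans (integral_avg_ball bK _ s0 a0 mk k0)).
apply: (le_trans (IH _ _)); first by rewrite addr_gt0.
by rewrite -natr1 mulrDl mul1r [(_ + s)%R in leRHS]addrC addrA.
Qed.

Variables (lambda : R) (f e : V -> \bar R).
Hypotheses (lambda0 : (0 < lambda)%R)
  (mf : measurable_fun setT f) (f0 : forall x, 0 <= f x)
  (me : measurable_fun setT e) (e0 : forall x, 0 <= e x).
Hypothesis fe : forall s h y, (0 < s)%R -> K ((lambda * s / 2)^-1 *: h) ->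
  A s f (y + h)%R <= f y + e y.

Let mei s i := (measurable_iter_avg s i me e0).1.
Let ei0 s i := (measurable_iter_avg s i me e0).2.

Lemma avg_sum_iter s h j z :
  A s (fun y => \sum_(i < j) iter i (A s) e (y + h *+ i)%R) z =
  \sum_(i < j) iter i.+1 (A s) e (z + h *+ i)%R.
Proof.
elim: j z => [|j IH] z.
  rewrite big_ord0 (_ : (fun _ => _) = cst 0) ?(avg_cst bK)//.
  by apply/funext => ?; rewrite big_ord0.
rewrite big_ord_recr/= -IH -avg_translation -avgD.
- by congr (A s _ z); apply/funext => ?; rewrite big_ord_recr.
- exact: bK.
- by move=> y; apply: sume_ge0 => i _; exact: ei0.
- by move=> y; exact: ei0.
- by apply: emeasurable_sum => i; apply: measurable_translation; exact: mei.
- by apply: measurable_translation; exact: mei.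
Qed.

(** Induction on [k]: the bound for k steps is averaged once more, about y + h. [fe] treats the term
    [f], and each term in [e] gains one average and one shift, so that the sum records [e] along the
    path from y to y + kh. *)
Lemma iter_avg_shift_le s h k y : (0 < s)%R -> K ((lambda * s / 2)^-1 *: h) ->
  iter k (A s) f (y + h *+ k)%R <= f y + \sum_(i < k) iter i (A s) e (y + h *+ i)%R.
Proof.
move=> s0 Kh; elim: k y => [|k IH] y.
  by rewrite big_ord0 mulr0n addr0 adde0.
have [mfk fk0] := measurable_iter_avg s k mf f0.
pose E y := \sum_(i < k) iter i (A s) e (y + h *+ i)%R.
have mE : measurable_fun setT E.
  by apply: emeasurable_sum => i; apply: measurable_translation; exact: mei.
have E0 z : 0 <= E z by apply: sume_ge0 => i _; exact: ei0.
apply: (@le_trans _ _ (A s (fun z => f z + E z) (y + h)%R)).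
  rewrite iterS mulrS addrA -avg_translation; apply: (le_avg bK).
  - by move=> z; exact: fk0.
  - exact: measurable_translation.
  - exact: emeasurable_funD.
  - exact: IH.
rewrite (avgD bK)// avg_sum_iter big_ord_recl/= mulr0n addr0 addeA.
apply: leeD; first exact: fe.
by apply: lee_sum => i _; rewrite /bump/= mulrS addrA.
Qed.

End iterated_averages.

Section weighted_integral.
Context {R : realType} {n : nat}.
Local Notation V := 'rV[R]_n.
Local Notation mu := (borel_lebesgue R n).
Variable K : set V.
Hypothesis bK : sym_body K.
Local Notation B := (body_ball K).
Local Notation A := (avg K).
Local Open Scope ereal_scope.

Variables (lambda : R) (f e : V -> \bar R).
Hypotheses (lambda0 : (0 < lambda)%R)
  (mf : measurable_fun setT f) (f0 : forall x, 0 <= f x)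
  (me : measurable_fun setT e) (e0 : forall x, 0 <= e x).
Hypothesis fe : forall s h y, (0 < s)%R -> K ((lambda * s / 2)^-1 *: h) ->
  A s f (y + h)%R <= f y + e y.

Let mei s i := (measurable_iter_avg bK s i me e0).1.
Let ei0 s i := (measurable_iter_avg bK s i me e0).2.
Let mB x r := measurable_body_ball bK x r.
Let mind (D : set V) : measurable D -> measurable_fun setT (fun x => (\1_D x)%:E : \bar R).
Proof. by move=> mD; apply/measurable_EFinP; exact: measurable_indic. Qed.

(** The homothety of centre y and ratio t maps the ball into itself by convexity. The change of
    variables costs t^-n, and i averages enlarge the ball by is, which [b] accommodates. *)
Lemma integral_iter_avg_contract s i t a b x0 y : (0 < s)%R -> (0 < a)%R ->
  (0 < t <= 1)%R -> B x0 a y -> (a + i%:R * s <= b)%R ->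
  \int[mu]_(x in B x0 a) iter i (A s) e ((y - t *: y) + t *: x)%R <=
  (t ^- n)%:E * \int[mu]_(x in B x0 b) e x.
Proof.
move=> s0 a0 /andP[t0 t1] By ab.
pose phi (x : V) := ((y - t *: y) + t *: x)%R.
have mphi : measurable (phi @^-1` B x0 a).
  by rewrite -[X in measurable X]setTI; apply: measurable_rV_affine.
apply: (@le_trans _ _ (\int[mu]_(x in phi @^-1` B x0 a) iter i (A s) e (phi x))).
  apply: ge0_subset_integral; [exact: mB|exact: mphi| | |].
  - by apply: measurable_funTS; apply: measurable_comp_affine; exact: mei.
  - by move=> x _; exact: ei0.
  move=> x Bx; rewrite /phi/body_ball/=.
  have t01 : (0 <= t <= 1)%R by rewrite (ltW t0).
  have := body_convex bK t01 Bx By; congr K.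
  apply/rowP => j; rewrite !mxE; ring.
rewrite ge0_integral_affine; [|by rewrite gt_eqF|exact: mB|exact: mei|exact: ei0].
rewrite gtr0_norm//; apply: lee_wpmul2l.
  by rewrite lee_fin invr_ge0 exprn_ge0// ltW.
apply: (le_trans (integral_iter_avg bK _ _ s0 a0 me e0)).
apply: ge0_subset_integral; [exact: mB|exact: mB| | |].
- exact: measurable_funTS.
- by move=> x _.
- by apply: (body_ball_le bK) => //; rewrite ltr_wpDr// mulr_ge0// ltW.
Qed.

(** Every x of the ball is reached from y in m + 1 equal steps, so f y, e y and averages of [e]
    along the segment dominate the iterated average at x. The bound follows by integrating in x
    against [w]. *)
Lemma weighted_integral_le m x0 a (w : V -> \bar R) y : (0 < a)%R ->
  measurable_fun setT w -> (forall x, 0 <= w x <= 1) -> (forall x, ~ B x0 a x -> w x = 0) ->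
  B x0 a y ->
  \int[mu]_x (w x * iter m.+1 (A (4 * a / (lambda * m.+1%:R))%R) f x) <=
  (f y + e y) * \int[mu]_x w x +
  (m.+1%:R ^+ n.+1)%:E * \int[mu]_(x in B x0 (a + 4 * a / lambda)%R) e x.
Proof.
move=> a0 mw w1 wB By; set s := (4 * a / _)%R; set M := m.+1.
have M0 : (0 < M%:R :> R)%R by [].
have s0 : (0 < s)%R by rewrite divr_gt0// mulr_gt0.
have w0 x : 0 <= w x by have /andP[] := w1 x.
pose t i : R := (i%:R / M%:R)%R.
pose g i (x : V) := iter i (A s) e ((y - t i *: y) + t i *: x)%R.
have mg i : measurable_fun setT (g i) by apply: measurable_comp_affine; exact: mei.
have g0 i x : 0 <= g i x by exact: ei0.
have [mfM fM0] := measurable_iter_avg bK s M mf f0.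
have mg1 i : measurable_fun setT (fun x => g i x * (\1_(B x0 a) x)%:E).
  by apply: emeasurable_funM; [exact: mg|exact: mind].
have g10 i x : 0 <= g i x * (\1_(B x0 a) x)%:E by rewrite mule_ge0// lee_fin.
have fey0 : 0 <= f y + e y by exact: adde_ge0.
apply: (@le_trans _ _ (\int[mu]_x ((f y + e y) * w x +
    \sum_(i < m) (g i.+1 x * (\1_(B x0 a) x)%:E)))).
  apply: ge0_le_integral.
  - exact: measurableT.
  - by move=> x _; rewrite mule_ge0.
  - exact: emeasurable_funM.
  - apply: emeasurable_funD; first exact: measurable_funeM.
    by apply: emeasurable_sum => i; exact: mg1.
  move=> x _; have [Bx|Bx] := pselect (B x0 a x); last first.
    by rewrite wB// mul0e mule0 add0e sume_ge0.
  under eq_bigr do rewrite indicE mem_set// mule1.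
  (* x - y lies in 2a [K]. The radius s = 4a/(lambda M) is the one for which (2a/M) [K] equals
     (lambda s/2) [K], the set of shifts allowed by [fe]. *)
  pose h : V := M%:R^-1 *: (x - y).
  have Kh : K ((lambda * s / 2)^-1 *: h).
    rewrite /h scalerA (_ : (_ * _)%R = (a + a)^-1)%R.
      rewrite (_ : x - y = (x - x0) + (- (y - x0)))%R; last first.
        by rewrite opprB addrA subrK.
      by apply: (dilD bK) => //; exact: (dilN bK).
    by rewrite /s; move: M0; set M' := M%:R; move=> M0; field; rewrite !gt_eqF// addr_gt0.
  have gE i : g i x = iter i (A s) e (y + h *+ i)%R.
    rewrite /g /h -scaler_nat scalerA; congr (iter _ _ _ _).
    by apply/rowP => j; rewrite !mxE /t; ring.
  have := iter_avg_shift_le bK mf f0 me e0 fe M y s0 Kh; rewrite (_ : y + h *+ M = x)%R; last first.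
    by rewrite /h -scaler_nat scalerA mulfV ?gt_eqF// scale1r addrC subrK.
  (* The term i = 0 is e y itself: a contraction of ratio 0 could not be integrated, so it is kept
     next to f y. *)
  rewrite big_ord_recl/= mulr0n addr0 addeA => ch.
  apply: (@le_trans _ _ (w x * (f y + e y + \sum_(i < m) g i.+1 x))).
    rewrite lee_wpmul2l//; apply: (le_trans ch); rewrite leeD2l//.
    by apply: lee_sum => i _; rewrite gE.
  have S0 : 0 <= \sum_(i < m) g i.+1 x by apply: sume_ge0.
  rewrite ge0_muleDr// muleC leeD2l// -[leRHS]mul1e lee_wpmul2r//.
  by have /andP[] := w1 x.
rewrite ge0_integralD; last 5 first.
- exact: measurableT.
- by move=> x _; rewrite mule_ge0.
- exact: measurable_funeM.
- by move=> x _; exact: sume_ge0.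
- by apply: emeasurable_sum => i; exact: mg1.
rewrite ge0_integralZl// leeD2l//.
rewrite ge0_integral_sum//.
have int_le (i : 'I_m) : \int[mu]_x (g i.+1 x * (\1_(B x0 a) x)%:E) <=
    (M%:R ^+ n)%:E * \int[mu]_(x in B x0 (a + 4 * a / lambda)%R) e x.
  rewrite -integral_indic_mul.
  have ti0 : (0 < t i.+1)%R by rewrite divr_gt0.
  have ti1 : (t i.+1 <= 1)%R by rewrite ler_pdivrMr// mul1r ler_nat ltnS ltnW.
  apply: (le_trans (integral_iter_avg_contract (b := (a + 4 * a / lambda)%R) s0 a0 _ By _)).
  - by rewrite ti0.
  - rewrite lerD2l (_ : (4 * a / lambda = M%:R * s)%R).
      by rewrite ler_wpM2r ?(ltW s0)// ler_nat ltnS ltnW.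
    by rewrite /s; move: M0; set M' := M%:R; move=> M0; field; rewrite !gt_eqF.
  apply: lee_wpmul2r; first by apply: integral_ge0.
  (* The ratio t is at least 1/M, so t^-n is at most M^n; the m terms together give at most M^(n +
     1). *)
  rewrite lee_fin -exprVn; apply: lerXn2r.
  - by rewrite nnegrE invr_ge0 ltW.
  - by rewrite nnegrE ltW.
  - by rewrite invf_div ler_pdivrMr ?ltr0n//; apply: ler_peMr; [exact: ltW|rewrite ler1n].
apply: (le_trans (lee_sum _ (fun i _ => int_le i))).
rewrite -ge0_sume_distrl; last by move=> i _; rewrite lee_fin exprn_ge0// ltW.
apply: lee_wpmul2r; first by apply: integral_ge0.
rewrite sumEFin sumr_const card_ord lee_fin -[leLHS]mulr_natr exprSr.
apply: ler_wpM2l; [by rewrite exprn_ge0// ltW|by rewrite ler_nat].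
Qed.

End weighted_integral.

Lemma ge0_integral_setC {d} {T : measurableType d} {R : realType}
    (m : {measure set T -> \bar R}) (D : set T) (g : T -> \bar R) :
  measurable D -> measurable_fun setT g -> (forall x, 0 <= g x)%E ->
  (\int[m]_x g x = \int[m]_(x in D) g x + \int[m]_(x in ~` D) g x)%E.
Proof.
move=> mD mg g0; rewrite -ge0_integral_setU ?setUv//.
- exact: measurableC.
- by apply/disj_setPS => x [].
Qed.

(** * A cutoff and the error of transferring averages through it *)

Section local_estimate.
Context {R : realType} {n : nat}.
Local Notation V := 'rV[R]_n.
Local Notation mu := (borel_lebesgue R n).
Variable K : set V.
Hypothesis bK : sym_body K.
Local Notation B := (body_ball K).
Local Notation A := (avg K).
Local Open Scope ereal_scope.

Let mB x r := measurable_body_ball bK x r.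
Let mind (D : set V) : measurable D -> measurable_fun setT (fun x => (\1_D x)%:E : \bar R).
Proof. by move=> mD; apply/measurable_EFinP; exact: measurable_indic. Qed.

(** Radius 3a/4 and two averages at radius a/8 leave the value 1 on radius a/2 and 0 off radius a.
    Two averages are what [second_difference] asks for. *)
Definition cutoff (x0 : V) (a : R) : V -> \bar R :=
  A (a / 8)%R (A (a / 8)%R (fun x => (\1_(B x0 (3 * a / 4)%R) x)%:E)).

Let indic01 (D : set V) x : 0 <= ((\1_D x : R)%:E : \bar R) <= (1%R : R)%:E.
Proof. by rewrite !lee_fin indicE ler0n lern1 leq_b1. Qed.

Let cutoff_aux x0 a : measurable_fun setT (A (a / 8)%R (fun x => (\1_(B x0 (3 * a / 4)%R) x)%:E)).
Proof. by apply: (measurable_avg bK); [exact: mind|move=> y; have /andP[] := indic01 (B x0 (3 * a / 4)%R) y]. Qed.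

Let cutoff_aux01 x0 a x : 0 <= A (a / 8)%R (fun x => (\1_(B x0 (3 * a / 4)%R) x)%:E) x <= 1%R%:E.
Proof. by apply: (avg_le_cst bK); [exact: mind|move=> y; exact: indic01]. Qed.

Lemma cutoff01 x0 a x : 0 <= cutoff x0 a x <= 1.
Proof. by apply: (avg_le_cst bK); [exact: cutoff_aux|move=> y; exact: cutoff_aux01]. Qed.

Lemma cutoff_ge0 x0 a x : 0 <= cutoff x0 a x.
Proof. by have /andP[] := cutoff01 x0 a x. Qed.

Lemma measurable_cutoff x0 a : measurable_fun setT (cutoff x0 a).
Proof.
apply: (measurable_avg bK); first exact: cutoff_aux.
by move=> y; have /andP[] := cutoff_aux01 x0 a y.
Qed.

Lemma cutoff_out x0 a x : (0 < a)%R -> ~ B x0 a x -> cutoff x0 a x = 0.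
Proof.
move=> a0 Bx; have a8 : (0 < a / 8)%R by rewrite divr_gt0.
apply: (avg_eq0 bK (a := (7 * a / 8)%R) (x0 := x0)) => //.
- by rewrite divr_gt0// mulr_gt0.
- move=> y By; apply: (avg_eq0 bK (a := (3 * a / 4)%R) (x0 := x0)) => //.
  + by rewrite divr_gt0// mulr_gt0.
  + by move=> z Bz; rewrite indicE memNset.
  + by rewrite (_ : 3 * a / 4 + a / 8 = 7 * a / 8)%R//; field.
- by rewrite (_ : 7 * a / 8 + a / 8 = a)%R//; field.
Qed.

Lemma cutoff_in x0 a x : (0 < a)%R -> B x0 (a / 2)%R x -> cutoff x0 a x = 1.
Proof.
move=> a0; have a8 : (0 < a / 8)%R by rewrite divr_gt0.
apply: (avg_eq1 bK) => //; first by rewrite divr_gt0.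
move=> y; apply: (avg_eq1 bK) => //; first by rewrite addr_gt0// divr_gt0.
move=> z; rewrite (_ : _ + _ = 3 * a / 4)%R; last by field.
by move=> Bz; rewrite indicE mem_set.
Qed.

Lemma cutoff_avg x0 a s x : (0 < s < a / 8)%R ->
  cutoff x0 a x <= A s (cutoff x0 a) x + ((n%:R * (s / (a / 8))) ^+ 2)%:E.
Proof. by move=> sa; apply: (avg_avg_le bK) => //; exact: mind. Qed.

(** The cutoff is at most its own average plus a second order error, and it vanishes off the ball,
    so the error only meets the mass of [g] there. Self-adjointness then moves the average to
    [g]. *)
Lemma cutoff_integral_avg x0 a s (g : V -> \bar R) : (0 < s < a / 8)%R ->
  measurable_fun setT g -> (forall x, 0 <= g x) ->
  \int[mu]_x (cutoff x0 a x * g x) <=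
  \int[mu]_x (cutoff x0 a x * A s g x) +
  ((n%:R * (s / (a / 8))) ^+ 2)%:E * \int[mu]_(x in B x0 a) g x.
Proof.
move=> sa mg g0; have a0 : (0 < a)%R.
  by case/andP: sa => s0 /(lt_trans s0); rewrite pmulr_lgt0.
have mw := measurable_cutoff x0 a; have w0 := cutoff_ge0 x0 a.
set L := ((n%:R * _) ^+ 2)%R; have L0 : (0 <= L)%R by exact: sqr_ge0.
rewrite -(avg_selfadjoint bK)// (integral_indic_mul _ (B x0 a)) -ge0_integralZl//; last 2 first.
- by apply: emeasurable_funM => //; exact: mind.
- by move=> x _; rewrite mule_ge0// lee_fin.
have ms : measurable_fun setT (A s (cutoff x0 a)) by exact: measurable_avg.
have As0 x : 0 <= A s (cutoff x0 a) x by exact: (avg_ge0 bK).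
have gi0 x : 0 <= g x * (\1_(B x0 a) x)%:E by rewrite mule_ge0// lee_fin.
rewrite -ge0_integralD//; last 4 first.
- by move=> x _; rewrite mule_ge0.
- by apply: emeasurable_funM; [exact: ms|exact: mg].
- by move=> x _; rewrite mule_ge0// lee_fin.
- by apply: measurable_funeM; apply: emeasurable_funM => //; exact: mind.
apply: ge0_le_integral => //.
- by move=> x _; rewrite mule_ge0.
- by apply: emeasurable_funM; [exact: mw|exact: mg].
- apply: emeasurable_funD; first by apply: emeasurable_funM; [exact: ms|exact: mg].
  by apply: measurable_funeM; apply: emeasurable_funM => //; exact: mind.
move=> x _; have [Bx|Bx] := pselect (B x0 a x); last first.
  by rewrite cutoff_out// mul0e adde_ge0// mule_ge0// lee_fin.
rewrite indicE mem_set// mule1 -ge0_muleDl ?lee_fin//.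
by rewrite lee_wpmul2r//; exact: cutoff_avg.
Qed.

(** Each step costs the same square, times the mass on the ball of an already averaged [g]; by
    [integral_iter_avg] this is at most the mass of [g] on a slightly larger ball. *)
Lemma cutoff_integral_iter_avg x0 a s k (g : V -> \bar R) : (0 < s < a / 8)%R ->
  measurable_fun setT g -> (forall x, 0 <= g x) ->
  \int[mu]_x (cutoff x0 a x * g x) <=
  \int[mu]_x (cutoff x0 a x * iter k (A s) g x) +
  (k%:R * (n%:R * (s / (a / 8))) ^+ 2)%:E * \int[mu]_(x in B x0 (a + k%:R * s)%R) g x.
Proof.
move=> sa mg g0; have s0 : (0 < s)%R by case/andP: sa.
have a0 : (0 < a)%R by case/andP: sa => ? /(lt_trans s0); rewrite pmulr_lgt0.
set L := ((n%:R * _) ^+ 2)%R; have L0 : (0 <= L)%R by exact: sqr_ge0.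
have I0 c : 0 <= \int[mu]_(x in B x0 c) g x by exact: integral_ge0.
elim: k => [|k IH]; first by rewrite mul0r mul0e adde0.
have [mk k0] := measurable_iter_avg bK s k mg g0.
apply: (le_trans IH); apply: (@le_trans _ _ (\int[mu]_x (cutoff x0 a x * iter k.+1 (A s) g x) +
   L%:E * \int[mu]_(x in B x0 a) iter k (A s) g x +
   (k%:R * L)%:E * \int[mu]_(x in B x0 (a + k%:R * s)%R) g x)).
  by rewrite leeD2r//; exact: cutoff_integral_avg.
rewrite -addeA leeD2l// -natr1 !mulrDl !mul1r EFinD.
rewrite ge0_muleDl; [|by rewrite lee_fin mulr_ge0|by rewrite lee_fin].
have ak : (0 < a + k%:R * s)%R by rewrite ltr_wpDr// mulr_ge0// ltW.
have le1 : \int[mu]_(x in B x0 (a + k%:R * s)%R) g x <=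
    \int[mu]_(x in B x0 (a + (k%:R * s + s))%R) g x.
  apply: ge0_subset_integral; [exact: mB|exact: mB|exact: measurable_funTS| |].
  - by move=> x _; exact: g0.
  - by apply: (body_ball_le bK) => //; rewrite lerD2l lerDl ltW.
rewrite [leLHS]addeC; apply: leeD.
  by apply: lee_wpmul2l => //; rewrite lee_fin mulr_ge0.
apply: lee_wpmul2l => //; apply: le_trans le1.
exact: (integral_iter_avg bK).
Qed.

End local_estimate.

(* Real arithmetic of the averaging argument: [g] is the measure of the level set, [W] the mass
   of the cutoff and [W1] its mass off the level set. *)
Lemma local_level_set_arith {R : realType} (g F E I0 W1 J W : \bar R) (t kap N d : R) :
  (0 < t)%R -> (1 <= N)%R -> (0 <= kap)%R -> (0 < d)%R ->
  g \is a fin_num -> F \is a fin_num -> E \is a fin_num -> I0 \is a fin_num ->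
  W1 \is a fin_num -> J \is a fin_num -> W \is a fin_num ->
  (0 <= g -> 0 <= F -> 0 <= E ->
  d%:E <= W -> I0 <= t%:E * d%:E -> (t *+ 2)%:E * g + J <= I0 -> W = g + W1 ->
  I0 * W1 <= (J + E) * W + (N%:E * E + kap%:E * F) * W1 ->
  t%:E * g <= (N *+ 2)%:E * E + kap%:E * F)%E.
Proof.
move=> t0 N1 kap0 d0.
case: g => [g||]//; case: F => [Fr||]//; case: E => [Er||]//.
case: I0 => [i||]//; case: W1 => [w1||]//; case: J => [j||]//; case: W => [W'||]//.
move=> _ _ _ _ _ _ _.
rewrite -?EFinM -?EFinD -?EFinM -?EFinD !lee_fin => g0 F0 E0 dW id gi [Ww] key.
have W'0 : 0 < W' by exact: lt_le_trans d0 dW.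
have X0 : 0 <= N * Er + kap * Fr by rewrite addr_ge0// mulr_ge0// (le_trans ler01).
have EN : Er <= N * Er by rewrite ler_peMl.
suff : t * g <= Er + (N * Er + kap * Fr) by rewrite mulr2n mulrDl; lra.
set Xr := N * Er + kap * Fr in key X0 *.
rewrite -(ler_pM2r W'0).
have h1 : i * g <= t * W' * g.
  by rewrite ler_wpM2r// (le_trans id)// ler_wpM2l// ltW.
have w1E : w1 = W' - g by rewrite Ww addrAC subrr add0r.
have h2 : Xr * w1 <= Xr * W' by rewrite ler_wpM2l// w1E lerBlDr lerDl.
have h3 : (j + Er) * W' <= (i - t *+ 2 * g + Er) * W'.
  by rewrite ler_wpM2r ?(ltW W'0)// lerD2r lerBrDl.
rewrite {}w1E in key h2.
move: key h1 h2 h3; rewrite mulr2n; nra.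
Qed.

(** * The level set estimate on one ball *)

Section local_level_set.
Context {R : realType} {n : nat}.
Local Notation V := 'rV[R]_n.
Local Notation mu := (borel_lebesgue R n).
Variable K : set V.
Hypothesis bK : sym_body K.
Local Notation B := (body_ball K).
Local Notation A := (avg K).
Local Open Scope ereal_scope.

Variables (lambda : R) (f e : V -> \bar R).
Hypotheses (lambda0 : (0 < lambda)%R)
  (mf : measurable_fun setT f) (f0 : forall x, 0 <= f x)
  (me : measurable_fun setT e) (e0 : forall x, 0 <= e x).
Hypothesis fe : forall s h y, (0 < s)%R -> K ((lambda * s / 2)^-1 *: h) ->
  A s f (y + h)%R <= f y + e y.

Let mB x r := measurable_body_ball bK x r.

(** For every y of the ball, I0 is at most (f y + e y) W + X, where X collects the errors. This is
    integrated against [w] in y. Over the whole ball the term I0 W would stand on both sides. Over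
    the complement of [G] the right side loses 2t mu(G) W, while the left side loses I0 mu(G), at
    most t mu(G) W since I0 <= t mu(D) <= t W. The difference t mu(G) W is what the errors must pay
    for. *)
Lemma local_level_set m x0 a t : (0 < a)%R -> (0 < t)%R -> (32 < lambda * m.+1%:R)%R ->
  \int[mu]_(x in B x0 a) f x <= t%:E * mu (B x0 (a / 2)%R) ->
  \int[mu]_(x in B x0 (a + 4 * a / lambda)%R) f x < +oo ->
  t%:E * mu ([set x | (t *+ 2)%:E < f x] `&` B x0 (a / 2)%R) <=
  (m.+1%:R ^+ n.+1 *+ 2)%:E * \int[mu]_(x in B x0 (a + 4 * a / lambda)%R) e x +
  ((n%:R * 32 / lambda) ^+ 2 / m.+1%:R)%:E *
    \int[mu]_(x in B x0 (a + 4 * a / lambda)%R) f x.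
Proof.
move=> a0 t0 lm fa fb.
set b := (a + 4 * a / lambda)%R; set M := m.+1.
set kap := ((n%:R * 32 / lambda) ^+ 2 / M%:R)%R.
set E := \int[mu]_(x in B x0 b) e x; set F := \int[mu]_(x in B x0 b) f x.
have M0 : (0 < M%:R :> R)%R by [].
have M1 : (1 <= M%:R ^+ n.+1 :> R)%R by rewrite exprn_ege1// ler1n.
have kap0 : (0 <= kap)%R.
  by apply: divr_ge0; [exact: sqr_ge0|exact: ltW].
have E0 : 0 <= E by exact: integral_ge0.
have F0 : 0 <= F by exact: integral_ge0.
have [Eoo|Efin] := eqVneq E +oo.
  rewrite Eoo gt0_muley; last by rewrite lte_fin mulrn_wgt0// (lt_le_trans ltr01).
  by rewrite addye ?leey// gt_eqF// (lt_le_trans (ltNyr 0))// mule_ge0// lee_fin.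
set w := cutoff K x0 a.
have mw : measurable_fun setT w := measurable_cutoff bK x0 a.
have w01 x : 0 <= w x <= 1 := cutoff01 bK x0 a x.
have w0 x : 0 <= w x := cutoff_ge0 bK x0 a x.
have wout x : ~ B x0 a x -> w x = 0 := @cutoff_out _ _ _ bK _ _ _ a0.
have win x : B x0 (a / 2)%R x -> w x = 1 := @cutoff_in _ _ _ bK _ _ _ a0.
set s := (4 * a / (lambda * M%:R))%R.
have lM0 : (0 < lambda * M%:R)%R by exact: mulr_gt0.
have s0 : (0 < s)%R by rewrite divr_gt0// mulr_gt0.
(* The averages in the cutoff have radius a/8; s < a/8 amounts to 32 < lambda M. *)
have sa : (0 < s < a / 8)%R.
  rewrite s0/= /s ltr_pdivrMr//.
  by rewrite (_ : 4 * a = a / 8 * 32)%R ?ltr_pM2l// ?divr_gt0//; field.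
have bE : (a + M%:R * s = b)%R.
  by rewrite /b /s; move: M0; set M' := M%:R; move=> M0; field; rewrite !gt_eqF.
have cut := cutoff_integral_iter_avg bK x0 M sa mf f0.
rewrite bE -/w -/F in cut.
(* M steps, each with error (32 n/(lambda M))^2: one factor 1/M survives. *)
have kapE : (M%:R * (n%:R * (s / (a / 8))) ^+ 2 = kap)%R.
  by rewrite /kap /s; move: M0; set M' := M%:R; move=> M0; field; rewrite !gt_eqF.
rewrite kapE in cut.
pose I0 := \int[mu]_x (w x * f x); pose W := \int[mu]_x w x.
pose X := (M%:R ^+ n.+1)%:E * E + kap%:E * F.
have wf_le y : B x0 a y -> I0 <= (f y + e y) * W + X.
  move=> By; apply: (le_trans cut).
  rewrite /X addeA leeD2r//.
  exact: (weighted_integral_le bK lambda0 mf f0 me e0 fe m a0 mw w01 wout By).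
clear cut; clearbody w.
set D := B x0 (a / 2)%R; set G := [set x | _] `&` D.
have mD : measurable D by exact: mB.
have mG : measurable G.
  apply: measurableI => //; rewrite -[X in measurable X]setTI.
  exact: emeasurable_fun_o_infty.
have a20 : (0 < a / 2)%R by rewrite divr_gt0.
have Dfin : mu D < +oo by rewrite mu_ballE// ltry.
have GD : mu G <= mu D by apply: le_measure; rewrite ?inE//; exact: subIsetr.
have Gfin : mu G \is a fin_num by rewrite ge0_fin_numE// (le_lt_trans GD).
have mnG : measurable (~` G) by exact: measurableC.
have mwf : measurable_fun setT (fun x => w x * f x) by exact: emeasurable_funM.
have mwe : measurable_fun setT (fun x => w x * e x) by exact: emeasurable_funM.
have wf0 x : 0 <= w x * f x by exact: mule_ge0.
have we0 x : 0 <= w x * e x by exact: mule_ge0.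
have le_ball (g : V -> \bar R) c : measurable_fun setT g -> (forall x, 0 <= g x) -> (a <= c)%R ->
    \int[mu]_x (w x * g x) <= \int[mu]_(x in B x0 c) g x.
  move=> mg g0 ac; apply: (@le_trans _ _ (\int[mu]_(x in B x0 a) g x)).
    rewrite [leRHS]integral_indic_mul; apply: ge0_le_integral => //.
    - by move=> x _; exact: mule_ge0.
    - exact: emeasurable_funM.
    - by apply: emeasurable_funM => //; apply/measurable_EFinP; exact: measurable_indic.
    move=> x _; have [Bx|Bx] := pselect (B x0 a x); last by rewrite wout// mul0e mule_ge0 ?lee_fin.
    by rewrite indicE mem_set// mule1 -[leRHS]mul1e lee_wpmul2r//; have /andP[] := w01 x.
  by apply: ge0_subset_integral => //; [exact: measurable_funTS|exact: body_ball_le].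
have ab : (a <= b)%R by rewrite /b lerDl divr_ge0// ?mulr_ge0// ltW.
have I0t : I0 <= t%:E * mu D by apply: le_trans fa; exact: le_ball.
have Ele : \int[mu]_x (w x * e x) <= E by exact: le_ball.
have W1E : W = mu G + \int[mu]_(x in ~` G) w x.
  rewrite /W (ge0_integral_setC mu mG)//; congr (_ + _).
  rewrite -[RHS]mul1e -integral_cst//; apply: eq_integral => x /set_mem[_ Dx].
  exact: win.
have WD : mu D <= W.
  rewrite /W (ge0_integral_setC mu mD)// (_ : \int[mu]_(x in D) w x = mu D) ?leeDl ?integral_ge0//.
  by rewrite -[RHS]mul1e -integral_cst//; apply: eq_integral => x /set_mem; exact: win.
have Wfin : W \is a fin_num.
  rewrite ge0_fin_numE; last exact: integral_ge0.
  have := le_ball (cst 1) a (@measurable_cst _ _ _ _ _ _) (fun=> lee01) (lexx _).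
  under eq_integral do rewrite mule1.
  by move=> /le_lt_trans; apply; rewrite integral_cst// mul1e [X in X < _](mu_ballE bK)// ltry.
set W1 := \int[mu]_(x in ~` G) w x in W1E.
set J := \int[mu]_(x in ~` G) (w x * f x).
have I0E : (t *+ 2)%:E * mu G + J <= I0.
  rewrite /I0 (ge0_integral_setC mu mG)// leeD2r// -integral_cst//.
  apply: ge0_le_integral => //.
  - by move=> x _; rewrite lee_fin mulrn_wge0// ltW.
  - exact: measurable_funTS.
  - by move=> x [fx Dx]; rewrite win// mul1e ltW.
have I00 : 0 <= I0 by exact: integral_ge0.
have W0 : 0 <= W by exact: integral_ge0.
have W10 : 0 <= W1 by exact: integral_ge0.
have J0 : 0 <= J by exact: integral_ge0.
have X0 : 0 <= X.
  by apply: adde_ge0; apply: mule_ge0 => //; rewrite lee_fin// (le_trans ler01).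
have key : I0 * W1 <= (J + E) * W + X * W1.
  have mwnG : measurable_fun (~` G) w by exact: measurable_funTS.
  have mwfnG : measurable_fun (~` G) (fun x => w x * f x) by exact: measurable_funTS.
  have mwenG : measurable_fun (~` G) (fun x => w x * e x) by exact: measurable_funTS.
  have mwfe : measurable_fun (~` G) (fun x => w x * f x + w x * e x) by exact: emeasurable_funD.
  have wfe0 x : 0 <= w x * f x + w x * e x by exact: adde_ge0.
  apply: (@le_trans _ _ (\int[mu]_(x in ~` G) ((w x * f x + w x * e x) * W + X * w x))).
    rewrite -ge0_integralZl//; apply: ge0_le_integral => //.
    - by move=> x _; exact: mule_ge0.
    - exact: measurable_funeM.
    - apply: emeasurable_funD; last exact: measurable_funeM.
      by apply: emeasurable_funM => //; exact: measurable_cst.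
    move=> x _; have [Bx|Bx] := pselect (B x0 a x); last first.
      by rewrite wout// !mul0e !mule0 add0e mul0e adde0.
    have fe0 : 0 <= f x + e x by exact: adde_ge0.
    rewrite muleC -(ge0_muleDr _ (f0 x) (e0 x)) -muleA (muleC X).
    rewrite -(ge0_muleDr _ (mule_ge0 fe0 W0) X0).
    by apply: lee_wpmul2l => //; exact: wf_le.
  rewrite ge0_integralD//; last 4 first.
  - by move=> x _; exact: mule_ge0.
  - by apply: emeasurable_funM => //; exact: measurable_cst.
  - by move=> x _; exact: mule_ge0.
  - exact: measurable_funeM.
  rewrite ge0_integralZr// [X in _ + X <= _]ge0_integralZl// leeD2r//.
  apply: lee_wpmul2r => //; rewrite ge0_integralD// leeD2l//.
  apply: le_trans Ele; apply: ge0_subset_integral => //.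
have Ffin : F \is a fin_num by rewrite ge0_fin_numE.
have Efin' : E \is a fin_num by rewrite ge0_fin_numE// lt_neqAle Efin leey.
have Dd : mu D = ((a / 2) ^+ n * vol K)%:E by exact: mu_ballE.
have d0 : (0 < (a / 2) ^+ n * vol K)%R by rewrite mulr_gt0 ?exprn_gt0 ?vol_gt0.
rewrite Dd in I0t WD; clear Dd.
have I0fin : I0 \is a fin_num by rewrite ge0_fin_numE// (le_lt_trans I0t)// ltry.
have W1fin : W1 \is a fin_num by move: Wfin; rewrite W1E fin_numD => /andP[].
have Jfin : J \is a fin_num.
  rewrite ge0_fin_numE// (@le_lt_trans _ _ I0)//; last by rewrite -ge0_fin_numE.
  by apply: le_trans I0E; rewrite leeDr// mule_ge0// lee_fin mulrn_wge0// ltW.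
exact: (local_level_set_arith t0 M1 kap0 d0 Gfin Ffin Efin' I0fin W1fin Jfin Wfin (measure_ge0 _ _) F0 E0 WD I0t I0E W1E key).
Qed.

End local_level_set.

(** * Vitali covering and differentiation *)

Section vitali.
Context {R : realType} {n : nat}.
Local Notation V := 'rV[R]_n.
Local Notation mu := (borel_lebesgue R n).
Variable K : set V.
Hypothesis bK : sym_body K.
Local Notation B := (body_ball K).

Lemma body_ball_meet x y r s : 0 < r -> 0 < s -> r <= s -> B x r `&` B y s !=set0 ->
  B x r `<=` B y (3 * s).
Proof.
move=> r0 s0 rs [z [xz yz]] w xw.
have -> : 3 * s = (s + s) + s by rewrite -!natr1; ring.
have /= Kxz := dil_le bK r0 rs xz; have /= Kxw := dil_le bK r0 rs xw.
rewrite /body_ball/= (_ : w - y = ((w - x) + - (z - x)) + (z - y)); last first.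
  by apply/rowP => j; rewrite !mxE; ring.
by do 2?apply: (dilD bK) => //; [rewrite addr_gt0|exact: (dilN bK)].
Qed.

(** Greedy choice: a ball of largest radius is kept, those meeting it lie in its triple and are
    discarded, and the shorter list is treated recursively. *)
Lemma finite_vitali (I : eqType) (c : I -> V) (r : I -> R) (s : seq I) :
  {in s, forall i, 0 < r i} ->
  exists d : seq I, [/\ uniq d, {subset d <= s},
    trivIset [set` d] (fun i => B (c i) (r i)) &
    {in s, forall i, exists2 j, j \in d & B (c i) (r i) `<=` B (c j) (3 * r j)}].
Proof.
have [k] := ubnP (size s); elim: k s => // k IH [|i s] sk r0.
  by exists [::]; split => //; apply/trivIsetP.
have [i0 i0s i0max] : exists2 i0, i0 \in i :: s & {in i :: s, forall j, r j <= r i0}.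
  elim: s i {sk r0} => [|j s IHs] i.
    by exists i; rewrite ?mem_head// => j; rewrite inE => /eqP ->.
  have [i1 i1s i1max] := IHs j; have [ii1|ii1] := leP (r i) (r i1).
    exists i1; first by rewrite inE i1s orbT.
    by move=> l; rewrite inE => /predU1P[->//|]; exact: i1max.
  exists i; first exact: mem_head.
  move=> l; rewrite inE => /predU1P[->//|/i1max/le_trans]; apply.
  exact: ltW.
set S := i :: s in sk r0 i0s i0max *.
pose S' := [seq j <- S | ~~ `[< B (c j) (r j) `&` B (c i0) (r i0) !=set0 >]].
have i00 := r0 _ i0s.
have S'k : (size S' < k)%N.
  rewrite -ltnS (leq_trans _ sk)// ltnS size_filter -(count_predC (fun j => ~~ `[< B (c j) (r j) `&` B (c i0) (r i0) !=set0 >]) S).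
  rewrite -addn1 leq_add2l -has_count; apply/hasP; exists i0 => //=.
  by rewrite negbK; apply/asboolP; exists (c i0); split; exact: body_ball_center.
have [|d [ud dS' td dcov]] := IH S' S'k.
  by move=> j; rewrite mem_filter => /andP[_]; exact: r0.
have disj j : j \in d -> B (c j) (r j) `&` B (c i0) (r i0) = set0.
  move=> /dS'; rewrite mem_filter => /andP[/asboolPn + _].
  by move=> /set0P/negP; rewrite negbK => /eqP.
have i0d : i0 \notin d.
  apply/negP => /disj; rewrite setIid => /seteqP[+ _] => /(_ (c i0)); apply.
  exact: body_ball_center.
exists (i0 :: d); split.
- by rewrite /= i0d.
- by move=> j; rewrite inE => /predU1P[->//|/dS']; rewrite mem_filter => /andP[].
- apply/trivIsetP => a b /=; rewrite !inE => /predU1P[->|ad] /predU1P[->|bd].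
  + by rewrite eqxx.
  + by move=> _; rewrite setIC disj.
  + by move=> _; rewrite disj.
  + by move/trivIsetP: td; exact.
- move=> j jS; have [jS'|] := boolP (j \in S').
    by have [l ld lj] := dcov _ jS'; exists l => //; rewrite inE ld orbT.
  rewrite mem_filter jS andbT negbK => /asboolP jm.
  exists i0; first exact: mem_head.
  by apply: body_ball_meet => //; [exact: r0|exact: i0max].
Qed.

Let mB x r := measurable_body_ball bK x r.

Local Open Scope ereal_scope.

(** The countable family is exhausted by finite ones, in which a largest radius exists, and
    continuity from below passes the bound to the union. Thus the factor is exactly 3, without a
    bound on the radii. [E] is kept in the sums so that the estimate of a tripled ball may depend on
    it. *)
Lemma vitali_measure_le (I : countType) (P : set I) (c : I -> V) (r : I -> R) (E : set V) b :
  measurable E -> (forall i, P i -> (0 < r i)%R) ->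
  (forall d : seq I, uniq d -> (forall i, i \in d -> P i) ->
     trivIset [set` d] (fun i => B (c i) (r i)) ->
     \sum_(i <- d) mu (E `&` B (c i) (3 * r i)%R) <= b) ->
  mu (E `&` \bigcup_(i in P) B (c i) (r i)) <= b.
Proof.
move=> mE r0 db.
pose s N := [seq i <- pmap unpickle (iota 0 N) | `[< P i >]] : seq I.
pose F N := E `&` \big[setU/set0]_(i <- s N) B (c i) (r i).
have sP N i : i \in s N -> P i by rewrite mem_filter => /andP[/asboolP].
have mF N : measurable (F N).
  by apply: measurableI => //; apply: bigsetU_measurable => i _; exact: mB.
have FE : E `&` \bigcup_(i in P) B (c i) (r i) = \bigcup_N F N.
  rewrite -setI_bigcupr; congr (_ `&` _); apply/seteqP; split => x.
    move=> [i Pi Bx]; exists (pickle i).+1 => //.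
    rewrite -bigcup_seq; exists i => //; rewrite [_ i]/(is_true (i \in s _)) mem_filter asboolT//.
    by rewrite andTb mem_pmap; apply/mapP; exists (pickle i); [rewrite mem_iota add0n ltnSn|rewrite pickleK].
  by move=> [N _]; rewrite -bigcup_seq => -[i /sP Pi Bx]; exists i.
have ndF : nondecreasing_seq F.
  move=> N M NM; apply/subsetPset => x [Ex]; rewrite -!bigcup_seq => -[i iN Bx].
  split => //; rewrite -bigcup_seq; exists i => //=.
  move: iN; rewrite /= !mem_filter => /andP[-> /=]; rewrite !mem_pmap => /mapP[j + ->].
  by rewrite !mem_iota/= add0n => jN; apply: map_f; rewrite mem_iota/= add0n (leq_trans jN).
have mUF : measurable (\bigcup_N F N) by exact: bigcupT_measurable.
have cvgF := nondecreasing_cvg_mu (mu := mu) mF mUF ndF.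
rewrite FE -(cvg_lim _ cvgF)//; apply: lime_le.
  apply: ereal_nondecreasing_is_cvgn => N M NM; apply: le_measure; rewrite ?inE//.
  by apply/subsetPset; exact: ndF.
apply: nearW => N /=.
have [d [ud ds td dcov]] := @finite_vitali I c r (s N) (fun i h => r0 i (sP N i h)).
apply: le_trans (db d ud (fun i h => sP N i (ds i h)) td).
have mG (i : I) : measurable (E `&` B (c i) (3 * r i)%R) by exact: measurableI.
apply: (@le_trans _ _ (mu (\big[setU/set0]_(i <- d) (E `&` B (c i) (3 * r i)%R)))).
  apply: le_measure; rewrite ?inE//; first exact: bigsetU_measurable.
  move=> x [Ex]; rewrite -!bigcup_seq => -[i /dcov[j jd] sub /sub Bx].
  by exists j.
elim: d {ud ds td dcov} => [|i d IH]; first by rewrite !big_nil measure0.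
rewrite !big_cons; apply: le_trans (leeD (lexx _) IH).
by apply: measureU2 => //; exact: bigsetU_measurable.
Qed.

(** In each ball the values of [g] up to b/2 account for at most half of the mass assumed. Having
    only the part g > b/2 on the right is what makes the later summation over levels converge. *)
Lemma disjoint_balls_weak_type (I : choiceType) (c : I -> V) (r : I -> R) (d : seq I)
    (g : V -> \bar R) (b : R) :
  (0 < b)%R -> uniq d -> trivIset [set` d] (fun i => B (c i) (r i)) ->
  {in d, forall i, (0 < r i)%R} ->
  measurable_fun setT g -> (forall x, 0 <= g x) ->
  {in d, forall i, b%:E * mu (B (c i) (r i)) <= \int[mu]_(x in B (c i) (r i)) g x} ->
  \sum_(i <- d) mu (B (c i) (r i)) <=
  (2 / b)%:E * \int[mu]_(x in [set x | (b / 2)%:E < g x]) g x.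
Proof.
move=> b0 ud td r0 mg g0 bg; set G := [set x | _].
have mG : measurable G.
  by rewrite -[G]setTI; exact: emeasurable_fun_o_infty.
have mnG : measurable (~` G) by exact: measurableC.
have Bi i : i \in d -> mu (B (c i) (r i)) <= (2 / b)%:E * \int[mu]_(x in B (c i) (r i) `&` G) g x.
  move=> id; have := bg _ id; rewrite mu_ballE//; last exact: r0.
  set v := (_ * _)%R => bv.
  have v0 : (0 <= v)%R by rewrite mulr_ge0 ?exprn_ge0 ?(ltW (vol_gt0 bK))// ltW// r0.
  have : b%:E * v%:E <= \int[mu]_(x in B (c i) (r i) `&` G) g x + (b / 2 * v)%:E.
    apply: (le_trans bv).
    apply: (@le_trans _ _ (\int[mu]_(x in B (c i) (r i) `&` G) g x + \int[mu]_(x in B (c i) (r i) `&` ~` G) g x)).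
      apply: ge0_le_integral_setU => //; [exact: measurableI|exact: measurableI|].
      by rewrite -setIUr setUv setIT.
    rewrite leeD2l//.
    apply: (@le_trans _ _ (\int[mu]_(x in B (c i) (r i) `&` ~` G) (b / 2)%:E)).
      apply: ge0_le_integral => //; first exact: measurableI.
      - exact: measurable_funTS.
      - by move=> x [_ /= /negP]; rewrite -leNgt.
    rewrite integral_cst; last exact: measurableI.
    rewrite [leRHS]EFinM; apply: lee_wpmul2l; first by rewrite lee_fin divr_ge0// ltW.
    rewrite -(mu_ballE bK (c i)); last exact: r0.
    by apply: le_measure; rewrite ?inE//; exact: measurableI.
  have := @integral_ge0 _ _ _ mu (B (c i) (r i) `&` G) g (fun x _ => g0 x).
  case: (\int[mu]_(x in B (c i) (r i) `&` G) g x) => [J||]//; last first.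
    by move=> _ _; rewrite gt0_muley ?leey// lte_fin divr_gt0.
  rewrite -EFinM -EFinD -EFinM !lee_fin => J0 H.
  rewrite mulrAC ler_pdivlMr//; lra.
apply: (@le_trans _ _ (\sum_(i <- d) (2 / b)%:E * \int[mu]_(x in B (c i) (r i) `&` G) g x)).
  by rewrite big_seq [leRHS]big_seq; apply: lee_sum => i; exact: Bi.
rewrite -ge0_sume_distrr; last by move=> i _; exact: integral_ge0.
apply: lee_wpmul2l; first by rewrite lee_fin divr_ge0// ltW.
rewrite -(@ge0_integral_bigsetU _ _ _ _ _ (fun i => B (c i) (r i) `&` G))//.
- apply: ge0_subset_integral => //.
  + by apply: bigsetU_measurable => i _; exact: measurableI.
  + exact: measurable_funTS.
  + by move=> x; rewrite -bigcup_seq => -[i _ []].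
- by move=> i; exact: measurableI.
- by apply: (trivIset_setIr td).
- exact: measurable_funTS.
Qed.

End vitali.

(** * Regularity of finite Borel measures *)

Section regularity.
Context {R : realType} {n : nat}.
Local Notation V := 'rV[R]_n.
Variable m : {measure set V -> \bar R}.
Hypothesis mfin : (m setT < +oo)%E.
Local Open Scope ereal_scope.

Let mlt (A : set V) : measurable A -> m A < +oo.
Proof.
by move=> mA; apply: le_lt_trans mfin; apply: le_measure; rewrite ?inE.
Qed.

(** Sandwiching between a closed and an open set makes the property stable under complement, so that
    the sets having it form a sigma-algebra. *)
Definition approximable (A : set V) := forall eps : R, (0 < eps)%R ->
  exists U C, [/\ open U, closed C, C `<=` A, A `<=` U & m (U `\` C) < eps%:E].

Let limit_lt (F : (set V)^nat) (e : R) : (forall k, measurable (F k)) ->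
  nonincreasing_seq F -> m (\bigcap_k F k) < e%:E -> exists k, m (F k) < e%:E.
Proof.
move=> mF nF lte.
have cv := nonincreasing_cvg_mu (mlt (mF 0%N)) mF (bigcapT_measurable mF) nF.
apply: contrapT => Fe; have : e%:E <= lim (m (F k) @[k --> \oo]).
  apply: lime_ge; first exact: cvgP cv.
  by apply: nearW => k; rewrite leNgt; apply/negP => Fk; apply: Fe; exists k.
by rewrite (cvg_lim _ cv)// leNgt lte.
Qed.

Lemma approximable_setC A : approximable A -> approximable (~` A).
Proof.
move=> aA eps /aA[U [C [oU cC CA AU UC]]].
exists (~` C), (~` U); split; [exact: closed_openC|exact: open_closedC|exact: subsetC|exact: subsetC|].
by rewrite setDE setCK setIC -setDE.
Qed.

Lemma approximable_bigcup (A : (set V)^nat) :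
  (forall k, approximable (A k)) -> approximable (\bigcup_k A k).
Proof.
move=> aA eps e0; have e20 : (0 < eps / 2)%R by rewrite divr_gt0.
have ek0 k : (0 < eps / 2 / (2 ^ k.+1)%:R)%R by rewrite divr_gt0// ltr0n expn_gt0.
have /choice[U /choice[C CP]] k : exists U C, [/\ open U, closed C, C `<=` A k, A k `<=` U
    & m (U `\` C) < (eps / 2 / (2 ^ k.+1)%:R)%:E] by exact: aA.
have oU k : open (U k) by have [] := CP k.
have cC k : closed (C k) by have [] := CP k.
have mU k : measurable (U k) by exact: open_measurable_rV.
have mC k : measurable (C k) by exact: closed_measurable_rV.
(* Only finite unions of the closed sets are sure to be closed. The sets [F k] decrease to a set of
   measure at most eps/2, and finiteness of [m] allows stopping at a finite [k]. *)
pose UU := \bigcup_k U k; pose F k := UU `\` \big[setU/set0]_(i < k) C i.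
have mUU : measurable UU by exact: bigcupT_measurable.
have mCk k : measurable (\big[setU/set0]_(i < k) C i).
  by apply: bigsetU_measurable => i _.
have mF k : measurable (F k) by exact: measurableD.
have nF : nonincreasing_seq F.
  apply/nonincreasing_seqP => k; apply/subsetPset => x [Ux nC]; split => //.
  by move=> Cx; apply: nC; rewrite big_ord_recr/=; left.
have [|k Fk] := limit_lt (e := eps) mF nF.
  apply: (@le_lt_trans _ _ (m (\bigcup_k (U k `\` C k)))).
    apply: le_measure; rewrite ?inE.
    - exact: bigcapT_measurable.
    - by apply: bigcupT_measurable => k; exact: measurableD.
    move=> x Fx; have [[k _ Ux] _] := Fx 0%N I.
    exists k => //; split => // Cx; have [_] := Fx k.+1 I; apply.
    by rewrite big_ord_recr/=; right.
  apply: (@le_lt_trans _ _ (eps / 2)%:E); last by rewrite lte_fin ltr_pdivrMr//; lra.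
  apply: le_trans (epsilon_trick0 xpredT (ltW e20)).
  apply: (@le_trans _ _ (\sum_(k <oo) m (U k `\` C k))).
    apply: measure_sigma_subadditive => //.
    - by move=> k; exact: measurableD.
    - by apply: bigcupT_measurable => k; exact: measurableD.
  by apply: lee_nneseries => // k _; have [_ _ _ _ /ltW] := CP k.
exists UU, (\big[setU/set0]_(i < k) C i); split => //.
- exact: bigcup_open.
- exact: closed_bigsetU.
- move=> x; rewrite -bigcup_mkord => -[i _ Cx]; exists i => //.
  by have [_ _ + _ _] := CP i; exact.
- by move=> x [i _ Ax]; exists i => //; have [_ _ _ + _] := CP i; exact.
Qed.

Let approximable_ray (i : 'I_n) (b : R) : approximable [set x : V | (x ord0 i <= b)%R].
Proof.
move=> eps e0; pose U k := [set x : V | (x ord0 i < b + k.+1%:R^-1)%R].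
set C := [set x | _].
have cC : closed C.
  apply: (@closed_comp _ _ (fun x : V => x ord0 i) [set y | (y <= b)%R]).
    by move=> x _; exact: coord_continuous.
  exact: closed_le.
have oU k : open (U k).
  apply: (@open_comp _ _ (fun x : V => x ord0 i) [set y | (y < b + k.+1%:R^-1)%R]).
    by move=> x _; exact: coord_continuous.
  exact: open_lt.
have mC : measurable C by exact: closed_measurable_rV.
have mU k : measurable (U k) by exact: open_measurable_rV.
have [|||k Fk] := limit_lt (F := fun k => U k `\` C) (e := eps).
- by move=> k; exact: measurableD.
- move=> k l kl; apply/subsetPset => x [Ux nC]; split => //.
  by apply: lt_le_trans Ux _; rewrite lerD2l lef_pV2 ?posrE// ler_nat.
- rewrite (_ : \bigcap_k _ = set0) ?measure0 ?lte_fin//; apply/seteqP; split => // x Fx.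
  have [_ /negP] := Fx 0%N I; rewrite -ltNge => xb.
  have [Ux _] := Fx (Num.truncn (x ord0 i - b)^-1) I.
  move: Ux; rewrite /U/= -ltrBlDl; apply/negP; rewrite -leNgt.
  rewrite -[leRHS]invrK lef_pV2 ?posrE ?invr_gt0 ?subr_gt0//.
  exact/ltW/truncnS_gt.
exists (U k), C; split => // x Cx; apply: le_lt_trans Cx _.
by rewrite ltrDl invr_gt0.
Qed.

Lemma measurable_approximable (A : set V) : measurable A -> approximable A.
Proof.
have approx0 : approximable set0.
  by move=> eps e0; exists set0, set0; split; [exact: open0|exact: closed0|by []|by []|by rewrite setD0 measure0 lte_fin].
have sigma_approx : sigma_algebra setT approximable.
  split => //; last exact: approximable_bigcup.
  by move=> B; rewrite setTD; exact: approximable_setC.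
apply: smallest_sub => // B; rewrite -bigcup_seq => -[i _ [C mC <-]]; rewrite setTI.
(* For a fixed coordinate, the sets of reals with approximable preimage form a sigma-algebra, so
   half-open intervals suffice, and these come from rays. *)
pose G := [set C : set (measurableTypeR R) | approximable ((fun v : V => v ord0 i) @^-1` C)].
suff : G C by [].
move: C mC; apply: smallest_sub.
  split.
  - by rewrite /G/= preimage_set0.
  - by move=> C; rewrite /G/= setTD preimage_setC; exact: approximable_setC.
  - by move=> F GF; rewrite /G/= preimage_bigcup; exact: approximable_bigcup.
move=> _ [[a b] _ <-]; rewrite /G/=.
rewrite (_ : _ @^-1` _ = ~` (~` [set x : V | (x ord0 i <= b)%R] `|` [set x : V | (x ord0 i <= a)%R])).
  apply: approximable_setC; rewrite -bigcup2E; apply: approximable_bigcup.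
  case=> [|[|k]] /=; [apply: approximable_setC| |]; [exact: approximable_ray|exact: approximable_ray|exact: approx0].
rewrite setCU setCK; apply/seteqP; split => x /=; rewrite in_itv/=.
  by move=> /andP[ax xb]; split => //; apply/negP; rewrite -ltNge.
by move=> [xb /negP]; rewrite -ltNge => ->.
Qed.

End regularity.

(** * The lower semicontinuous maximal function *)

Section max_fun.
Context {R : realType} {n : nat}.
Local Notation V := 'rV[R]_n.
Local Notation mu := (borel_lebesgue R n).
Variable K : set V.
Hypothesis bK : sym_body K.
Local Notation B := (body_ball K).
Local Notation A := (avg K).
Local Open Scope ereal_scope.

Variables (lambda : R) (f : V -> \bar R).
Hypotheses (lambda01 : (0 < lambda <= 1)%R)
  (mf : measurable_fun setT f) (f0 : forall x, 0 <= f x).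

Let lambda0 : (0 < lambda)%R. Proof. by case/andP: lambda01. Qed.

(* Interior points of [lambda S] only, which makes the maximal function lower semicontinuous. *)
Definition max_fun (x : V) : \bar R :=
  ereal_sup [set A cr.2 f cr.1 | cr in
    [set cr : V * R | (0 < cr.2)%R /\ K° ((lambda * cr.2)^-1 *: (x - cr.1))%R]].

(** The ball of radius e/2 about v/2 consists of midpoints of [v] and points of the ball of radius e
    about 0, which lies in [K]. *)
Lemma interior_half v : K v -> K° (2^-1 *: v)%R.
Proof.
move=> Kv; have /nbhs_ballP[e /= e0 eK] := body_nbhs bK.
apply/nbhs_ballP; exists (e / 2)%R; first by rewrite /= divr_gt0.
move=> w vw; have half : (0 <= 2^-1 :> R)%R && (2^-1 <= 1 :> R)%R.
  by rewrite invr_ge0 ler0n/= invf_le1// ler1n.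
have Kw : K (2 *: (w - 2^-1 *: v))%R.
  apply: eK; have e20 : (0 < e / 2)%R by rewrite divr_gt0.
  apply/rV_ballP => // i; move/(rV_ballP _ _ e20) : vw => /(_ i).
  rewrite !mxE sub0r normrN normrM ger0_norm// distrC ltr_pdivlMr//.
  by rewrite mulrC.
have := body_convex bK half Kv Kw; congr K.
by apply/rowP => i; rewrite !mxE; field.
Qed.

Lemma le_max_fun c r x : (0 < r)%R -> K° ((lambda * r)^-1 *: (x - c))%R ->
  A r f c <= max_fun x.
Proof. by move=> r0 Kx; apply: ereal_sup_ubound; exists (c, r). Qed.

(** The source of the hypothesis [fe] of the iteration. The factor 1/2 in the allowed shift places y
    in the interior of lambda times the ball about y + h. *)
Lemma max_fun_translate s h y : (0 < s)%R -> K ((lambda * s / 2)^-1 *: h)%R ->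
  A s f (y + h)%R <= max_fun y.
Proof.
move=> s0 Kh; apply: le_max_fun => //; rewrite opprD addrA subrr add0r.
have -> : ((lambda * s)^-1 *: - h = 2^-1 *: ((lambda * s / 2)^-1 *: - h))%R.
  rewrite scalerA; congr (_ *: _); field; by rewrite !gt_eqF.
by apply: interior_half; exact: (dilN bK).
Qed.

Lemma max_fun_ge0 x : 0 <= max_fun x.
Proof.
apply: (@le_trans _ _ (A 1 f (x + 0)%R)); first exact: (avg_ge0 bK).
by apply: max_fun_translate => //; rewrite scaler0; exact: body0.
Qed.

Lemma max_fun_open t : open [set x | t < max_fun x].
Proof.
rewrite (_ : [set x | _] = \bigcup_(cr in [set cr : V * R | (0 < cr.2)%R /\ t < A cr.2 f cr.1])
    [set x | K° ((lambda * cr.2)^-1 *: (x - cr.1))%R]); last first.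
  apply/seteqP; split => x /=.
    by move=> /ereal_sup_gt[_ [cr [cr0 Kx] <-]] tA; exists cr.
  move=> [cr [cr0 tA] Kx]; apply: (lt_le_trans tA).
  exact: le_max_fun.
apply: bigcup_open => -[c r] _; rewrite (_ : [set x | _] =
    [set x | K° (- ((lambda * r)^-1 *: c) + (lambda * r)^-1 *: x)%R]).
  exact/open_preimage_affine/open_interior.
by apply/seteqP; split => x /=; rewrite scalerBr addrC.
Qed.

Lemma measurable_max_fun : measurable_fun setT max_fun.
Proof.
apply: (measurability _ (ErealGenOInfty.measurableE R)) => //.
move=> _ [_ [t ->] <-]; rewrite setTI.
apply: open_measurable_rV.
rewrite (_ : _ @^-1` _ = [set x | t%:E < max_fun x]); first exact: max_fun_open.
by apply/seteqP; split => x /=; rewrite in_itv/= andbT.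
Qed.

End max_fun.

(** * Almost everywhere domination of [f] by its maximal function *)

Section differentiation.
Context {R : realType} {n : nat}.
Local Notation V := 'rV[R]_n.
Local Notation mu := (borel_lebesgue R n).
Variable K : set V.
Hypothesis bK : sym_body K.
Local Notation B := (body_ball K).
Local Notation A := (avg K).
Local Open Scope ereal_scope.

Variables (lambda : R) (f : V -> \bar R).
Hypotheses (lambda01 : (0 < lambda <= 1)%R)
  (mf : measurable_fun setT f) (f0 : forall x, 0 <= f x).
Local Notation N := (max_fun K lambda f).

Let lambda0 : (0 < lambda)%R. Proof. by case/andP: lambda01. Qed.
Let mB x r := measurable_body_ball bK x r.

Lemma open_body_ball (U : set V) x : open U -> U x ->
  exists2 r, (0 < r)%R & B x r `<=` U.
Proof.
move=> oU Ux; have /nbhs_ballP[e /= e0 eU] := open_nbhs_nbhs (conj oU Ux).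
have [M KM] := body_bounded bK.
have M0 : (0 <= M)%R by apply: le_trans (KM _ (body0 bK)).
have M1 : (0 < M + 1)%R by rewrite ltr_wpDl.
have r0 : (0 < e / (M + 1))%R by rewrite divr_gt0.
exists (e / (M + 1))%R => // y Ky; apply: eU; rewrite mx_norm_ball /ball_/= distrC.
have := KM _ Ky; rewrite normrZ gtr0_norm ?invr_gt0// ler_pdivrMl// => /le_lt_trans; apply.
rewrite mulrAC ltr_pdivrMr// ltr_pM2l// ltrDl//.
Qed.

(* Where [N <= a < b < f], balls meeting the set have density at most [a / b], which
   the Vitali covering lemma inside a tight open neighbourhood forbids. *)
Lemma level_gap_measure_le (a b eps : R) (E U : set V) : (0 <= a < b)%R ->
  measurable E -> open U -> E `<=` U -> E `<=` [set x | N x <= a%:E /\ b%:E < f x] ->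
  mu (U `\` E) < eps%:E -> mu E <= (3 ^+ n / (1 - a / b) * eps)%:E.
Proof.
move=> /andP[a0 ab] mE oU EU ENf UE; have b0 := le_lt_trans a0 ab.
pose c (qr : 'rV[rat]_n * rat) : V := rat_rV qr.1.
pose r (qr : 'rV[rat]_n * rat) : R := ratr qr.2.
pose P := [set qr | [/\ (0 < r qr)%R, B (c qr) (r qr) `<=` U & A (r qr) f (c qr) <= a%:E]].
have th1 : (0 < 1 - a / b)%R by rewrite subr_gt0 ltr_pdivrMr// mul1r.
rewrite -(setIidl (_ : E `<=` \bigcup_(i in P) B (c i) (r i))); last first.
  move=> x Ex; have [rho rho0 rhoU] := open_body_ball oU (EU _ Ex).
  have [|s] := @rat_in_itvoo R 0%R (rho / 2)%R; first by rewrite divr_gt0.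
  rewrite in_itv/= => /andP[s0 srho].
  have ls0 : (0 < lambda * ratr s)%R by exact: mulr_gt0.
  (* Rational centres keep the family countable. Near [x] they leave [x] interior to lambda times
     the ball, so the average about them is still at most N x. *)
  pose W := [set y : V | K° ((lambda * ratr s)^-1 *: (x - y))%R].
  have oW : open W.
    rewrite /W (_ : [set y | _] =
        [set y : V | K° ((lambda * ratr s)^-1 *: x + - (lambda * ratr s)^-1 *: y)%R]).
      exact/open_preimage_affine/open_interior.
    by apply/seteqP; split => y /=; rewrite scalerBr scaleNr.
  have [|q Wq] := open_rat_rV oW.
    exists x; rewrite /W/= subrr scaler0.
    by have := interior_half bK (body0 bK); rewrite scaler0.
  have Kxq : K ((ratr s)^-1 *: (x - rat_rV q))%R.
    apply: (dil_le bK ls0); last exact: interior_subset Wq.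
    by rewrite ger_pMl//; case/andP: lambda01.
  exists (q, s); last exact: Kxq.
  split => //=.
  - apply: subset_trans rhoU.
    apply: (subset_trans (body_ball_sub bK s0 s0 (_ : K ((ratr s)^-1 *: (rat_rV q - x))%R))).
      by rewrite -opprB; exact: (dilN bK).
    by apply: (body_ball_le bK); [rewrite addr_gt0|rewrite -mulr2n -mulr_natr -ler_pdivlMr// ltW].
  - by have [+ _] := ENf _ Ex; apply: le_trans; exact: le_max_fun.
apply: (vitali_measure_le bK) => //; first by move=> i [].
move=> d ud dP td.
have r0 i : i \in d -> (0 < r i)%R by move=> /dP[].
have vol0 := vol_gt0 bK.
(* f > b on [E] while the mean over the ball is at most a, so [E] fills at most the fraction a/b of
   the ball. The remainder lies in [U] minus [E] and controls the volume of the tripled ball. *)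
have dens i : i \in d -> mu (E `&` B (c i) (3 * r i)%R) <=
    (3 ^+ n / (1 - a / b))%:E * mu (B (c i) (r i) `\` E).
  move=> id; have [ri0 riU Aa] := dP _ id.
  have r30 : (0 < 3 * r i)%R by rewrite mulr_gt0.
  apply: (@le_trans _ _ (mu (B (c i) (3 * r i)%R))).
    by apply: le_measure; rewrite ?inE//; exact: measurableI.
  rewrite mu_ballE//; set v := (r i ^+ n * vol K)%R.
  have v0 : (0 < v)%R by rewrite mulr_gt0 ?exprn_gt0.
  have mBE : measurable (B (c i) (r i) `&` E) by exact: measurableI.
  have BEle : b%:E * mu (B (c i) (r i) `&` E) <= a%:E * v%:E.
    rewrite -integral_cst//; apply: (@le_trans _ _ (\int[mu]_(x in B (c i) (r i)) f x)).
      apply: (@le_trans _ _ (\int[mu]_(x in B (c i) (r i) `&` E) f x)).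
        apply: ge0_le_integral => //.
        - by move=> x _; rewrite lee_fin ltW.
        - exact: measurable_funTS.
        - by move=> x [_ /ENf[_ /ltW]].
      by apply: ge0_subset_integral => //; exact: measurable_funTS.
    by rewrite (avgE bK)// muleC lee_wpmul2r// lee_fin ltW.
  have BE : v%:E = mu (B (c i) (r i) `&` E) + mu (B (c i) (r i) `\` E).
    rewrite /v -(mu_ballE bK (c i) ri0).
    by rewrite addeC -measureDI.
  move: BEle BE (measure_ge0 mu (B (c i) (r i) `\` E)) (measure_ge0 mu (B (c i) (r i) `&` E)).
  case: (mu (B (c i) (r i) `\` E)) => [g||]//; case: (mu (B (c i) (r i) `&` E)) => [h||]//.
  rewrite -!EFinM -!EFinD !lee_fin => bh [vE] g0 h0.
  rewrite exprMn -mulrA -/v -mulrA; apply: ler_wpM2l; first by rewrite exprn_ge0.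
  rewrite mulrC ler_pdivlMr//.
  have hb : (h <= a / b * v)%R by rewrite mulrAC ler_pdivlMr// mulrC.
  have -> : (v * (1 - a / b) = v - a / b * v)%R by ring.
  by lra.
apply: (@le_trans _ _ (\sum_(i <- d) (3 ^+ n / (1 - a / b))%:E * mu (B (c i) (r i) `\` E))).
  by rewrite big_seq [leRHS]big_seq; apply: lee_sum => i; exact: dens.
rewrite -ge0_sume_distrr// [leRHS]EFinM; apply: lee_wpmul2l.
  by rewrite lee_fin divr_ge0 ?exprn_ge0// ltW.
apply: le_trans (ltW UE).
have mBE i : measurable (B (c i) (r i) `\` E) by exact: measurableD.
apply: (@le_trans _ _ (\sum_(i <- d) \int[mu]_(x in B (c i) (r i) `\` E) 1)).
  by apply: lee_sum => i _; rewrite integral_cst// mul1e.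
rewrite -(@ge0_integral_bigsetU _ _ _ _ _ (fun i => B (c i) (r i) `\` E))//; last first.
  by apply: (trivIset_setIr td).
rewrite integral_cst ?mul1e; last by apply: bigsetU_measurable => i _.
apply: le_measure; rewrite ?inE.
- by apply: bigsetU_measurable => i _.
- by apply: measurableD => //; exact: open_measurable_rV.
- by move=> x; rewrite -bigcup_seq => -[i /dP[_ iU _] [Bx nE]]; split => //; exact: iU.
Qed.

End differentiation.

Lemma ball_measure_lty {R : realType} {n : nat} (r : R) : 0 < r ->
  (borel_lebesgue R n (ball (0%R : 'rV[R]_n) r) < +oo)%E.
Proof.
move=> r0; have [|mb mbE] := @borel_lebesgue_box R n (const_mx (- r)) (const_mx r).
  by move=> i; rewrite !mxE; lra.
set box := mkset _ in mb mbE.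
apply: (@le_lt_trans _ _ (borel_lebesgue R n box)); last by rewrite mbE ltry.
apply: le_measure; rewrite ?inE//; first by apply: open_measurable_rV; exact: ball_open.
move=> x /(rV_ballP _ _ r0) xr i; rewrite !mxE.
by have := xr i; rewrite mxE sub0r normrN ltr_norml => /andP[/ltW -> /ltW].
Qed.

Section differentiation_ae.
Context {R : realType} {n : nat}.
Local Notation V := 'rV[R]_n.
Local Notation mu := (borel_lebesgue R n).
Variable K : set V.
Hypothesis bK : sym_body K.
Local Open Scope ereal_scope.

Variables (lambda : R) (f : V -> \bar R).
Hypotheses (lambda01 : (0 < lambda <= 1)%R)
  (mf : measurable_fun setT f) (f0 : forall x, 0 <= f x).
Local Notation N := (max_fun K lambda f).

Let mN : measurable_fun setT N := measurable_max_fun K lambda f.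

(** Rationals a < b between N x and f x and a ball of integer radius split the set into countably
    many pieces. The ball makes the measure finite, so regularity provides tight open
    neighbourhoods, and [level_gap_measure_le] bounds each piece by an arbitrary [e]. *)
Lemma max_fun_lt_negligible : mu [set x | N x < f x] = 0.
Proof.
pose W k : set V := ball (0%R : V) k.+1%:R.
pose E (i : nat * rat * rat) := if (0 <= (ratr i.1.2 : R) < ratr i.2)%R then
  W i.1.1 `&` ([set x | N x <= (ratr i.1.2)%:E] `&` [set x | (ratr i.2)%:E < f x]) else set0.
have oW k : open (W k) by exact: ball_open.
have mW k : measurable (W k) by exact: open_measurable_rV.
have mE i : measurable (E i).
  rewrite /E; case: ifPn => // _; apply: measurableI => //; apply: measurableI.
    by rewrite -[X in measurable X]setTI; exact: emeasurable_fun_infty_c.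
  by rewrite -[X in measurable X]setTI; exact: emeasurable_fun_o_infty.
have E0 i : mu (E i) = 0.
  apply/eqP; rewrite eq_le measure_ge0 andbT.
  have [ab|] := boolP (0 <= (ratr i.1.2 : R) < ratr i.2)%R; last first.
    by rewrite /E => /negPf ->; rewrite measure0.
  set a := ratr i.1.2 in ab; set b := ratr i.2 in ab.
  have b0 : (0 < b)%R by case/andP: ab => /le_lt_trans; apply.
  set C := (3 ^+ n / (1 - a / b))%R.
  have C0 : (0 < C)%R.
    rewrite divr_gt0 ?exprn_gt0// subr_gt0 ltr_pdivrMr// mul1r.
    by case/andP: ab.
  apply/lee_addgt0Pr => e e0; rewrite add0e.
  have eC0 : (0 < e / C)%R by rewrite divr_gt0.
  have mfin : mrestr mu (mW i.1.1) setT < +oo.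
    by rewrite /mrestr setTI ball_measure_lty.
  have [U [D [oU cD DE EU UD]]] := measurable_approximable mfin (mE i) eC0.
  have EW : E i `<=` W i.1.1 by rewrite /E ab => x [].
  rewrite (_ : e = C * (e / C))%R; last by rewrite mulrC divfK ?gt_eqF.
  apply: (level_gap_measure_le bK lambda01 mf f0 (a := a) (b := b) (U := U `&` W i.1.1)) => //.
  - exact: openI.
  - by move=> x Ex; split; [exact: EU|exact: EW].
  - by rewrite /E ab => x [_ []].
  - apply: le_lt_trans UD; apply: le_measure; rewrite ?inE.
    + by apply: measurableD => //; apply: measurableI => //; exact: open_measurable_rV.
    + apply: measurableI => //; apply: measurableD; first exact: open_measurable_rV.
      exact: closed_measurable_rV.
    + by move=> x [[Ux Wx] nE]; split => //; split => // /DE.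
pose F k := if unpickle k is Some i then E i else set0.
have F0 k : mu.-negligible (F k).
  rewrite /F; case: unpickle => [i|]; last exact: negligible_set0.
  by exists (E i); split => //; exact: E0.
apply: measure_negligible.
  by rewrite -[X in measurable X]setTI; exact: measurable_lte.
apply: negligibleS (negligible_bigcup F0) => x /= Nf.
have N0 := max_fun_ge0 bK lambda01 f0 x.
have [c [d [Nc cd df]]] : exists c d : R, [/\ N x = c%:E, (c < d)%R & d%:E <= f x].
  move: Nf N0; case: (N x) => [c||]//; case: (f x) => [d||]//.
    by move=> cd _; exists c, d.
  by move=> _ _; exists c, (c + 1)%R; split; rewrite ?leey// ltrDl.
rewrite Nc lee_fin in N0.
have [|a] := @rat_in_itvoo R c ((c + d) / 2)%R; first by rewrite ltr_pdivlMr//; lra.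
have [|b] := @rat_in_itvoo R ((c + d) / 2)%R d; first by rewrite ltr_pdivrMr//; lra.
rewrite !in_itv/= => /andP[cdb bd] /andP[ca acd].
pose i := (Num.truncn `|x|, a, b).
exists (pickle i) => //; rewrite /F pickleK /E/= ifT; last first.
  by rewrite (le_trans N0 (ltW ca)) (lt_trans acd cdb).
split; last split => /=.
- by rewrite /W mx_norm_ball /ball_/= sub0r normrN truncnS_gt.
- by rewrite Nc lee_fin ltW.
- by apply: lt_le_trans df; rewrite lte_fin.
Qed.

End differentiation_ae.

Lemma measure_disjoint_sum {d} {T : measurableType d} {R : realType}
    (m : {measure set T -> \bar R}) (I : choiceType) (s : seq I) (F : I -> set T) :
  (forall i, measurable (F i)) -> uniq s -> trivIset [set` s] F ->
  (\sum_(i <- s) m (F i) = m (\bigcup_(i in [set` s]) F i))%E.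
Proof.
move=> mF us tF.
transitivity (\sum_(i <- s) \int[m]_(x in F i) 1)%E.
  by apply: eq_bigr => i _; rewrite integral_cst// mul1e.
rewrite -(@ge0_integral_bigsetU _ _ _ _ _ F)//.
by rewrite integral_cst; [rewrite mul1e -bigcup_seq|exact: bigsetU_measurable].
Qed.

(** * The good-lambda inequality *)

Section covering.
Context {R : realType} {n : nat}.
Local Notation V := 'rV[R]_n.
Local Notation mu := (borel_lebesgue R n).
Variable K : set V.
Hypothesis bK : sym_body K.
Local Notation B := (body_ball K).
Local Notation A := (avg K).
Local Open Scope ereal_scope.

Variables (lambda : R) (f : V -> \bar R).
Hypotheses (n0 : (0 < n)%N) (lambda01 : (0 < lambda <= 1)%R)
  (mf : measurable_fun setT f) (f0 : forall x, 0 <= f x).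
Local Notation N := (max_fun K lambda f).
Hypothesis f_tail : forall t, (0 < t)%R -> \int[mu]_(x in [set x | t%:E < f x]) f x < +oo.

Let lambda0 : (0 < lambda)%R. Proof. by case/andP: lambda01. Qed.
Let mB x r := measurable_body_ball bK x r.
Let vol0 := vol_gt0 bK.
Let mlevel (g : V -> \bar R) t : measurable_fun setT g -> measurable [set x | t < g x].
Proof. by move=> mg; rewrite -[X in measurable X]setTI; exact: emeasurable_fun_o_infty. Qed.

(** The weak type estimate for a single ball bounds r^n, hence r: for r > 1, n > 0 gives r <=
    r^n. *)
Lemma avg_radius_bounded t : (0 < t)%R ->
  exists M : R, forall x r, (0 < r)%R -> t%:E < A r f x -> (r <= M)%R.
Proof.
move=> t0; have t20 : (0 < t / 2)%R by rewrite divr_gt0.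
pose F := fine (\int[mu]_(x in [set x | (t / 2)%:E < f x]) f x).
have FE : \int[mu]_(x in [set x | (t / 2)%:E < f x]) f x = F%:E.
  by rewrite fineK// ge0_fin_numE ?f_tail// integral_ge0.
exists (1 + (2 / t * F) / vol K)%R => x r r0 tA.
have tB : t%:E * mu (B x r) <= \int[mu]_(y in B x r) f y.
  rewrite (avgE bK)// muleC mu_ballE// lee_wpmul2l ?ltW// lte_fin.
  by rewrite mulr_gt0// exprn_gt0.
have := @disjoint_balls_weak_type _ _ _ bK bool (fun=> x) (fun=> r) [:: true] f t t0 isT.
rewrite big_seq1 FE mu_ballE// -EFinM lee_fin => H.
have {H} rF : (r ^+ n * vol K <= 2 / t * F)%R.
  apply: H => //.
  - by apply/trivIsetP => i j /=; rewrite !inE => /eqP -> /eqP ->.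
  - by move=> i _; rewrite EFinM -(mu_ballE bK x r0).
have [r1|r1] := leP r 1%R.
  apply: (le_trans r1); rewrite lerDl divr_ge0 ?(ltW vol0)//.
  by apply: le_trans rF; rewrite mulr_ge0 ?exprn_ge0// ltW.
apply: ler_wpDl => //; rewrite ler_pdivlMr//; apply: le_trans rF.
rewrite ler_wpM2r ?(ltW vol0)//.
by rewrite -[leLHS]expr1 ler_weXn2l// ltW.
Qed.


(** Stopping radii: [rad q] is at least half the supremum of the radii whose mean about q exceeds
    t/2^n, so beyond 2 rad q the means stay below that level. The factor 2^n pays for replacing a
    centre c by a rational q, since the ball of radius r about c lies in that of radius 2r about
    q. *)
Lemma rational_balls_cover t : (0 < t)%R -> exists (P : set 'rV[rat]_n) (rad : 'rV[rat]_n -> R),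
  [/\ forall q, P q -> (0 < rad q)%R,
      forall q, P q -> (t / 2 ^+ n)%:E * mu (B (rat_rV q) (rad q)) <=
        \int[mu]_(x in B (rat_rV q) (rad q)) f x,
      forall q r, P q -> (2 * rad q < r)%R ->
        \int[mu]_(x in B (rat_rV q) r) f x <= (t / 2 ^+ n)%:E * mu (B (rat_rV q) r) &
      [set x | t%:E < N x] `<=` \bigcup_(q in P) B (rat_rV q) (2 * rad q)%R].
Proof.
move=> t0; have p0 : (0 < 2 ^+ n :> R)%R by rewrite exprn_gt0.
have tau0 : (0 < t / 2 ^+ n)%R by rewrite divr_gt0.
have [M MP] := avg_radius_bounded tau0.
pose Rad q := [set r | (0 < r)%R /\ (t / 2 ^+ n)%:E < A r f (rat_rV q)].
pose P := [set q | Rad q !=set0].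
have radP q : exists r, P q -> Rad q r /\ forall r', Rad q r' -> (r' <= 2 * r)%R.
  have [Pq|Pq] := pselect (P q); last by exists 0%R.
  have hs : has_sup (Rad q).
    by split => //; exists M => r [r0 rA]; exact: MP rA.
  have s0 : (0 < sup (Rad q))%R.
    by have [r [r0 rA]] := Pq; apply: (lt_le_trans r0); apply: sup_ubound => //; case: hs.
  have s2 : (0 < sup (Rad q) / 2)%R by rewrite divr_gt0.
  have [r Rr sr] := sup_adherent s2 hs.
  exists r => _; split => // r' Rr'.
  apply: (@le_trans _ _ (sup (Rad q))); first by apply: sup_ubound => //; case: hs.
  by move: sr; lra.
have /choice[rad {}radP] := radP.
have ballE q r : (0 < r)%R -> mu (B (rat_rV q) r) = (r ^+ n * vol K)%:E by move=> r0; exact: mu_ballE.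
exists P, rad; split.
- by move=> q /radP[[]].
- move=> q /radP[[r0 /ltW tA] _]; rewrite (avgE bK)// ballE// muleC.
  by rewrite lee_wpmul2l// lee_fin mulr_ge0 ?exprn_ge0// ltW.
- move=> q r Pq rr; have [[r0 _] rmax] := radP _ Pq.
  have r0' : (0 < r)%R by apply: lt_trans rr; rewrite mulr_gt0.
  rewrite (avgE bK)// ballE// muleC; apply: lee_wpmul2r.
    by rewrite lee_fin mulr_ge0 ?exprn_ge0// ltW.
  by rewrite leNgt; apply/negP => tA; have := rmax _ (conj r0' tA); rewrite leNgt rr.
- move=> x /= /ereal_sup_gt[_ [[c r] [/= r0 Kx] <-] tA].
  have [||q Wq] := @open_rat_rV R n [set y : V | K° (r^-1 *: (c - y))%R].
  - rewrite (_ : [set y | _] = [set y : V | K° (r^-1 *: c + - r^-1 *: y)%R]).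
      exact/open_preimage_affine/open_interior.
    by apply/seteqP; split => y /=; rewrite scalerBr scaleNr.
  - exists c; rewrite /= subrr scaler0.
    by have := interior_half bK (body0 bK); rewrite scaler0.
  have Kcq : K (r^-1 *: (c - rat_rV q))%R by exact: interior_subset.
  have sub : B c r `<=` B (rat_rV q) (2 * r)%R.
    by have := body_ball_sub bK r0 r0 Kcq; rewrite mulrDl mul1r.
  have r20 : (0 < 2 * r)%R by rewrite mulr_gt0.
  have Rr : Rad q (2 * r)%R.
    split => //; have : (t * (r ^+ n * vol K))%:E < \int[mu]_(x in B (rat_rV q) (2 * r)%R) f x.
      apply: (@lt_le_trans _ _ (\int[mu]_(x in B c r) f x)).
        rewrite (avgE bK)// EFinM muleC lte_pmul2l ?fin_num//.
        by rewrite lte_fin mulr_gt0 ?exprn_gt0.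
      by apply: ge0_subset_integral => //; exact: measurable_funTS.
    rewrite (avgE bK)//.
    have -> : (t * (r ^+ n * vol K) = ((2 * r) ^+ n * vol K) * (t / 2 ^+ n))%R.
      by rewrite exprMn; field; rewrite gt_eqF.
    by rewrite EFinM lte_pmul2l ?fin_num// lte_fin mulr_gt0 ?exprn_gt0.
  have Pq : P q by exists (2 * r)%R.
  exists q => //; have [_ rmax] := radP _ Pq.
  apply: (body_ball_le bK r20); first exact: rmax.
  apply: sub; apply: (dil_le bK _ _ (interior_subset Kx)); first exact: mulr_gt0.
  by rewrite ger_pMl//; case/andP: lambda01.
Qed.

End covering.

Section good_lambda.
Context {R : realType} {n : nat}.
Local Notation V := 'rV[R]_n.
Local Notation mu := (borel_lebesgue R n).
Variable K : set V.
Hypothesis bK : sym_body K.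
Local Notation B := (body_ball K).
Local Notation A := (avg K).
Local Open Scope ereal_scope.

Variables (lambda : R) (f e : V -> \bar R).
Hypotheses (n0 : (0 < n)%N) (lambda01 : (0 < lambda <= 1)%R)
  (mf : measurable_fun setT f) (f0 : forall x, 0 <= f x)
  (me : measurable_fun setT e) (e0 : forall x, 0 <= e x).
Local Notation N := (max_fun K lambda f).
Hypothesis Nfe : forall x, N x <= f x + e x.
Hypothesis f_tail : forall t, (0 < t)%R -> \int[mu]_(x in [set x | t%:E < f x]) f x < +oo.
Variables (m : nat).
Hypothesis lm : (32 < lambda * m.+1%:R)%R.
(* [local_level_set] is applied to balls of radius [a = 12 r]; then
   [a + 4 a / lambda = Lam r] and [kappa] is the coefficient of [f].  On balls where the
   mean of [e] is at most [delta t], the [e] term contributes no more than [kappa]. *)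
Local Notation kappa := ((n%:R * 32 / lambda) ^+ 2 / m.+1%:R)%R.
Local Notation Lam := (12 * (1 + 4 / lambda))%R.
Local Notation delta := (kappa / (m.+1%:R ^+ n.+1 *+ 2))%R.

Let lambda0 : (0 < lambda)%R. Proof. by case/andP: lambda01. Qed.
Let mB x r := measurable_body_ball bK x r.
Let mlevel (g : V -> \bar R) t : measurable_fun setT g -> measurable [set x | t < g x].
Proof. by move=> mg; rewrite -[X in measurable X]setTI; exact: emeasurable_fun_o_infty. Qed.

Let fe s h y : (0 < s)%R -> K ((lambda * s / 2)^-1 *: h) -> A s f (y + h)%R <= f y + e y.
Proof. by move=> s0 Kh; apply: le_trans (Nfe y); exact: max_fun_translate. Qed.

Let kappa0 : (0 < kappa)%R.
Proof. by rewrite divr_gt0// exprn_gt0// divr_gt0// mulr_gt0// ltr0n. Qed.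

Let Lam12 : (12 <= Lam)%R.
Proof. by rewrite ler_peMr// lerDl ltW// divr_gt0. Qed.

Let Lam0 : (0 < Lam)%R. Proof. by apply: lt_le_trans Lam12. Qed.

Let delta0 : (0 < delta)%R. Proof. by rewrite divr_gt0. Qed.

(** Why a = 12 r: the half ball, of radius 6r, is then the triple of a covering ball of radius 2r.
    Means at most t/2^n are what bounds the integral over radius 12r by t times the volume of radius
    6r. By the choice of [delta], each of the two error terms is at most kappa t times the volume of
    the ball of radius [Lam] r. *)
Lemma level_ball_le t x r : (0 < t)%R -> (0 < r)%R ->
  (forall s, (2 * r < s)%R -> \int[mu]_(y in B x s) f y <= (t / 2 ^+ n)%:E * mu (B x s)) ->
  \int[mu]_(y in B x (Lam * r)%R) e y <= (delta * t)%:E * mu (B x (Lam * r)%R) ->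
  mu ([set y | (t *+ 2)%:E < f y] `&` B x (6 * r)%R) <= (2 * kappa * Lam ^+ n)%:E * mu (B x r).
Proof.
move=> t0 r0 fr er; have r12 : (0 < 12 * r)%R by rewrite mulr_gt0.
have p0 : (0 < 2 ^+ n :> R)%R by rewrite exprn_gt0.
have Lr : (12 * r + 4 * (12 * r) / lambda = Lam * r)%R by field; rewrite gt_eqF.
have Lr0 : (0 < Lam * r)%R by rewrite mulr_gt0.
have r6 : (0 < 6 * r)%R by rewrite mulr_gt0.
have f12 : \int[mu]_(y in B x (12 * r)%R) f y <= t%:E * mu (B x (12 * r / 2)%R).
  have r12' : (0 < 12 * r / 2)%R by rewrite divr_gt0.
  apply: (le_trans (fr _ _)); first by rewrite ltr_pM2r// ltr_nat.
  rewrite !mu_ballE// -!EFinM lee_fin.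
  rewrite [((12 * r) ^+ n)%R](_ : _ = 2 ^+ n * (12 * r / 2) ^+ n)%R; last first.
    by rewrite -exprMn; congr (_ ^+ _)%R; field.
  set q := ((12 * r / 2) ^+ n)%R.
  by rewrite !mulrA divfK ?gt_eqF.
have fL : \int[mu]_(y in B x (Lam * r)%R) f y <= t%:E * mu (B x (Lam * r)%R).
  apply: (le_trans (fr _ _)).
    by rewrite ltr_pM2r// (lt_le_trans _ Lam12)// ltr_nat.
  apply: lee_wpmul2r => //; rewrite lee_fin ler_pdivrMr// ler_peMr ?(ltW t0)//.
  by rewrite exprn_ege1// ler1n.
have fLoo : \int[mu]_(y in B x (12 * r + 4 * (12 * r) / lambda)%R) f y < +oo.
  by rewrite Lr; apply: le_lt_trans fL _; rewrite mu_ballE// ltry.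
have := local_level_set bK lambda0 mf f0 me e0 fe r12 t0 lm f12 fLoo.
rewrite Lr (_ : 12 * r / 2 = 6 * r)%R; last by field.
set E := [set y | _] `&` _ => H.
have : t%:E * mu E <= t%:E * ((2 * kappa * Lam ^+ n)%:E * mu (B x r)).
  apply: (le_trans H).
  apply: (@le_trans _ _ ((kappa * t)%:E * mu (B x (Lam * r)%R) + (kappa * t)%:E * mu (B x (Lam * r)%R))).
    apply: leeD.
      apply: (@le_trans _ _ ((m.+1%:R ^+ n.+1 *+ 2)%:E * ((delta * t)%:E * mu (B x (Lam * r)%R)))).
        by apply: lee_wpmul2l => //; rewrite lee_fin ltW.
      rewrite muleA -EFinM (_ : (_ * (delta * t) = kappa * t)%R)//.
      by rewrite mulrA [X in (X * t)%R]mulrC divfK// gt_eqF.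
    rewrite [(kappa * t)%:E]EFinM -muleA; apply: lee_wpmul2l => //; rewrite lee_fin; exact: ltW.
  rewrite !mu_ballE// -!EFinM -EFinD lee_fin.
  set l := Lam; set k := kappa; rewrite exprMn le_eqVlt; apply/orP; left.
  by apply/eqP; ring.
by rewrite lee_pmul2l ?lte_fin.
Qed.

Lemma mu_ball_scale x r c : (0 < c)%R -> (0 < r)%R ->
  mu (B x (c * r)%R) = (c ^+ n)%:E * mu (B x r).
Proof. by move=> c0 r0; rewrite !mu_ballE ?mulr_gt0// -EFinM exprMn mulrA. Qed.

(** The Vitali lemma is applied to the balls of radius 2 rad covering N > t, a set containing f > 2t
    up to measure zero. Balls with a small mean of [e] obey [level_ball_le], and the weak type
    estimate for [f] sums their volumes. The others go through a second covering, by balls on which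
    the mean of [e] exceeds delta t. Each covering contributes 3^n, whence 9^n. *)
Lemma good_lambda t : (0 < t)%R ->
  mu [set x | (t *+ 2)%:E < f x] <=
  (4 * kappa * Lam ^+ n * 2 ^+ n / t)%:E *
    \int[mu]_(x in [set x | (t / 2 ^+ n / 2)%:E < f x]) f x +
  (9 ^+ n * 2 / (delta * t))%:E * \int[mu]_(x in [set x | (delta * t / 2)%:E < e x]) e x.
Proof.
move=> t0; have p0 : (0 < 2 ^+ n :> R)%R by rewrite exprn_gt0.
have tau0 : (0 < t / 2 ^+ n)%R by rewrite divr_gt0.
have dt0 : (0 < delta * t)%R by exact: mulr_gt0.
have [P [rad [rad0 fP Pf cov]]] := rational_balls_cover bK n0 lambda01 mf f0 f_tail t0.
set E := [set x | _].
have mE : measurable E by exact: mlevel.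
set UB := \bigcup_(q in P) B (rat_rV q) (2 * rad q)%R.
have mUB : measurable UB.
  rewrite /UB bigcup_mkcond; apply: countable_bigcupT_measurable; first exact: countableP.
  by move=> q; case: ifPn => _ //; exact: mB.
have mNf : measurable [set x | N x < f x].
  rewrite -[X in measurable X]setTI; apply: measurable_lte => //.
  exact: measurable_max_fun.
apply: (@le_trans _ _ (mu (E `&` UB))).
  apply: (@le_trans _ _ (mu ((E `&` UB) `|` [set x | N x < f x]))).
    apply: le_measure; rewrite ?inE//.
      by apply: measurableU => //; exact: measurableI.
    move=> x Ex.
    have [Nf|/negP] := pselect (N x < f x); first by right.
    rewrite -leNgt => fN.
    left; split; first exact: Ex.
    apply: cov; apply: lt_le_trans fN; apply: le_lt_trans Ex.
    by rewrite lee_fin mulr2n lerDl ltW.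
  apply: (le_trans (measureU2 _ (measurableI _ _ mE mUB) mNf)).
  by rewrite [X in _ + X](max_fun_lt_negligible bK lambda01 mf f0) adde0.
apply: (vitali_measure_le bK mE) => [q /rad0 r0|d ud dP td]; first exact: mulr_gt0.
have r0 i : i \in d -> (0 < rad i)%R by move=> /dP/rad0.
pose good i := \int[mu]_(y in B (rat_rV i) (Lam * rad i)%R) e y <=
  (delta * t)%:E * mu (B (rat_rV i) (Lam * rad i)%R).
pose bad := [seq i <- d | ~~ good i].
have badP i : i \in bad -> i \in d /\ ~~ good i by rewrite mem_filter => /andP[].
have step i : i \in d -> mu (E `&` B (rat_rV i) (3 * (2 * rad i))%R) <=
    (2 * kappa * Lam ^+ n)%:E * mu (B (rat_rV i) (rad i)) +
    (if ~~ good i then mu (B (rat_rV i) (3 * (2 * rad i))%R) else 0).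
  move=> id; case: ifPn => gi.
    rewrite -[leLHS]add0e; apply: leeD.
      by rewrite mule_ge0// lee_fin mulr_ge0 ?exprn_ge0 ?(ltW Lam0)// mulr_ge0// ltW.
    by apply: le_measure; rewrite ?inE//; exact: measurableI.
  rewrite adde0 (_ : 3 * (2 * rad i) = 6 * rad i)%R; last by ring.
  apply: level_ball_le => //; first exact: r0.
    by move=> s; apply: Pf; exact: dP.
  by move: gi; rewrite negbK.
apply: (@le_trans _ _ (\sum_(i <- d) ((2 * kappa * Lam ^+ n)%:E * mu (B (rat_rV i) (rad i)) +
    (if ~~ good i then mu (B (rat_rV i) (3 * (2 * rad i))%R) else 0)))).
  by rewrite big_seq [leRHS]big_seq; apply: lee_sum => i; exact: step.
rewrite big_split/=; apply: leeD.
  rewrite -ge0_sume_distrr//.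
  (* The lower bound on the mean of [f] is known at radius rad only; these balls inherit
     disjointness from those of radius 2 rad. *)
  have td1 : trivIset [set` d] (fun i => B (rat_rV i) (rad i)).
    apply/trivIsetP => i j /= id jd ij; have /trivIsetP/(_ i j id jd ij) := td.
    apply: subsetI_eq0; apply: (body_ball_le bK); rewrite ?r0//;
      by rewrite ler_peMl ?ler1n// ltW// r0.
  have := disjoint_balls_weak_type bK tau0 ud td1 r0 mf f0 (fun i id => fP i (dP i id)).
  move=> H; apply: (@le_trans _ _ ((2 * kappa * Lam ^+ n)%:E * ((2 / (t / 2 ^+ n))%:E *
      \int[mu]_(x in [set x | (t / 2 ^+ n / 2)%:E < f x]) f x))).
    by apply: lee_wpmul2l => //; rewrite lee_fin mulr_ge0 ?exprn_ge0 ?(ltW Lam0)// mulr_ge0// ltW.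
  rewrite muleA -EFinM (_ : (_ * (2 / _) = 4 * kappa * Lam ^+ n * 2 ^+ n / t)%R)//.
  set k := kappa; set l := (Lam ^+ n)%R; set q := (2 ^+ n)%R in p0 *.
  by field; rewrite !gt_eqF.
rewrite -big_mkcond -big_filter -/bad.
have r0b i : i \in bad -> (0 < rad i)%R by move=> /badP[/r0].
have tb : trivIset [set` bad] (fun i => B (rat_rV i) (2 * rad i)%R).
  by apply: sub_trivIset td => i /badP[].
have ub : uniq bad by exact: filter_uniq.
rewrite (_ : \sum_(i <- bad) _ = (3 ^+ n)%:E * \sum_(i <- bad) mu (B (rat_rV i) (2 * rad i)%R)); last first.
  rewrite ge0_sume_distrr// big_seq [RHS]big_seq; apply: eq_bigr => i ib.
  by rewrite mu_ball_scale// mulr_gt0// r0b.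
rewrite measure_disjoint_sum//.
have mUL : measurable (\bigcup_(i in [set` bad]) B (rat_rV i) (Lam * rad i)%R).
  by rewrite bigcup_seq; apply: bigsetU_measurable => i _; exact: mB.
(* The mean of [e] is large on the enlarged balls, which may overlap; only their union is compared
   with the disjoint ones, before covering it again. *)
apply: (@le_trans _ _ ((3 ^+ n)%:E * mu (setT `&` \bigcup_(i in [set` bad]) B (rat_rV i) (Lam * rad i)%R))).
  apply: lee_wpmul2l; first by rewrite lee_fin exprn_ge0.
  apply: le_measure; rewrite ?inE.
  - by rewrite bigcup_seq; apply: bigsetU_measurable => i _; exact: mB.
  - by rewrite setTI.
  - rewrite setTI => x [i /= ib Bx]; exists i => //; apply: (body_ball_le bK) Bx.
      by rewrite mulr_gt0// r0b.
    by rewrite ler_wpM2r ?(ltW (r0b _ ib))// (le_trans _ Lam12)// ler_nat.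
set IE := \int[mu]_(x in _) e x.
have -> : (9 ^+ n * 2 / (delta * t))%:E * IE =
    (3 ^+ n)%:E * ((3 ^+ n)%:E * ((2 / (delta * t))%:E * IE)).
  rewrite !muleA -!EFinM; congr (_%:E * _); rewrite !mulrA -exprMn.
  by congr (_ ^+ _ * _ / _)%R; ring.
apply: lee_wpmul2l; first by rewrite lee_fin exprn_ge0.
apply: (vitali_measure_le bK measurableT) => [i /= ib|d' ud' d'b td'].
  by rewrite mulr_gt0// r0b.
rewrite (eq_big_seq (fun i => (3 ^+ n)%:E * mu (B (rat_rV i) (Lam * rad i)%R))); last first.
  by move=> i /d'b ib; rewrite setTI mu_ball_scale// mulr_gt0// r0b.
rewrite -ge0_sume_distrr//; apply: lee_wpmul2l; first by rewrite lee_fin exprn_ge0.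
apply: (disjoint_balls_weak_type bK dt0 ud' td' _ me e0) => i /d'b ib.
  by rewrite mulr_gt0// r0b.
by have [_] := badP _ ib; rewrite /good -ltNge => /ltW.
Qed.

End good_lambda.

(** * Summation over dyadic levels *)

Section geometric_levels.
Context {R : realType}.

Definition level (s : R) (k : nat) : R := 2 ^+ k * s.

Lemma level_gt0 s k : 0 < s -> 0 < level s k.
Proof. by move=> s0; rewrite mulr_gt0// exprn_gt0. Qed.

Lemma levelS s k : level s k.+1 = 2 * level s k.
Proof. by rewrite /level exprS mulrA. Qed.

Lemma level_le s k l : 0 < s -> (k <= l)%N -> level s k <= level s l.
Proof. by move=> s0 kl; rewrite ler_wpM2r ?(ltW s0)// ler_weXn2l// ler1n. Qed.

Lemma two_powR_gt1 (q : R) : 0 < q -> 1 < 2 `^ q.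
Proof.
move=> q0; rewrite -[ltLHS](_ : 1 `^ q = 1 :> R); last by rewrite powR1.
by apply: gt0_ltr_powR; rewrite ?nnegrE// ltr1n.
Qed.

Lemma level_powRS s k q : 0 < s -> level s k.+1 `^ q = 2 `^ q * level s k `^ q.
Proof. by move=> s0; rewrite levelS powRM// ltW// level_gt0. Qed.

Lemma sum_level_powR s q M : 0 < s -> 0 < q ->
  \sum_(k < M) level s k `^ q <= level s M `^ q / (2 `^ q - 1).
Proof.
move=> s0 q0; have q1 : 0 < 2 `^ q - 1 by rewrite subr_gt0 two_powR_gt1.
elim: M => [|M IH]; first by rewrite big_ord0 divr_ge0 ?powR_ge0// ltW.
rewrite big_ord_recr/=; apply: (le_trans (lerD IH (lexx _))).
rewrite level_powRS// le_eqVlt; apply/orP; left; apply/eqP.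
by field; rewrite gt_eqF.
Qed.

(** Once the last level is below [v], all are; as the ratio 2^q exceeds 1, the geometric sum is a
    constant times its largest term. *)
Lemma sum_level_powR_lt s q M v : 0 < s -> 0 < q -> 0 <= v ->
  \sum_(k < M) level s k `^ q * (level s k < v)%R%:R <=
  2 `^ q / (2 `^ q - 1) * v `^ q.
Proof.
move=> s0 q0 v0; have q1 : 0 < 2 `^ q - 1 by rewrite subr_gt0 two_powR_gt1.
elim: M => [|M IH]; first by rewrite big_ord0 mulr_ge0 ?divr_ge0 ?powR_ge0// ltW.
rewrite big_ord_recr/=; have [tv|vt] := ltP (level s M) v; last first.
  by rewrite mulr0 addr0.
rewrite mulr1; apply: (@le_trans _ _ (\sum_(k < M.+1) level s k `^ q)).
  rewrite big_ord_recr/= lerD2r; apply: ler_sum => k _.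
  by rewrite ler_piMr ?powR_ge0// lern1 leq_b1.
apply: (le_trans (sum_level_powR _ s0 q0)).
rewrite level_powRS// mulrAC; apply: ler_wpM2l.
  by rewrite divr_ge0 ?powR_ge0// ltW.
by apply: ge0_ler_powR; rewrite ?nnegrE// ltW// level_gt0.
Qed.

(* Take the last [k] with [2 * level s k < u]. *)
Lemma powR_le_sum_level s p M u : 0 < s -> 0 < p -> 2 * s < u -> u <= 2 * level s M ->
  u `^ p <= \sum_(k < M) (4 * level s k) `^ p * (2 * level s k < u)%R%:R.
Proof.
move=> s0 p0 su; elim: M => [|M IH] uM.
  by move: uM; rewrite /level expr0 mul1r leNgt su.
rewrite big_ord_recr/=; have [tu|ut] := ltP (2 * level s M) u.
  rewrite mulr1 (le_trans _ (_ : (4 * level s M) `^ p <= _))//.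
    apply: ge0_ler_powR; rewrite ?nnegrE ?(ltW p0)//.
    - by rewrite (le_trans _ (ltW su))// mulr_ge0// ltW.
    - by rewrite mulr_ge0// ltW// level_gt0.
    - by rewrite (le_trans uM)// levelS mulrA -natrM.
  by rewrite lerDr sumr_ge0// => k _; rewrite mulr_ge0// powR_ge0.
by rewrite mulr0 addr0; exact: IH.
Qed.

End geometric_levels.

Section level_sums.
Context {d} {T : measurableType d} {R : realType}.
Variable m : {measure set T -> \bar R}.
Local Open Scope ereal_scope.
Variable p : R.
Hypothesis p1 : (1 < p)%R.
Local Notation q := (p - 1)%R.
Local Notation C := (2 `^ q / (2 `^ q - 1))%R.

Let q0 : (0 < q)%R. Proof. by rewrite subr_gt0. Qed.
Let p0 : (0 < p)%R. Proof. by rewrite (lt_trans ltr01). Qed.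
Let C0 : (0 < C)%R.
Proof. by rewrite divr_gt0 ?powR_gt0// subr_gt0 two_powR_gt1. Qed.

Let mlevel (g : T -> \bar R) t : measurable_fun setT g -> measurable [set x | t < g x].
Proof. by move=> mg; rewrite -[X in measurable X]setTI; exact: emeasurable_fun_o_infty. Qed.

(** The factor of the integral of g^p when (a/t) times the integral of g over g > ct is weighted by
    (4t)^p and summed over dyadic t: the weights are 4^p a t^(p-1), whose sum over t < g/c is at
    most 4^p a C (g/c)^(p-1). *)
Definition level_cst (a c : R) : R := (4 `^ p * a * C / c `^ q)%R.

Lemma level_cst_ge0 a c : (0 <= a)%R -> (0 <= level_cst a c)%R.
Proof.
move=> a0; apply: divr_ge0; last exact: powR_ge0.
by apply: mulr_ge0; [rewrite mulr_ge0 ?powR_ge0|exact: ltW].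
Qed.

Lemma level_cst_gt0 a c : (0 < a)%R -> (0 < c)%R -> (0 < level_cst a c)%R.
Proof.
move=> a0 c0; apply: divr_gt0; last exact: powR_gt0.
by apply: mulr_gt0; [rewrite mulr_gt0 ?powR_gt0|exact: C0].
Qed.

Lemma sum_level_pointwise a c s M (u : \bar R) : (0 < a)%R -> (0 < c)%R -> (0 < s)%R ->
  0 <= u ->
  \sum_(k < M) ((4 * level s k) `^ p * (a / level s k))%:E *
     (u * ((c * level s k)%:E < u)%E%:R%:E) <= (level_cst a c)%:E * u `^ p.
Proof.
move=> a0 c0 s0; case: u => [u|_|//]; last first.
  rewrite poweRyr ?gt_eqF// gt0_muley ?leey// lte_fin.
  exact: level_cst_gt0.
rewrite lee_fin => u0; rewrite poweR_EFin -EFinM.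
under eq_bigr do rewrite -!EFinM.
rewrite sumEFin lee_fin.
have uc0 : (0 <= u / c)%R by rewrite divr_ge0// ltW.
have -> : (level_cst a c * u `^ p = 4 `^ p * a * u * (C * (u / c) `^ q))%R.
  have -> : (u `^ p = u * ((u / c) `^ q * c `^ q))%R.
    by rewrite -powRM ?(ltW c0)// divfK ?gt_eqF// mulr_powRB1.
  rewrite /level_cst; set x := (_ `^ q)%R; set y := (c `^ q)%R; set z := ((u / c) `^ q)%R.
  have y0 : (y != 0)%R by rewrite gt_eqF// powR_gt0.
  have x0 : (x - 1 != 0)%R by rewrite gt_eqF// subr_gt0 two_powR_gt1.
  by field; rewrite x0 y0.
apply: (@le_trans _ _ (4 `^ p * a * u * \sum_(k < M) level s k `^ q * (level s k < u / c)%R%:R)%R); last first.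
  rewrite ler_wpM2l ?sum_level_powR_lt//.
  by rewrite !mulr_ge0 ?powR_ge0// ltW.
rewrite mulr_sumr; apply: ler_sum => k _.
have t0 := level_gt0 k s0; set t := level s k in t0 *.
rewrite lte_fin ltr_pdivlMr// [(t * c)%R]mulrC powRM ?(ltW t0)//.
rewrite -(@mulr_powRB1 _ t p (ltW t0) p0).
rewrite le_eqVlt; apply/orP; left; apply/eqP.
set x := (4 `^ p)%R; set y := (t `^ q)%R; set z := (nat_of_bool _)%:R.
by field; rewrite gt_eqF.
Qed.

Lemma sum_level_integral (g : T -> \bar R) a c s M : (0 < a)%R -> (0 < c)%R -> (0 < s)%R ->
  measurable_fun setT g -> (forall x, 0 <= g x) ->
  \sum_(k < M) ((4 * level s k) `^ p)%:E *
     ((a / level s k)%:E * \int[m]_(x in [set x | (c * level s k)%:E < g x]) g x) <=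
  (level_cst a c)%:E * \int[m]_x (g x `^ p).
Proof.
move=> a0 c0 s0 mg g0.
pose G k : set T := [set x | (c * level s k)%:E < g x].
have mG k : measurable (G k) by exact: mlevel.
have mi k : measurable_fun setT (fun x => (\1_(G k) x)%:E : \bar R).
  by apply/measurable_EFinP; apply: measurable_indic; exact: mG.
have mgi k : measurable_fun setT (fun x => g x * (\1_(G k) x)%:E).
  exact: emeasurable_funM.
have gi0 k x : 0 <= g x * (\1_(G k) x)%:E.
  by rewrite mule_ge0// lee_fin.
pose w k : R := ((4 * level s k) `^ p * (a / level s k))%R.
have w0 k : (0 <= w k)%R by rewrite mulr_ge0 ?powR_ge0// divr_ge0// ltW// level_gt0.
have we0 k : 0 <= (w k)%:E by rewrite lee_fin.
have mpow : measurable_fun setT (fun x => g x `^ p).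
  by apply: (measurableT_comp (measurable_poweR _)).
rewrite (eq_bigr (fun k : 'I_M => \int[m]_x ((w k)%:E * (g x * (\1_(G k) x)%:E)))); last first.
  by move=> k _; rewrite -/(G k) [in LHS]integral_indic_mul muleA -EFinM [RHS]ge0_integralZl// lee_fin.
rewrite -ge0_integral_sum//; last 2 first.
- by move=> k; exact: measurable_funeM.
- by move=> k x _; rewrite mule_ge0.
rewrite -ge0_integralZl//; last 2 first.
- by move=> x _; exact: poweR_ge0.
- by rewrite lee_fin; apply: level_cst_ge0; exact: ltW.
apply: ge0_le_integral => //.
- by move=> x _; apply: sume_ge0 => k _; rewrite mule_ge0.
- by apply: emeasurable_sum => k; exact: measurable_funeM.
- exact: measurable_funeM.
move=> x _; apply: le_trans (sum_level_pointwise M a0 c0 s0 (g0 x)).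
apply: lee_sum => k _; rewrite indicE.
by rewrite (_ : (x \in G k) = ((c * level s k)%:E < g x)%E)//; apply/idP/idP; rewrite inE.
Qed.

Variables (f : T -> R) (e : T -> \bar R).
Hypotheses (mf : measurable_fun setT f) (f0 : forall x, (0 <= f x)%R).
Hypotheses (me : measurable_fun setT e) (e0 : forall x, 0 <= e x).
Variables (a1 a2 c1 c2 : R).
Hypotheses (a10 : (0 < a1)%R) (a20 : (0 < a2)%R) (c10 : (0 < c1)%R) (c20 : (0 < c2)%R).
Hypothesis level_le : forall t, (0 < t)%R ->
  m [set x | (t *+ 2)%:E < (f x)%:E] <=
  (a1 / t)%:E * \int[m]_(x in [set x | (c1 * t)%:E < (f x)%:E]) (f x)%:E +
  (a2 / t)%:E * \int[m]_(x in [set x | (c2 * t)%:E < e x]) e x.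

Let mfp : measurable_fun setT (fun x => (f x `^ p)%:E).
Proof. by apply/measurable_EFinP; apply: (measurableT_comp (measurable_powR _)). Qed.

(** A layer-cake bound: on the truncation f^p is at most the sum of (4t)^p over the levels t with f
    > 2t, and [level_le] is applied to each of these finitely many levels. *)
Lemma truncated_powR_integral_le s M : (0 < s)%R ->
  \int[m]_(x in [set x | (2 * s < f x)%R && (f x <= 2 * level s M)%R]) (f x `^ p)%:E <=
  (level_cst a1 c1)%:E * \int[m]_x (f x `^ p)%:E +
  (level_cst a2 c2)%:E * \int[m]_x (e x `^ p).
Proof.
move=> s0; set D := [set x | _].
have mEf : measurable_fun setT (EFin \o f) by exact/measurable_EFinP.
pose G k : set T := [set x | (level s k *+ 2)%:E < (f x)%:E].
have mG k : measurable (G k) by exact: mlevel.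
have mi k : measurable_fun setT (fun x => (\1_(G k) x)%:E : \bar R).
  by apply/measurable_EFinP; exact: measurable_indic.
have mD : measurable D.
  rewrite (_ : D = [set x | (2 * s)%:E < (f x)%:E] `&` ~` [set x | (2 * level s M)%:E < (f x)%:E]).
    by apply: measurableI; [exact: mlevel|apply: measurableC; exact: mlevel].
  apply/seteqP; split => x; rewrite /D/= !lte_fin leNgt; first by move=> /andP[-> /negP].
  by move=> [-> /negP ->].
have w0 k : 0 <= ((4 * level s k) `^ p)%:E by rewrite lee_fin powR_ge0.
apply: (@le_trans _ _ (\int[m]_x (\sum_(k < M) ((4 * level s k) `^ p)%:E * (\1_(G k) x)%:E))).
  rewrite integral_indic_mul; apply: ge0_le_integral => //.
  - by move=> x _; rewrite mule_ge0// lee_fin ?powR_ge0.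
  - apply: emeasurable_funM => //; apply/measurable_EFinP; exact: measurable_indic.
  - by apply: emeasurable_sum => k; exact: measurable_funeM.
  move=> x _; have [Dx|Dx] := pselect (D x); last first.
    rewrite [X in _ * X%:E <= _]indicE memNset// mule0; apply: sume_ge0 => k _.
    by rewrite mule_ge0// lee_fin.
  rewrite [X in _ * X%:E <= _]indicE mem_set// mule1.
  under eq_bigr do rewrite -EFinM.
  rewrite sumEFin lee_fin; move: Dx => /andP[fs fM].
  apply: (le_trans (powR_le_sum_level s0 p0 fs fM)); apply: ler_sum => k _.
  rewrite indicE (_ : (x \in G k) = (2 * level s k < f x)%R)//.
  by rewrite mulr_natl; apply/idP/idP; rewrite inE /G/= lte_fin.
rewrite ge0_integral_sum//; last 2 first.
- by move=> k; exact: measurable_funeM.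
- by move=> k x _; rewrite mule_ge0// lee_fin.
pose I1 k := \int[m]_(x in [set x | (c1 * level s k)%:E < (f x)%:E]) (f x)%:E.
pose I2 k := \int[m]_(x in [set x | (c2 * level s k)%:E < e x]) e x.
have I10 k : 0 <= I1 k by apply: integral_ge0 => x _; rewrite lee_fin.
have I20 k : 0 <= I2 k by apply: integral_ge0.
apply: (@le_trans _ _ (\sum_(k < M) (((4 * level s k) `^ p)%:E * ((a1 / level s k)%:E * I1 k) +
     ((4 * level s k) `^ p)%:E * ((a2 / level s k)%:E * I2 k)))).
  apply: lee_sum => k _; rewrite ge0_integralZl//.
  have t0 := level_gt0 k s0.
  rewrite integral_indic// setIT -ge0_muleDr; last 2 first.
  - by rewrite mule_ge0// lee_fin divr_ge0// ltW.
  - by rewrite mule_ge0// lee_fin divr_ge0// ltW.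
  by apply: lee_wpmul2l => //; exact: level_le.
rewrite big_split/=; apply: leeD.
  have := sum_level_integral M a10 c10 s0 mEf (fun x => _ : 0 <= (EFin \o f) x).
  by apply => x; rewrite lee_fin.
exact: sum_level_integral.
Qed.

Lemma powR_integral_le :
  \int[m]_x (f x `^ p)%:E <= (level_cst a1 c1)%:E * \int[m]_x (f x `^ p)%:E +
  (level_cst a2 c2)%:E * \int[m]_x (e x `^ p).
Proof.
(* With s = 2^-k and 2k levels the window of values grows with k from both ends and exhausts the
   positive reals, under a bound free of k; the zeros of [f] contribute nothing. *)
pose s k : R := (2 ^- k)%R; have s0 k : (0 < s k)%R by rewrite invr_gt0 exprn_gt0.
have sE k : level (s k) (k + k) = (2 ^+ k)%R.
  by rewrite /level /s exprD mulfK// gt_eqF// exprn_gt0.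
pose D k : set T := [set x | (2 * s k < f x)%R && (f x <= 2 * level (s k) (k + k))%R].
have mEf : measurable_fun setT (EFin \o f) by exact/measurable_EFinP.
have mD k : measurable (D k).
  rewrite (_ : D k = [set x | (2 * s k)%:E < (f x)%:E] `&` ~` [set x | (2 * level (s k) (k + k))%:E < (f x)%:E]).
    by apply: measurableI; [exact: mlevel|apply: measurableC; exact: mlevel].
  apply/seteqP; split => x; rewrite /D/= !lte_fin leNgt; first by move=> /andP[-> /negP].
  by move=> [-> /negP ->].
have ndD : nondecreasing_seq D.
  move=> k l kl; apply/subsetPset => x /andP[sf fs]; apply/andP; split.
    apply: le_lt_trans sf; rewrite ler_pM2l// lef_pV2 ?posrE ?exprn_gt0//.
    by rewrite ler_weXn2l// ler1n.
  by rewrite (le_trans fs)// ler_pM2l// !sE ler_weXn2l// ler1n.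
have fp0 x : 0 <= (f x `^ p)%:E by rewrite lee_fin powR_ge0.
have cv := ge0_nondecreasing_set_cvg_integral (mu := m) ndD mD
  (fun k => measurable_funTS mfp) (fun k x _ => fp0 x).
rewrite {1}(_ : \int[m]_x (f x `^ p)%:E = \int[m]_(x in \bigcup_k D k) (f x `^ p)%:E).
  rewrite -(cvg_lim _ cv)//; apply: lime_le; first exact: cvgP cv.
  by apply: nearW => k; exact: truncated_powR_integral_le.
rewrite [RHS]integral_indic_mul; apply: eq_integral => x _.
have [fx0|fx0] := eqVneq (f x) 0%R; first by rewrite fx0 powR0 ?gt_eqF// mul0e.
have fxp : (0 < f x)%R by rewrite lt_def fx0 f0.
rewrite indicE mem_set ?mule1//.
pose k := maxn (Num.truncn (2 / f x)) (Num.truncn (f x)).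
have k2 j : (j.+1%:R <= 2 ^+ j :> R)%R by rewrite -natrX ler_nat ltn_expl.
exists k => //; apply/andP; split.
  rewrite /s ltr_pdivrMr ?exprn_gt0// mulrC -ltr_pdivrMr//.
  apply: (lt_le_trans (truncnS_gt _)); apply: le_trans (k2 k).
  by rewrite ler_nat ltnS leq_maxl.
rewrite sE; apply: (@le_trans _ _ (2 ^+ k)%R); last first.
  by rewrite ler_peMl ?exprn_ge0// ler1n.
apply: le_trans (k2 k); apply/ltW/(lt_le_trans (truncnS_gt _)).
by rewrite ler_nat ltnS leq_maxr.
Qed.

End level_sums.

(** Write each power as t^p = t t^(p-1): the second factor increases with t. *)
Lemma powR_superadditive {R : realType} (p u v : R) : 1 < p -> 0 <= u -> 0 <= v ->
  u `^ p + v `^ p <= (u + v) `^ p.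
Proof.
move=> p1 u0 v0; have p0 : 0 < p by rewrite (lt_trans ltr01).
have uv0 : 0 <= u + v by rewrite addr_ge0.
have q0 : 0 <= p - 1 by rewrite subr_ge0 ltW.
rewrite -(mulr_powRB1 u0 p0) -(mulr_powRB1 v0 p0) -(mulr_powRB1 uv0 p0) mulrDl.
by apply: lerD; rewrite ler_wpM2l// ge0_ler_powR ?nnegrE// ?lerDl ?lerDr.
Qed.

(** * The integral inequality for Borel functions *)

Section core.
Context {R : realType} {n : nat}.
Local Notation V := 'rV[R]_n.
Local Notation mu := (borel_lebesgue R n).
Local Open Scope ereal_scope.

(** Where f > t, f is at most t^(1-p) f^p. *)
Lemma tail_integral_lty (p : R) (f : V -> R) t : (1 < p)%R -> measurable_fun setT f ->
  (forall x, (0 <= f x)%R) -> \int[mu]_x (f x `^ p)%:E < +oo -> (0 < t)%R ->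
  \int[mu]_(x in [set x | t%:E < (f x)%:E]) (f x)%:E < +oo.
Proof.
move=> p1 mf f0 fp t0.
have p0 : (0 < p)%R by rewrite (lt_trans ltr01).
have q0 : (0 <= p - 1)%R by rewrite subr_ge0 ltW.
have mEf : measurable_fun setT (EFin \o f) by exact/measurable_EFinP.
have mG : measurable [set x | t%:E < (f x)%:E].
  by rewrite -[X in measurable X]setTI; exact: emeasurable_fun_o_infty.
have mfp : measurable_fun setT (fun x => (f x `^ p)%:E).
  by apply/measurable_EFinP; apply: (measurableT_comp (measurable_powR _)).
apply: (@le_lt_trans _ _ (\int[mu]_(x in [set x | t%:E < (f x)%:E])
    ((t `^ (p - 1))^-1%:E * (f x `^ p)%:E))).
  apply: ge0_le_integral => //.
  - by move=> x _; rewrite lee_fin.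
  - exact: measurable_funTS.
  - by apply: measurable_funTS; exact: measurable_funeM.
  move=> x /=; rewrite lte_fin => tf; rewrite -EFinM lee_fin.
  rewrite -(mulr_powRB1 (f0 x) p0) mulrCA ler_peMr// mulrC ler_pdivlMr ?powR_gt0// mul1r.
  by apply: ge0_ler_powR => //; rewrite ?nnegrE// ltW.
rewrite ge0_integralZl//; last 3 first.
- exact: measurable_funTS.
- by move=> x _; rewrite lee_fin powR_ge0.
- by rewrite lee_fin invr_ge0 powR_ge0.
apply: lte_mul_pinfty; rewrite ?lee_fin ?invr_ge0 ?powR_ge0//.
apply: le_lt_trans fp; apply: ge0_subset_integral => //.
by move=> x _; rewrite lee_fin powR_ge0.
Qed.

(** [level_cst] is linear in [a], and m occurs there only through the factor 1/(m + 1) of kappa, so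
    the constant is Z/(m + 1). The bound 1/2 is what absorption needs. *)
Lemma small_level_cst (p lambda : R) : (0 < lambda)%R ->
  exists2 m : nat, (32 < lambda * m.+1%:R)%R &
  (level_cst p (4 * ((n%:R * 32 / lambda) ^+ 2 / m.+1%:R) * (12 * (1 + 4 / lambda)) ^+ n * 2 ^+ n)
     ((2 ^+ n)^-1 / 2) <= 2^-1)%R.
Proof.
move=> l0; pose Z := level_cst p (4 * (n%:R * 32 / lambda) ^+ 2 * (12 * (1 + 4 / lambda)) ^+ n * 2 ^+ n)
  ((2 ^+ n)^-1 / 2).
pose m := maxn (Num.truncn (2 * Z)) (Num.truncn (32 / lambda)).
have m0 : (0 < m.+1%:R :> R)%R by [].
have mZ : (2 * Z < m.+1%:R)%R.
  by apply: (lt_le_trans (truncnS_gt _)); rewrite ler_nat ltnS leq_maxl.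
have ml : (32 / lambda < m.+1%:R)%R.
  by apply: (lt_le_trans (truncnS_gt _)); rewrite ler_nat ltnS leq_maxr.
exists m; first by rewrite mulrC -ltr_pdivrMr.
rewrite (_ : level_cst _ _ _ = Z / m.+1%:R)%R.
  by rewrite ler_pdivrMr// mulrC ler_pdivlMr// mulrC ltW.
rewrite /Z /level_cst; move: m0; set M := m.+1%:R; set x := (_ ^+ 2)%R.
set y := ((12 * _) ^+ n)%R; set z := (_ `^ (p - 1) / _)%R; set w := (_ `^ _)^-1%R.
set v := (4 `^ p)%R; set u := (2 ^+ n)%R => M0.
by field; rewrite gt_eqF.
Qed.

(** Absorption in I <= I/2 + C2 E, with I finite, leaves E >= I/(2 C2). As I + E is at most the
    integral of N^p, the gain is c = 1/(2 C2). *)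
Theorem max_fun_powR_integral (p lambda : R) : (0 < n)%N -> (1 < p)%R -> (0 < lambda <= 1)%R ->
  exists2 c : R, (0 < c)%R & forall (K : set V) (f : V -> R), sym_body K ->
    measurable_fun setT f -> (forall x, (0 <= f x)%R) -> \int[mu]_x (f x `^ p)%:E < +oo ->
    (1 + c)%:E * \int[mu]_x (f x `^ p)%:E <=
    \int[mu]_x (max_fun K lambda (EFin \o f) x `^ p).
Proof.
move=> n0 p1 l01; have l0 : (0 < lambda)%R by case/andP: l01.
have p0 : (0 < p)%R by rewrite (lt_trans ltr01).
have [m lm small] := small_level_cst p l0.
pose kappa := ((n%:R * 32 / lambda) ^+ 2 / m.+1%:R)%R.
pose Lam := (12 * (1 + 4 / lambda))%R.
pose delta := (kappa / (m.+1%:R ^+ n.+1 *+ 2))%R.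
have p20 : (0 < 2 ^+ n :> R)%R by rewrite exprn_gt0.
have kappa0 : (0 < kappa)%R.
  by rewrite divr_gt0// exprn_gt0// divr_gt0// mulr_gt0// ltr0n.
have Lam0 : (0 < Lam)%R by rewrite mulr_gt0// addr_gt0// divr_gt0.
have delta0 : (0 < delta)%R by rewrite divr_gt0// mulrn_wgt0// exprn_gt0.
pose a1 := (4 * kappa * Lam ^+ n * 2 ^+ n)%R; pose a2 := (9 ^+ n * 2 / delta)%R.
pose c1 : R := ((2 ^+ n)^-1 / 2)%R; pose c2 := (delta / 2)%R.
have a10 : (0 < a1)%R.
  apply: mulr_gt0; last exact: p20.
  by apply: mulr_gt0; [exact: mulr_gt0|exact: exprn_gt0].
have a20 : (0 < a2)%R.
  by apply: divr_gt0 => //; apply: mulr_gt0 => //; exact: exprn_gt0.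
have c10 : (0 < c1)%R by rewrite divr_gt0// invr_gt0.
have c20 : (0 < c2)%R by rewrite divr_gt0.
pose C2 := level_cst p a2 c2; have C20 : (0 < C2)%R by exact: level_cst_gt0.
exists (2 * C2)^-1%R; first by rewrite invr_gt0 mulr_gt0.
move=> K f bK mf f0 fp; set N := max_fun K lambda (EFin \o f).
have mEf : measurable_fun setT (EFin \o f) by exact/measurable_EFinP.
have Ef0 x : 0 <= (EFin \o f) x by rewrite lee_fin.
have mN : measurable_fun setT N by exact: measurable_max_fun.
have N0 x : 0 <= N x by exact: max_fun_ge0.
pose e x := maxe (N x - (f x)%:E) 0.
have me : measurable_fun setT e.
  by apply: measurable_maxe => //; exact: emeasurable_funB.
have e0 x : 0 <= e x by rewrite /e le_max lexx orbT.
have feE x : (f x)%:E + e x = maxe (N x) (f x)%:E.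
  rewrite /e; have := N0 x; case: (N x) => [v||]// _.
  by rewrite -EFinB -!EFin_max -EFinD addr_maxr addr0 addrC subrK.
have Nfe x : N x <= (EFin \o f) x + e x by rewrite /= feE le_max lexx.
have tail t : (0 < t)%R -> \int[mu]_(x in [set x | t%:E < (EFin \o f) x]) (EFin \o f) x < +oo.
  by move=> t0; exact: (tail_integral_lty p1 mf f0 fp t0).
have gl t : (0 < t)%R -> mu [set x | (t *+ 2)%:E < (f x)%:E] <=
  (a1 / t)%:E * \int[mu]_(x in [set x | (c1 * t)%:E < (f x)%:E]) (f x)%:E +
  (a2 / t)%:E * \int[mu]_(x in [set x | (c2 * t)%:E < e x]) e x.
  move=> t0; have := good_lambda bK n0 l01 mEf Ef0 me e0 Nfe tail lm t0.
  rewrite -/kappa -/Lam -/delta.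
  rewrite (_ : t / 2 ^+ n / 2 = c1 * t)%R; last by rewrite /c1 [RHS]mulrC mulrA.
  rewrite (_ : delta * t / 2 = c2 * t)%R; last by rewrite /c2 mulrAC.
  by rewrite (_ : 9 ^+ n * 2 / (delta * t) = a2 / t)%R// /a2 invfM mulrA.
have main := powR_integral_le p1 mf f0 me e0 a10 a20 c10 c20 gl.
have fp0 x : (0 <= f x `^ p)%R by exact: powR_ge0.
set I := \int[mu]_x (f x `^ p)%:E in fp main *.
set E := \int[mu]_x (e x `^ p) in main *.
have I0 : 0 <= I by apply: integral_ge0 => x _; rewrite lee_fin.
have E0 : 0 <= E by apply: integral_ge0 => x _; exact: poweR_ge0.
have mfp : measurable_fun setT (fun x => (f x `^ p)%:E).
  by apply/measurable_EFinP; apply: (measurableT_comp (measurable_powR _)).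
have mep : measurable_fun setT (fun x => e x `^ p).
  by apply: (measurableT_comp (measurable_poweR _)).
have mNp : measurable_fun setT (fun x => N x `^ p).
  by apply: (measurableT_comp (measurable_poweR _)).
have IE : I + E <= \int[mu]_x (N x `^ p).
  rewrite -ge0_integralD//; last 2 first.
  - by move=> x _; rewrite lee_fin.
  - by move=> x _; exact: poweR_ge0.
  apply: ae_ge0_le_integral => //.
  - by move=> x _; rewrite adde_ge0 ?lee_fin// poweR_ge0.
  - exact: emeasurable_funD.
  - by move=> x _; exact: poweR_ge0.
  have mNf : measurable [set x | N x < (EFin \o f) x].
    by rewrite -[X in measurable X]setTI; apply: measurable_lte.
  exists [set x | N x < (EFin \o f) x]; split => //.
    exact: max_fun_lt_negligible.
  move=> x /= H; rewrite ltNge; apply/negP => fN; apply: H => _.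
  have -> : N x = (f x)%:E + e x by rewrite feE; apply/esym/max_idPl.
  have := e0 x; case: (e x) => [r||]//; last first.
    by rewrite addey// poweRyr ?gt_eqF// leey.
  rewrite lee_fin => r0; rewrite !poweR_EFin -!EFinD lee_fin.
  exact: powR_superadditive.
apply: le_trans IE; rewrite EFinD.
rewrite ge0_muleDl; [|by rewrite lee_fin|by rewrite lee_fin invr_ge0 ltW// mulr_gt0].
rewrite mul1e leeD2l//.
have Ifin : I \is a fin_num by rewrite ge0_fin_numE.
have half : (level_cst p a1 c1)%:E * I <= (2^-1)%:E * I.
  by apply: lee_wpmul2r => //; rewrite lee_fin.
have := le_trans main (leeD2r _ half); move: Ifin I0 E0.
case: (I) => [i||]//; case: (E) => [r||]//; last by move=> *; rewrite leey.
rewrite -!EFinM -!EFinD !lee_fin => _ i0 r0 H.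
have C22 : (0 < 2 * C2)%R by exact: mulr_gt0.
rewrite (ler_pdivrMl _ _ C22) -(mulrA 2%R); move: H; rewrite -/C2.
by set x := (C2 * r)%R; lra.
Qed.

End core.

(** * From Borel to Lebesgue measurable functions *)

Section borel_kernel.
Context {R : realType} {n : nat}.
Local Notation V := 'rV[R]_n.
Local Notation mu := (borel_lebesgue R n).
Local Notation leb := (lebesgue_rV R n).
Local Open Scope ereal_scope.

(** The completed measure is an infimum over countable Borel covers; the hull is the intersection of
    covers optimal up to 1/(j + 1). *)
Lemma borel_hull (F : set V) : leb F < +oo ->
  exists D : set V, [/\ measurable D, F `<=` D & mu D = leb F].
Proof.
move=> Foo; have F0 : 0 <= leb F by exact: outer_measure_ge0.
have Ffin : leb F \is a fin_num by rewrite ge0_fin_numE.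
have cov (j : nat) : exists2 A : (set V)^nat, measurable_cover F A &
    \sum_(k <oo) mu (A k) < leb F + j.+1%:R^-1%:E.
  have j0 : (0 < j.+1%:R^-1 :> R)%R by rewrite invr_gt0.
  by have [_ [A FA <-] lt] := lb_ereal_inf_adherent j0 Ffin; exists A.
have /choice[A AP] : forall j, exists A : (set V)^nat, measurable_cover F A /\
    \sum_(k <oo) mu (A k) < leb F + j.+1%:R^-1%:E.
  by move=> j; have [A FA lt] := cov j; exists A.
have mA j k : measurable (A j k) by have [[+ _] _] := AP j; exact.
pose D j := \bigcup_k A j k.
have mD j : measurable (D j) by exact: bigcupT_measurable.
have mDD : measurable (\bigcap_j D j) by exact: bigcapT_measurable.
have FD : F `<=` \bigcap_j D j by move=> x Fx j _; have [[_ +] _] := AP j; apply.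
exists (\bigcap_j D j); split => //.
apply/eqP; rewrite eq_le; apply/andP; split; last first.
  have [_ <-] := lebesgue_rVE mDD; exact: le_mu_ext.
apply/lee_addgt0Pr => eps eps0.
pose j := Num.truncn eps^-1.
have je : (j.+1%:R^-1 <= eps :> R)%R.
  by rewrite -[leRHS]invrK lef_pV2 ?posrE ?invr_gt0// ltW// truncnS_gt.
apply: (@le_trans _ _ (mu (D j))).
  by apply: le_measure; rewrite ?inE//; exact: bigcap_inf.
apply: (@le_trans _ _ (\sum_(k <oo) mu (A j k))).
  exact: measure_sigma_subadditive.
have [_ /ltW/le_trans] := AP j; apply.
by rewrite leeD2l// lee_fin.
Qed.

(** Hulls of the complement of [E], cut by balls to have finite measure, are removed from the space.
    Each hull exceeds the set it covers by a null set, because their measures agree and are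
    finite. *)
Lemma borel_kernel (E : set (lebesgue_space R n)) : measurable E ->
  exists C : set V, [/\ measurable C, C `<=` E & leb.-negligible (E `\` C)].
Proof.
move=> mE; pose W k : set V := ball (0%R : V) k.+1%:R.
have mW k : measurable (W k) by apply: open_measurable_rV; exact: ball_open.
have mWl k : measurable (W k : set (lebesgue_space R n)) := (lebesgue_rVE (mW k)).1.
pose F k : set (lebesgue_space R n) := ~` E `&` W k.
have mF k : measurable (F k) by apply: measurableI => //; exact: measurableC.
have Foo k : leb (F k) < +oo.
  apply: (@le_lt_trans _ _ (leb (W k))).
    by apply: le_measure; rewrite ?inE//; exact: subIsetr.
  by rewrite (lebesgue_rVE (mW k)).2 ball_measure_lty.
have /choice[D DP] := fun k => borel_hull (Foo k).
have mD k : measurable (D k) by have [] := DP k.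
have mDl k : measurable (D k : set (lebesgue_space R n)) := (lebesgue_rVE (mD k)).1.
exists (~` \bigcup_k D k); split.
- by apply: measurableC; exact: bigcupT_measurable.
- move=> x nD; apply: contrapT => nE; apply: nD.
  exists (Num.truncn `|x|) => //; have [_ + _] := DP (Num.truncn `|x|); apply.
  by split => //; rewrite /W mx_norm_ball /ball_/= sub0r normrN truncnS_gt.
apply: (@negligibleS _ _ _ _ (\bigcup_k (D k `\` F k : set (lebesgue_space R n)))).
  move=> x [Ex /contrapT[k _ Dx]]; exists k => //; split => //.
  by move=> [].
apply: negligible_bigcup => k; exists (D k `\` F k); split => //.
  exact: measurableD.
have [_ FD Dk] := DP k.
have lebD : leb (D k) = leb (F k) by rewrite (lebesgue_rVE (mD k)).2 Dk.
have Doo : leb (D k) < +oo by rewrite lebD.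
have := measureD (mDl k) (mF k) Doo; rewrite (setIidr FD) => ->.
rewrite [X in X - _]lebD subee// ge0_fin_numE//; exact: Foo.
Qed.

(** The rational superlevel sets of [f] are replaced by Borel kernels, and x is sent to the supremum
    of the rationals whose kernel contains it. A minorant is wanted because it only lowers the
    averages, while its norm is that of [f]. *)
Lemma borel_minorant (f : V -> R) :
  measurable_fun setT (f : lebesgue_space R n -> R) -> (forall x, (0 <= f x)%R) ->
  exists g : V -> R, [/\ measurable_fun setT g, forall x, (0 <= g x <= f x)%R &
    leb.-negligible [set x | g x != f x]].
Proof.
move=> mf f0.
pose E (a : rat) : set (lebesgue_space R n) := [set x | (ratr a < f x)%R].
have mE a : measurable (E a).
  rewrite (_ : E a = setT `&` f @^-1` `]ratr a, +oo[%classic); first exact: mf.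
  by apply/seteqP; split => x /=; rewrite in_itv/= andbT// => -[].
have /choice[C CP] := fun a => borel_kernel (mE a).
have mC a : measurable (C a) by have [] := CP a.
(* The maximum with 0 repairs the points lying in no kernel, where the supremum is -oo. *)
pose G (x : V) : \bar R := maxe 0 (ereal_sup [set (ratr a)%:E | a in [set a | C a x]]).
have G0 x : 0 <= G x by rewrite le_max lexx.
have Gf x : G x <= (f x)%:E.
  rewrite ge_max lee_fin f0/=; apply: ge_ereal_sup => _ [a Cx <-].
  by have [_ + _] := CP a => /(_ _ Cx)/= /ltW; rewrite lee_fin.
have Gfin x : G x \is a fin_num by rewrite ge0_fin_numE// (le_lt_trans (Gf x))// ltry.
have aG a x : C a x -> (ratr a)%:E <= G x.
  by move=> Cx; rewrite le_max; apply/orP; right; apply: ereal_sup_ubound; exists a.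
have mG : measurable_fun setT G.
  apply: (measurability _ (ErealGenOInfty.measurableE R)) => //.
  move=> _ [_ [t ->] <-]; rewrite setTI.
  have [t0|t0] := ltP t 0%R.
    rewrite (_ : _ @^-1` _ = setT)//; apply/seteqP; split => x //= _.
    by rewrite in_itv/= andbT (lt_le_trans _ (G0 x)).
  rewrite (_ : _ @^-1` _ = \bigcup_a (if (t < ratr a)%R then C a else set0)).
    apply: countable_bigcupT_measurable; first exact: countableP.
    by move=> a; case: ifPn.
  apply/seteqP; split => x /=; rewrite in_itv/= andbT.
    rewrite lt_max => /orP[|/ereal_sup_gt[_ [a Cx <-]]].
      by rewrite lte_fin ltNge t0.
    by rewrite lte_fin => ta; exists a => //; rewrite ta.
  move=> [a _]; case: ifPn => // ta Cx; apply: lt_le_trans (aG _ _ Cx).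
  by rewrite lte_fin.
exists (fine \o G); split.
- by apply: (measurableT_comp _ mG); exact: fine_measurable.
- by move=> x; rewrite /= fine_ge0//= -lee_fin fineK.
pose D k : set (lebesgue_space R n) := if unpickle k is Some a then E a `\` C a else set0.
have ND k : leb.-negligible (D k).
  rewrite /D; case: unpickle => [a|]; last exact: negligible_set0.
  by have [] := CP a.
apply: negligibleS (negligible_bigcup ND) => x /= gf.
have gf' : (fine (G x) < f x)%R.
  by rewrite lt_neqAle gf/= -lee_fin fineK.
have [a] := rat_in_itvoo gf'; rewrite in_itv/= => /andP[ga af].
exists (pickle a); first exact: I.
rewrite /D pickleK; split; first exact: af.
move=> /aG.
by rewrite -(fineK (Gfin x)) lee_fin leNgt ga.
Qed.

End borel_kernel.

Section lebesgue_transfer.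
Context {R : realType} {n : nat}.
Local Notation V := 'rV[R]_n.
Local Notation mu := (borel_lebesgue R n).
Local Notation leb := (lebesgue_rV R n).
Local Open Scope ereal_scope.

Lemma measurable_lebesgue_id : measurable_fun setT (id : lebesgue_space R n -> V).
Proof. by move=> _ B mB; rewrite setTI; exact: (lebesgue_rVE mB).1. Qed.

Lemma measurable_lebesgue_space d (T : measurableType d) (h : V -> T) :
  measurable_fun setT h -> measurable_fun setT (h : lebesgue_space R n -> T).
Proof.
by move=> mh _ B mB; rewrite setTI; apply: (lebesgue_rVE _).1; rewrite -[X in measurable X]setTI; exact: mh.
Qed.

Lemma ge0_integral_lebesgue_rV (D : set V) (h : V -> \bar R) :
  measurable D -> measurable_fun setT h -> (forall x, 0 <= h x) ->
  \int[leb]_(x in D) h x = \int[mu]_(x in D) h x.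
Proof.
move=> mD mh h0.
have := ge0_integral_pushforward measurable_lebesgue_id leb mD (measurable_funTS mh) (fun x _ => h0 x).
move=> <-.
apply: eq_measure_integral; first exact: measurable_lebesgue_id.
move=> mid A mA _.
refine (lebesgue_rVE mA).2.
Qed.

End lebesgue_transfer.

Section ge0_integral_monotone.
Context d (T : measurableType d) (R : realType).
Variable m : {measure set T -> \bar R}.
Local Open Scope ereal_scope.

(* Unlike [ge0_le_integral], no measurability is assumed. *)
Lemma ge0_le_integralT (f g : T -> \bar R) :
  (forall x, 0 <= f x) -> (forall x, f x <= g x) ->
  \int[m]_x f x <= \int[m]_x g x.
Proof.
move=> f0 fg; rewrite !ge0_integralTE//; last by move=> x; exact: le_trans (fg x).
apply: le_ereal_sup => _ [h hf <-]; exists h => // x.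
exact: le_trans (fg x).
Qed.

End ge0_integral_monotone.

(** * Reduction to a body centred at the origin *)

Section centred_body.
Context {R : realType} {n : nat}.
Local Notation V := 'rV[R]_n.
Variables (K : set V) (c0 : V).
Hypotheses (cK : convex_body K) (sK : symmetric_about c0 K).

Definition centred := [set v | K (c0 + v)].

Lemma convex_body_line x y t : 0 <= t <= 1 -> K x -> K y -> K (t *: x + (1 - t) *: y).
Proof.
move=> /andP[t0 t1] Kx Ky; case: cK => _ cvx _.
by have := cvx x y (Itv01 t0 t1); rewrite !inE; exact.
Qed.

Lemma centred_sym_body : sym_body centred.
Proof.
have [cmp _ [v0 iv0]] := cK.
have cvx x y t : 0 <= t <= 1 -> centred x -> centred y -> centred (t *: x + (1 - t) *: y).
  move=> t01 Kx Ky; have := convex_body_line t01 Kx Ky; rewrite /centred/=.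
  by rewrite !scalerDr addrACA -scalerDl (addrC t) subrK scale1r.
have sym x : centred x -> centred (- x).
  by move=> /sK; rewrite /centred/= mulr2n opprD addrA addrK.
have bnd : exists M : R, forall x, centred x -> `|x| <= M.
  have [M [_ HM]] := compact_bounded cmp.
  exists (M + 1 + `|c0|) => x Kx.
  rewrite -[x](addKr c0) (le_trans (ler_normD _ _))// normrN addrC lerD2r.
  by apply: HM => //; rewrite ltrDl.
have mC : measurable centred.
  have mK : measurable K by apply: closed_measurable_rV; exact: (compact_closed (@norm_hausdorff _ _)).
  rewrite (_ : centred = (fun x => c0 + 1 *: x) @^-1` K).
    by rewrite -[X in measurable X]setTI; exact: measurable_rV_affine.
  by apply/seteqP; split => x; rewrite /centred/= scale1r.
split => //.
- have /nbhs_ballP[e /= e0 eK] := iv0.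
  apply/nbhs_ballP; exists (e / 2) => /=; first by rewrite divr_gt0.
  move=> w; rewrite -ball_normE/= sub0r normrN => we.
  (* [w] is the midpoint of this point and of the reflection of v0 - c0, so a neighbourhood of an
     arbitrary interior point yields one of 0. *)
  have H1 : centred (v0 - c0 + 2 *: w).
    rewrite /centred/= addrA (addrCA c0) subrr addr0; apply: eK.
    rewrite -ball_normE/= opprD addNKr normrN normrZ ger0_norm//.
    by rewrite mulrC -ltr_pdivlMr.
  have H2 : centred (- (v0 - c0)).
    by apply: sym; rewrite /centred/= addrC subrK; exact: nbhs_singleton iv0.
  have h : 0 <= (2^-1 : R) <= 1 by lra.
  have := cvx _ _ _ h H1 H2.
  rewrite (_ : 1 - 2^-1 = 2^-1 :> R); last lra.
  by rewrite -scalerDr addrAC subrr add0r scalerA mulVf// scale1r.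
- have [M HM] := bnd.
  apply: le_lt_trans (@ball_measure_lty R n (Num.max M 0 + 1) _).
    apply: le_measure; rewrite ?inE//.
      by apply: open_measurable_rV; exact: ball_open.
    move=> x Kx; rewrite -ball_normE/= sub0r normrN.
    by rewrite (le_lt_trans (HM _ Kx))// ltr_pwDr// le_max lexx.
  by rewrite ltr_pwDr// le_max lexx orbT.
Qed.

End centred_body.

Section maximal_operator_lower_bound.
Context {R : realType} {n : nat}.
Local Notation V := 'rV[R]_n.
Local Notation mu := (borel_lebesgue R n).
Local Notation leb := (lebesgue_rV R n).
Variables (K : set V) (c0 : V).
Hypotheses (cK : convex_body K) (sK : symmetric_about c0 K).
Local Notation K0 := (centred K c0).
Let bK0 : sym_body K0 := centred_sym_body cK sK.

Lemma body_ball_centred c r : 0 < r ->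
  [set c - r *: c0 + r *: y | y in K] = body_ball K0 c r.
Proof.
move=> r0; have rN0 : r != 0 by rewrite gt_eqF.
apply/seteqP; split => [_ [y Ky <-]|y Sy] /=.
  rewrite /body_ball /centred /=.
  rewrite (_ : _ + _ = y)//.
  by apply/rowP => i; rewrite !mxE; field.
exists (c0 + r^-1 *: (y - c)) => //.
by apply/rowP => i; rewrite !mxE; field.
Qed.

Variables (lambda : R) (f g : V -> R).
Hypotheses (lambda0 : 0 < lambda)
  (mf : measurable_fun setT (f : lebesgue_space R n -> R))
  (mg : measurable_fun setT g) (gf : forall x, 0 <= g x <= f x).

Lemma avg_le_average c r : 0 < r ->
  (avg K0 r (EFin \o g) c <= average (body_ball K0 c r) f)%E.
Proof.
move=> r0; set S := body_ball K0 c r.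
have mS : measurable S by exact: (measurable_body_ball bK0).
have g0 y : (0 <= (EFin \o g) y)%E by rewrite lee_fin; have /andP[] := gf y.
have mEg : measurable_fun setT (EFin \o g) by exact/measurable_EFinP.
have v0 : 0 < r ^+ n * vol K0 by rewrite mulr_gt0 ?exprn_gt0 ?vol_gt0.
have SE : leb S = (r ^+ n * vol K0)%:E by rewrite (lebesgue_rVE mS).2 mu_ballE.
rewrite /average SE inver gt_eqF//.
rewrite [leLHS](_ : _ = ((r ^+ n * vol K0)^-1%:E * \int[leb]_(y in S) (EFin \o g) y)%E); last first.
  rewrite ge0_integral_lebesgue_rV// (avgE bK0)// muleA -EFinM mulVf ?mul1e//.
  by rewrite gt_eqF.
apply: lee_wpmul2l; first by rewrite lee_fin invr_ge0 ltW.
apply: ge0_le_integral; first exact: (lebesgue_rVE mS).1.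
- by move=> y _; exact: g0.
- by apply: measurable_funTS; exact: measurable_lebesgue_space.
- by apply: measurable_funTS; exact/measurable_EFinP.
- by move=> y _; rewrite lee_fin; case/andP: (gf y).
Qed.

(** The ball c + r [K0] is a member of the family, [K] scaled by r and moved by c - r c0, and it is
    symmetric about c. Passing to interior points shrinks the family and g <= f lowers the averages,
    so both changes go in the required direction. *)
Lemma max_fun_le_maximal_operator x :
  (max_fun K0 lambda (EFin \o g) x <= maximal_operator lambda K f x)%E.
Proof.
apply: ge_ereal_sup => _ [[c r] /= [r0 Kx] <-].
apply: le_trans (avg_le_average c r0) _.
apply: ereal_sup_ubound; exists (body_ball K0 c r) => //; split.
  exists r => //; exists (c - r *: c0) => //.
  exact: body_ball_centred.
exists c; split.
  move=> y /(body_sym bK0); rewrite /body_ball/= -scalerN opprB mulr2n.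
  by rewrite addrAC addrK.
exists (c + lambda^-1 *: (x - c)).
  rewrite /body_ball/= addrAC subrr add0r scalerA -invfM mulrC.
  exact: interior_subset Kx.
by rewrite addrAC subrr add0r scalerA mulfV ?gt_eqF// scale1r addrC subrK.
Qed.

End maximal_operator_lower_bound.

Lemma powR_Lnorm d (T : measurableType d) (R : realType)
    (m : {measure set T -> \bar R}) (p : R) (h : T -> \bar R) :
  (forall x, (0 <= h x)%E) ->
  'N[m]_(p%:E)[h]%E = ((\int[m]_x (h x `^ p)) `^ p^-1)%E.
Proof.
by move=> h0; rewrite unlock; congr (_ `^ _)%E; apply: eq_integral => x _; rewrite gee0_abs.
Qed.

Theorem theorem1 (R : realType) (n : nat) (p lambda : R) :
  (1 <= n)%N -> 1 < p -> 0 < lambda <= 1 ->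
  exists A : R, 1 < A /\
    forall K : set 'rV[R]_n, convex_body K -> centrally_symmetric K ->
    forall f : 'rV[R]_n -> R,
      f \in Lfun (lebesgue_rV R n) p%:E -> (forall x, 0 <= f x) ->
      (A%:E * 'N[lebesgue_rV R n]_(p%:E)[EFin \o f]
        <= 'N[lebesgue_rV R n]_(p%:E)[maximal_operator lambda K f])%E.
Proof.
move=> n0 p1 lambda01.
have p0 : 0 < p by exact: lt_trans p1.
have [c c0 core] := @max_fun_powR_integral R n p lambda n0 p1 lambda01.
exists ((1 + c) `^ p^-1); split.
  rewrite [ltLHS](_ : 1 = 1 `^ p^-1); last by rewrite powR1.
  by apply: gt0_ltr_powR; rewrite ?invr_gt0 ?nnegrE//; lra.
move=> K cK [z sK] f /andP[mf finf] f0.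
have {}mf : measurable_fun setT (f : lebesgue_space R n -> R) by move: mf; rewrite inE.
have {finf} : ('N[lebesgue_rV R n]_(p%:E)[EFin \o f] < +oo)%E by move: finf; rewrite inE.
have bK := centred_sym_body cK sK.
have [g [mg gf Ng]] := borel_minorant mf f0.
have g0 x : 0 <= g x by case/andP: (gf x).
set N := max_fun (centred K z) lambda (EFin \o g).
have mEg : measurable_fun setT (EFin \o g) by exact/measurable_EFinP.
have g0E x : (0 <= (EFin \o g) x)%E by rewrite lee_fin.
have N0 x : (0 <= N x)%E by exact: max_fun_ge0.
have NM x : (N x <= maximal_operator lambda K f x)%E.
  by apply: max_fun_le_maximal_operator => //; case/andP: lambda01.
have M0 x : (0 <= maximal_operator lambda K f x)%E by exact: le_trans (NM x).
have mN : measurable_fun setT N by exact: measurable_max_fun.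
rewrite !powR_Lnorm//.
have mgp : measurable_fun setT (fun x => (g x `^ p)%:E).
  by apply/measurable_EFinP; exact: (measurableT_comp (measurable_powR p)).
have fE : (\int[lebesgue_rV R n]_x ((EFin \o f) x `^ p))%E =
    (\int[borel_lebesgue R n]_x (g x `^ p)%:E)%E.
  rewrite -(ge0_integral_lebesgue_rV measurableT mgp); last first.
    by move=> x; rewrite lee_fin powR_ge0.
  apply: ge0_ae_eq_integral; first exact: measurableT.
  - apply: (measurableT_comp (measurable_poweR p)); exact/measurable_EFinP.
  - exact: measurable_lebesgue_space.
  - by move=> x _; rewrite poweR_ge0.
  - by move=> x _; rewrite lee_fin powR_ge0.
  apply: negligibleS Ng => x /= H; apply/eqP => gfx; apply: H => _.
  by rewrite /= gfx.
move=> finf.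
have {finf} finI : (\int[borel_lebesgue R n]_x (g x `^ p)%:E < +oo)%E.
  by rewrite -fE; apply: lty_poweRy finf; rewrite invr_eq0 gt_eqF.
rewrite fE -poweR_EFin -poweRM; [|by rewrite lee_fin; lra|]; last first.
  by apply: integral_ge0 => x _; rewrite lee_fin powR_ge0.
have I0 : (0 <= \int[borel_lebesgue R n]_x (g x `^ p)%:E)%E.
  by apply: integral_ge0 => x _; rewrite lee_fin powR_ge0.
apply: gt0_ler_poweR.
- by rewrite invr_ge0 ltW.
- by rewrite in_itv/= leey mule_ge0// lee_fin; lra.
- by rewrite in_itv/= leey integral_ge0// => x _; rewrite poweR_ge0.
apply: le_trans (core _ g bK mg g0 finI) _.
rewrite -ge0_integral_lebesgue_rV//; last 2 first.
- exact: (measurableT_comp (measurable_poweR p)).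
- by move=> x; exact: poweR_ge0.
(* Measurability of the maximal operator is not established; pointwise domination of [N] is enough
   here. *)
apply: ge0_le_integralT => x; first exact: poweR_ge0.
by apply: gt0_ler_poweR; rewrite ?in_itv/= ?leey ?andbT// ltW.
Qed.
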